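(* Let $d\ge1$, $s>0$ and $p=\frac{2(d+2)}{d}$. Assume that there is a constant $C>0$ such that for all $R\ge1$ the inequality $$\|F\|_{L^{p}(\mathbb{R}^{d+1})}\le C\,R^{s}\,\Big\|\Big(\sum_{k\in\mathbb{Z}^{d}}|F_{\square_{k}}|^{2}\Big)^{1/2}\Big\|_{L^{p}(\mathbb{R}^{d+1})}$$ holds for all $F\in\mathcal{S}(\mathbb{R}^{d+1})$ with $$\mathrm{supp}\,\widehat F\subset\{(\xi,|\xi|^2+\tau)\in\mathbb{R}^d\times\mathbb{R}\;:\;|\xi|\le1,\ |\tau|\le R^{-2}\}.$$ Then $s\ge\frac d2-\frac{d+1}{p}$.
   Context: For $R\ge1$, $k\in\mathbb{Z}^d$ and $F\in\mathcal{S}(\mathbb{R}^{d+1})$, $F_{\square_k}$ denotes the sharp frequency projection of $F$ in the first $d$ frequency variables to the cube $R^{-1}(k+[0,1]^d)$, that is, $F_{\square_k}=\mathcal{F}^{-1}\big[\chi_{[0,1]^d}(R\xi-k)\,\widehat F(\xi,\sigma)\big]$ with $(\xi,\sigma)\in\mathbb{R}^d\times\mathbb{R}$, where $\chi_A$ is the indicator function of $A$ and $\mathcal{F}$ is the Fourier transform on $\mathbb{R}^{d+1}$. *)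

(* Defs.v *)
From HB Require Import structures.
From mathcomp Require Import all_boot all_order all_algebra.
From mathcomp Require Import all_classical all_reals all_analysis complex.
Set Implicit Arguments.
Unset Strict Implicit.
Unset Printing Implicit Defensive.
Import Order.TTheory GRing.Theory Num.Theory.
Import numFieldNormedType.Exports.
Local Open Scope classical_set_scope.
Local Open Scope ring_scope.

(* The sigma-algebra on row vectors generated by the coordinate maps; over a
   realType this is the Borel sigma-algebra of R^n. *)
Section measurable_rV.
Context d (T : measurableType d) (n : nat).

Let coord (i : 'I_n) (v : 'rV[T]_n) : T := v ord0 i.

Let rV_set0 : g_sigma_preimage coord set0.
Proof. exact: sigma_algebra0. Qed.

Let rV_setC A : g_sigma_preimage coord A -> g_sigma_preimage coord (~` A).
Proof. exact: sigma_algebraC. Qed.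

Let rV_bigcup (F : (set 'rV[T]_n)^nat) :
  (forall i, g_sigma_preimage coord (F i)) ->
  g_sigma_preimage coord (\bigcup_i (F i)).
Proof. exact: sigma_algebra_bigcup. Qed.

HB.instance Definition _ := @isMeasurable.Build (measure_tuple_display d)
  'rV[T]_n (g_sigma_preimage coord) rV_set0 rV_setC rV_bigcup.

Lemma measurable_coord (i : 'I_n) :
  measurable_fun [set: 'rV[T]_n] (fun v => v ord0 i).
Proof.
move=> _ Y mY; rewrite setTI; apply: sub_sigma_algebra => /=.
rewrite -bigcup_seq/=; exists i => /=; first by rewrite mem_index_enum.
by exists Y => //; rewrite setTI.
Qed.

Lemma measurable_fun_rV d' (S : measurableType d') (f : S -> 'rV[T]_n) :
  (forall i, measurable_fun [set: S] (fun s => f s ord0 i)) ->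
  measurable_fun [set: S] f.
Proof.
move=> mf _ A; rewrite setTI.
have : preimage_set_system [set: S] f (g_sigma_preimage coord) `<=` measurable.
  rewrite -g_sigma_preimage_comp; apply: smallest_sub.
    exact: sigma_algebra_measurable.
  rewrite -bigcup_seq; apply: bigcup_sub => i _.
  by move=> B [C mC <-]; exact: mf.
by move=> + mA; apply; exists A => //; rewrite setTI.
Qed.

End measurable_rV.

(* The library only exports this instance for subprobabilities. *)
Lemma product_sigma_finite d1 d2 (T1 : measurableType d1)
    (T2 : measurableType d2) (R : realType)
    (m1 : {sigma_finite_measure set T1 -> \bar R})
    (m2 : {sigma_finite_measure set T2 -> \bar R}) :
  sigma_finite setT (m1 \x m2)%E.
Proof.
have /sigma_finiteP[F [TF ndF Foo]] := sigma_finiteT m1.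
have /sigma_finiteP[G [TG ndG Goo]] := sigma_finiteT m2.
exists (fun n => F n `*` G n).
  rewrite -setXTT TF TG predeqE => -[x y]; split.
    move=> [/= [n _ Fnx] [k _ Gky]]; exists (maxn n k) => //; split.
    - by move: x Fnx; exact/subsetPset/ndF/leq_maxl.
    - by move: y Gky; exact/subsetPset/ndG/leq_maxr.
  by move=> [n _ []/= ? ?]; split; exists n.
move=> k; have [? ?] := Foo k; have [? ?] := Goo k.
split; first exact: measurableX.
by rewrite product_measure1E// lte_mul_pinfty// ge0_fin_numE.
Qed.

Section lebesgue_rV.
Context {K : realType}.

Definition consrV n (x : measurableTypeR K * 'rV[K]_n) : 'rV[K]_n.+1 :=
  row_mx (x.1%:M : 'rV[K]_1) x.2.

Lemma consrV0 n x : @consrV n x ord0 ord0 = x.1.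
Proof.
rewrite /consrV (_ : ord0 = lshift n (ord0 : 'I_1)); last exact/val_inj.
by rewrite [LHS](@row_mxEl _ 1 1 n) mxE.
Qed.

Lemma consrVS n x i : @consrV n x ord0 (lift ord0 i) = x.2 ord0 i.
Proof.
rewrite /consrV (_ : lift ord0 i = rshift 1 i); last exact/val_inj.
by rewrite [LHS](@row_mxEr _ 1 1 n).
Qed.

Lemma measurable_consrV n : measurable_fun [set: _] (@consrV n).
Proof.
apply: measurable_fun_rV => i; case: (unliftP ord0 i) => [j|] ->.
  under eq_fun do rewrite consrVS.
  apply: (@measurableT_comp _ _ _ _ _ _ (fun v : 'rV[K]_n => v ord0 j)) => //.
  exact: measurable_coord.
by under eq_fun do rewrite consrV0; exact: measurable_fst.
Qed.

HB.instance Definition _ n :=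
  isMeasurableFun.Build _ _ _ _ (@consrV n) (@measurable_consrV n).

Section lebesgueS.
Variables (n : nat) (mu : {sigma_finite_measure set 'rV[K]_n -> \bar K}).

Definition lebesgueS : set 'rV[K]_n.+1 -> \bar K :=
  pushforward (lebesgue_measure \x mu)%E (@consrV n).

Let lebesgueS0 : lebesgueS set0 = 0%E.
Proof. exact: measure0. Qed.

Let lebesgueS_ge0 A : (0 <= lebesgueS A)%E.
Proof. exact: measure_ge0. Qed.

Let lebesgueS_sigma_additive : semi_sigma_additive lebesgueS.
Proof. exact: measure_semi_sigma_additive. Qed.

HB.instance Definition _ := isMeasure.Build _ _ _ lebesgueS
  lebesgueS0 lebesgueS_ge0 lebesgueS_sigma_additive.

Let lebesgueS_sigma_finite : sigma_finite setT lebesgueS.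
Proof.
pose unconsrV (v : 'rV[K]_n.+1) : measurableTypeR K * 'rV[K]_n :=
  (v ord0 ord0, \row_j v ord0 (lift ord0 j)).
have consrVK x : unconsrV (consrV x) = x.
  rewrite [RHS]surjective_pairing /unconsrV consrV0; congr pair.
  by apply/rowP => j; rewrite mxE consrVS.
have munconsrV : measurable_fun [set: _] unconsrV.
  apply: measurable_fun_pair; first exact: measurable_coord.
  apply: measurable_fun_rV => j.
  under eq_fun do rewrite mxE.
  exact: measurable_coord.
have [F FT Foo] := product_sigma_finite lebesgue_measure mu.
exists (fun k => unconsrV @^-1` F k).
  by rewrite -preimage_bigcup -FT preimage_setT.
move=> k; have [mF Fk] := Foo k; split.
  by rewrite -[X in measurable X]setTI; exact: munconsrV.
rewrite /lebesgueS /pushforward -comp_preimage.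
by rewrite (_ : unconsrV \o _ = id) ?preimage_id//; apply/funext.
Qed.

HB.instance Definition _ := Measure_isSigmaFinite.Build _ _ _ lebesgueS
  lebesgueS_sigma_finite.

End lebesgueS.

(* Lebesgue measure on R^n: the n-fold product of lebesgue_measure; its values on
   boxes are given by lebesgue_rV_box. *)
Fixpoint lebesgue_rV n : {sigma_finite_measure set 'rV[K]_n -> \bar K} :=
  match n with
  | 0 => \d_(0 : 'rV[K]_0)
  | m.+1 => lebesgueS (lebesgue_rV m)
  end.

Lemma lebesgue_rV_box n (A : 'I_n -> set K) :
  (forall i, measurable (A i)) ->
  lebesgue_rV n [set v : 'rV[K]_n | forall i, A i (v ord0 i)] =
  (\prod_(i < n) lebesgue_measure (A i))%E.
Proof.
elim: n A => [|n IHn] A mA.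
  rewrite big_ord0 /= diracE mem_set//=; by case.
rewrite big_ord_recl -IHn; last by move=> i; exact: mA.
rewrite -product_measure1E//.
- rewrite /= /lebesgueS /pushforward; congr product_measure1.
  apply/seteqP; split => [x /= Ax|x /= [A0 AS] i].
    split; first by have := Ax ord0; rewrite consrV0.
    by move=> i; have := Ax (lift ord0 i); rewrite consrVS.
  by case: (unliftP ord0 i) => [j|] ->; rewrite ?consrV0 ?consrVS.
- exact: mA.
- rewrite (_ : [set v : 'rV[K]_n | forall i, A (lift ord0 i) (v ord0 i)] =
    \bigcap_(i in [set: 'I_n]) [set v | A (lift ord0 i) (v ord0 i)]); last first.
    by apply/seteqP; split => x /= Ax => [i _|i]; exact: Ax.
  apply: fin_bigcap_measurable => // i _.
  rewrite -[X in measurable X]setTI.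
  exact: (@measurable_coord _ K n i measurableT _ (mA (lift ord0 i))).
Qed.

End lebesgue_rV.

(* R^(d+1) is represented as the product R^d * R; the last factor carries the
   time variable, resp. the frequency variable dual to it. *)
Section space_time.
Context {K : realType} (d : nat).

Definition lebesgue_st : set ('rV[K]_d * measurableTypeR K) -> \bar K :=
  (lebesgue_rV d \x lebesgue_measure)%E.

HB.instance Definition _ := Measure.on lebesgue_st.
HB.instance Definition _ := Measure_isSigmaFinite.Build _ _ _ lebesgue_st
  (product_sigma_finite (lebesgue_rV d) lebesgue_measure).

Local Notation E := ('rV[K]_d * K)%type.

Definition dotrV (x y : 'rV[K]_d) : K := \sum_(i < d) x ord0 i * y ord0 i.

(* The Euclidean norm; the library norm `|x| on 'rV[K]_d is the sup norm. *)
Definition enorm (x : 'rV[K]_d) : K := Num.sqrt (dotrV x x).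

Definition dot_st (x y : E) : K := dotrV x.1 y.1 + x.2 * y.2.

Definition iter_derive (vs : seq E) (f : E -> K) : E -> K :=
  foldr (fun v g => 'D_v g) f vs.

(* Directions range over all vectors instead of the coordinate vectors only, and
   the weight is a power of 1 + `|x| for the sup norm `|x|; for smooth functions
   this yields the usual family of seminorms sup |x^a D^b f|, up to finite linear
   combinations. *)
Definition schwartz_real (f : E -> K) : Prop :=
  forall vs : seq E,
    (forall x, differentiable (iter_derive vs f) x) /\
    (forall N : nat, exists M : K,
       forall x, (1 + `|x|) ^+ N * `|iter_derive vs f x| <= M).

Definition schwartz (F : E -> K[i]) : Prop :=
  schwartz_real (fun x => complex.Re (F x)) /\
  schwartz_real (fun x => complex.Im (F x)).

Definition Cintegral (f : E -> K[i]) : K[i] :=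
  Complex (\int[lebesgue_st]_x complex.Re (f x))%R
          (\int[lebesgue_st]_x complex.Im (f x))%R.

Definition expi (t : K) : K[i] := Complex (cos t) (sin t).

(* The Fourier transform is normalized with the kernel exp(- 2 i pi x.z), so that
   inv_fourier is its inverse. *)
Definition fourier (F : E -> K[i]) (z : E) : K[i] :=
  Cintegral (fun x => F x * expi (- (2 * pi * dot_st x z))).

Definition inv_fourier (G : E -> K[i]) (x : E) : K[i] :=
  Cintegral (fun z => G z * expi (2 * pi * dot_st x z)).

Definition unit_cube : set 'rV[K]_d :=
  [set x | forall i, 0 <= x ord0 i <= 1].

(* Sharp projection to the slab {z | z.1 in R^-1 (k + [0,1]^d)}. *)
Definition freq_proj (R : K) (k : 'rV[int]_d) (F : E -> K[i]) : E -> K[i] :=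
  inv_fourier (fun z =>
    (\1_unit_cube (R *: z.1 - map_mx intr k))%:C%C * fourier F z).

(* (sum_k |F_k|^2)^(1/2); extended-real valued, as k ranges over all of Z^d. *)
Definition square_fun (R : K) (F : E -> K[i]) (x : E) : \bar K :=
  ((\esum_(k in [set: 'rV[int]_d])
     (Normc.normc (freq_proj R k F x) ^+ 2)%:E) `^ 2^-1)%E.

Definition fsupp (G : E -> K[i]) : set E := closure [set z | G z != 0].

Definition paraboloid_nbhd (R : K) : set E :=
  [set z | exists (xi : 'rV[K]_d) (tau : K),
    [/\ enorm xi <= 1, `|tau| <= R ^- 2
      & z = (xi, enorm xi ^+ 2 + tau)]].

End space_time.

Arguments lebesgue_st {K} d _.
Arguments unit_cube {K} d _.
Arguments paraboloid_nbhd {K} d R _.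

(* Main.v *)
(* The inequality is tested on a sum of Knapp wave packets focusing at the origin.  For
   R = d n, let the Fourier transform of F be b(R^2 (sigma - |xi|^2)) prod_i c(xi_i), where
   b is a smooth bump on [0,1] and c = sum_(k < n) b(R xi - k); then |xi| <= 1 on the
   support, and each F_square_k with k in {0,...,n-1}^d is one wave packet.  For (x,t)
   in a fixed small box all the packets are in phase, so |F| >= c R^-2 there and
   ||F||_p^p >= c R^(-2p).  A single packet has size R^(-d-2) and lives in the tube
   |x + 2tk/R| <= R, |t| <= R^2.  At time t the square function is thus controlled by
   products of sums of Lorentzians 1/(1 + (x/R + 2tk/R^2)^2), k < n, which are at most
   C min(R, R^2/|t|) and have integral n pi R in x; since p/2 = 1 + 2/d, this gives
   ||(sum |F_square_k|^2)^(1/2)||_p^p <= C R^(-(d+2)p + 2d+3).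
   As dp = 2d+4, the inequality becomes c <= C R^(sp-1) for all such R, hence
   s >= 1/p = d/2 - (d+1)/p. *)
Require Import Defs.
From HB Require Import structures.
From mathcomp Require Import all_boot all_order all_algebra.
From mathcomp Require Import all_classical all_reals all_analysis complex.
From mathcomp Require Import measurable_realfun ring lra.
Set Implicit Arguments.
Unset Strict Implicit.
Unset Printing Implicit Defensive.
Import Order.TTheory GRing.Theory Num.Theory.
Import numFieldNormedType.Exports.
Local Open Scope classical_set_scope.
Local Open Scope ring_scope.

(** * Smooth functions *)

(** The spectrum of F is not a tensor product, but after integration in sigma the shear by |xi|^2
    becomes the factor exp(2 pi i t |xi|^2), which splits over the coordinates. F and its
    projections are therefore products of d + 1 one-dimensional integrals of exp(i (u x + w x^2))
    against a bump, and the analysis is one-dimensional. F is written down on the physical side, so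
    its Fourier transform is computed by an inversion theorem, proved in one variable with an Abel
    factor. The relation R = d n keeps each coordinate of xi in [0, 1/d], whence |xi| <= 1, while
    the number of packets per coordinate stays proportional to R. In the upper bound the obstacle is
    the power p/2 = 1 + 2/d of the product of Lorentzian sums: one full power is integrated exactly
    in x, and the power 2/d is bounded uniformly in x. The one-dimensional bounds lose powers of 1 +
    |t|/R^2; the smoothness of b gives enough decay in t to absorb them. The bumps vanish at the
    ends of their intervals, so the sharp projections keep smooth spectra. *)

Section quadratic_differentiability.
Context {K : realType} {V : normedModType K}.

(** A quadratic remainder suffices to identify a differential. [J_taylor] bounds such a remainder
    inside the integral, which replaces differentiation under the integral sign. *)
Lemma differentiable_quadratic (f L : V -> K) (M C : K) (x : V) :
  (forall a u v, L (a *: u + v) = a * L u + L v) ->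
  (forall v, `|L v| <= M * `|v|) ->
  (forall h, `|f (x + h) - f x - L h| <= C * `|h| ^+ 2) ->
  differentiable f x /\ forall v, 'D_v f x = L v.
Proof.
move=> Llin LM fq.
pose Lm := GRing.isLinear.Build K V K *%R L Llin.
pose L' : {linear V -> K} := HB.pack L Lm.
have cL : continuous L'.
  have H : bounded_near L' (nbhs (0 : V)).
    apply/linear_boundedP; exists `|M|; split; first exact: num_real.
    move=> N MN y /=; rewrite (le_trans (LM y))// ler_wpM2r//.
    by rewrite (le_trans (ler_norm _))// ltW.
  exact: (bounded_linear_continuous H).
have fL : f \o shift x = cst (f x) + L' +o_ 0 id.
  apply/eqaddoP => _/posnumP[e].
  have C1 : 0 < `|C| + 1 by rewrite ltr_wpDl.
  have e1 : 0 < e%:num / (`|C| + 1) by exact: divr_gt0.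
  have nh : \forall h \near (0 : V), `|h| <= e%:num / (`|C| + 1) .
    by apply/nbhs_norm0P; exists (e%:num / (`|C| + 1)) => //= h; rewrite /ball_/= => /ltW.
  move: nh; apply: filterS => h /= hle.
  rewrite /= !fctE /= [h + x]addrC opprD addrA (le_trans (fq h))// expr2 mulrA.
  rewrite ler_wpM2r//.
  rewrite (@le_trans _ _ ((`|C| + 1) * `|h|))//.
    by rewrite ler_wpM2r// (le_trans (ler_norm _))// lerDl.
  rewrite mulrC -ler_pdivlMr//.
have dE := diff_unique cL fL.
have df : differentiable f x.
  by apply/diff_locallyP; rewrite dE; split.
by split=> // v; rewrite deriveE// dE.
Qed.

End quadratic_differentiability.

Lemma is_derive_quadratic (K : realType) (f : K -> K) (l C x : K) :
  (forall h, `|f (x + h) - f x - l * h| <= C * h ^+ 2) ->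
  is_derive x 1 f l.
Proof.
move=> H; have [] := @differentiable_quadratic K K f (fun h => l * h) `|l| C x.
- by move=> a u v; rewrite /GRing.scale/=; ring.
- by move=> v; rewrite normrM.
- by move=> h; rewrite (le_trans (H h))// real_normK// num_real.
move=> df dE; apply: DeriveDef; first exact: diff_derivable.
by rewrite dE mulr1.
Qed.

Section smooth.
Context {K : realType}.
Implicit Types (f g : K -> K) (n : nat).

Fixpoint n_derivable n f : Prop :=
  if n is m.+1 then (forall x : K, derivable f x 1) /\ n_derivable m (derive1 f) else True.

Definition smooth f := forall n, n_derivable n f.

Lemma n_derivableW n f : n_derivable n.+1 f -> n_derivable n f.
Proof. by elim: n f => //= n IH f [df /IH]. Qed.

Lemma smooth_derivable f : smooth f -> forall x, derivable f x 1.
Proof. by move=> /(_ 1)[]. Qed.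

Lemma smooth_continuous f : smooth f -> continuous f.
Proof.
move=> sf x; apply/differentiable_continuous/derivable1_diffP.
exact: smooth_derivable.
Qed.

Lemma smooth_derive1 f : smooth f -> smooth (derive1 f).
Proof. by move=> sf n; have [] := sf n.+1. Qed.

Lemma derive1D_fun f g : (forall x : K, derivable f x 1) -> (forall x : K, derivable g x 1) ->
  derive1 (f \+ g) = (derive1 f) \+ (derive1 g).
Proof.
move=> df dg; apply/funext => x.
by rewrite -[f \+ g]/(f + g) derive1E deriveD// -!derive1E.
Qed.

Lemma derive1M_fun f g : (forall x : K, derivable f x 1) -> (forall x : K, derivable g x 1) ->
  derive1 (f \* g) = ((derive1 f) \* g) \+ (f \* (derive1 g)).
Proof.
move=> df dg; apply/funext => x.
rewrite -[f \* g]/(f * g) derive1E deriveM// -!derive1E /GRing.scale/=.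
by rewrite addrC mulrC.
Qed.

Lemma n_derivableD n f g : n_derivable n f -> n_derivable n g -> n_derivable n (f \+ g).
Proof.
elim: n f g => //= n IH f g [df sf] [dg sg]; split.
  by move=> x; apply: derivableD.
by rewrite derive1D_fun//; exact: IH.
Qed.

Lemma smoothD f g : smooth f -> smooth g -> smooth (f \+ g).
Proof. by move=> sf sg n; exact: n_derivableD. Qed.

Lemma n_derivableM n f g : n_derivable n f -> n_derivable n g -> n_derivable n (f \* g).
Proof.
elim: n f g => // n IH f g sf sg.
have [df sf'] := sf; have [dg sg'] := sg; split.
  by move=> x; apply: derivableM.
rewrite derive1M_fun//.
by apply: n_derivableD; apply: IH => //; exact: n_derivableW.
Qed.

Lemma smoothM f g : smooth f -> smooth g -> smooth (f \* g).
Proof. by move=> sf sg n; exact: n_derivableM. Qed.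

Lemma smooth_cst (c : K) : smooth (cst c).
Proof.
move=> n; elim: n c => //= n IH c; split; first by move=> x; exact: derivable_cst.
rewrite (_ : derive1 _ = cst 0)//.
by apply/funext => x; rewrite derive1_cst.
Qed.

Lemma smooth_id : smooth (fun x : K => x).
Proof.
case => //= n; split; first by move=> x; exact: derivable_id.
rewrite (_ : derive1 _ = (cst 1 : K -> K)); first exact: smooth_cst.
by apply/funext => x; rewrite derive1_id.
Qed.

Lemma derive1_affine f (a c : K) : (forall x : K, derivable f x 1) ->
  derive1 (fun x => f (a * x + c)) = (cst a) \* (fun x => (derive1 f) (a * x + c)).
Proof.
move=> df; apply/funext => x.
have dg : is_derive x 1 (fun x : K => a * x + c) a.
  apply: (@is_derive_quadratic K _ a 0) => h.
  by rewrite (_ : _ - _ - _ = 0) ?normr0 ?mul0r//; ring.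
have df' := derivableP (df (a * x + c)).
have [_] := @is_derive1_comp K f (fun x : K => a * x + c) x _ _ df' dg.
by rewrite -derive1E => ->; rewrite /= derive1E mulrC.
Qed.

Lemma smooth_affine f (a c : K) : smooth f -> smooth (fun x => f (a * x + c)).
Proof.
move=> sf n; elim: n f sf => //= n IH f sf; split.
  move=> x; apply/derivable1_diffP.
  apply: (@differentiable_comp _ _ _ _ (fun x : K => a * x + c)) => //.
  exact/derivable1_diffP/smooth_derivable.
rewrite derive1_affine; last exact: smooth_derivable.
apply: n_derivableM; first exact: smooth_cst.
by apply: IH; exact: smooth_derive1.
Qed.

End smooth.

(** * Uniform Taylor estimates for sine and cosine *)

Section trig_taylor.
Context {K : realType}.
Lemma MVT_derive (f df : K -> K) : (forall x : K, is_derive x 1 f (df x)) ->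
  forall a b, exists c, (a <= c <= b \/ b <= c <= a) /\ f b - f a = df c * (b - a).
Proof.
move=> fdf a b.
have cf : continuous f.
  by move=> x; apply/differentiable_continuous/derivable1_diffP; have [] := fdf x.
case: (leP a b) => ab.
  have [//|c cab ->] := @MVT_segment K f df a b ab.
    exact: continuous_subspaceT.
  by exists c; split=> //; left; rewrite in_itv/= in cab.
have [//|c cab fE] := @MVT_segment K f df b a (ltW ab).
  exact: continuous_subspaceT.
exists c; split; first by right; rewrite in_itv/= in cab.
by rewrite -opprB fE -mulrN opprB.
Qed.

Lemma sin_norm_le1 (h : K) : `|sin h| <= 1.
Proof. by rewrite ler_norml sin_geN1 sin_le1. Qed.
Lemma cos_norm_le1 (h : K) : `|cos h| <= 1.
Proof. by rewrite ler_norml cos_geN1 cos_le1. Qed.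

Lemma abs_sin_le (h : K) : `|sin h| <= `|h|.
Proof.
have [c [_]] := MVT_derive (@is_derive_sin K) 0 h.
rewrite sin0 !subr0 => ->; rewrite normrM.
by rewrite ler_piMl// cos_norm_le1.
Qed.
Lemma abs_cosB1_le (h : K) : `|cos h - 1| <= h ^+ 2.
Proof.
have [c [ch]] := MVT_derive (@is_derive_cos K) 0 h.
rewrite cos0 !subr0 => ->; rewrite normrM normrN -(real_normK (num_real h)) expr2.
rewrite ler_wpM2r// (le_trans (abs_sin_le _))//.
rewrite ler_norml; have := ler_norm h; have := ler_norm (-h); rewrite normrN; lra.
Qed.
Lemma cos_lipschitz (u v : K) : `|cos u - cos v| <= `|u - v|.
Proof.
have [c [ch ->]] := MVT_derive (@is_derive_cos K) v u.
by rewrite normrM ler_piMl// normrN sin_norm_le1.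
Qed.
Lemma abs_sinB_le (h : K) : `|sin h - h| <= h ^+ 2.
Proof.
have D (x : K) : is_derive x 1 (fun x : K => sin x - x) (cos x - 1).
  exact: is_deriveB (is_derive_sin x) (is_derive_id x 1).
have [c [ch]] := MVT_derive D 0 h.
rewrite sin0 !subr0 => ->; rewrite normrM -(real_normK (num_real h)) expr2.
rewrite ler_wpM2r// -cos0 (le_trans (cos_lipschitz _ _))// subr0.
rewrite ler_norml; have := ler_norm h; have := ler_norm (-h); rewrite normrN; lra.
Qed.
(** The constant is independent of the base point [u], so the estimate can be integrated against any
    amplitude. It is 2 because |cos h - 1| and |sin h - h| are each at most h^2. *)
Lemma cos_taylor (u h : K) : `|cos (u + h) - cos u + h * sin u| <= 2 * h ^+ 2.
Proof.
rewrite cosD.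
have -> : cos u * cos h - sin u * sin h - cos u + h * sin u =
  cos u * (cos h - 1) - sin u * (sin h - h) by ring.
rewrite (le_trans (ler_normB _ _))// !normrM mulr_natl mulr2n lerD//.
  by rewrite (le_trans _ (abs_cosB1_le _))// ler_piMl// cos_norm_le1.
by rewrite (le_trans _ (abs_sinB_le _))// ler_piMl// sin_norm_le1.
Qed.
End trig_taylor.

(** * A smooth bump on the unit interval *)

Section flat.
Context {K : realType}.
Implicit Types P Q : {poly K}.

(** The polynomial factor makes the family closed under differentiation: with y = 1/x one has d/dx =
    - y^2 d/dy, so P(y) exp(-y) becomes y^2 (P - P')(y) exp(-y). Smoothness is then an induction in
    which [P] varies. *)
Definition flat P (x : K) : K := if 0 < x then P.[x^-1] * expR (- x^-1) else 0.

Lemma pow_expR_bounded n : exists C : K, forall y, 0 <= y -> y ^+ n * expR (- y) <= C.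
Proof.
exists n`!%:R => y y0.
rewrite expRN ler_pdivrMr ?expR_gt0//.
case: n => [|n]; first by rewrite expr0 fact0 mul1r -expR0 ler_expR.
rewrite mulrC -ler_pdivrMr ?ltr0n ?fact_gt0//.
by rewrite (le_trans _ (expR_ge1Dxn n y0))// lerDr.
Qed.

Lemma poly_expR_bounded P : exists C : K, forall y, 0 <= y -> `|P.[y] * expR (- y)| <= C.
Proof.
have [F HF] := choice pow_expR_bounded.
exists (\sum_(i < size P) `|P`_i| * F i) => y y0.
rewrite horner_coef mulr_suml (le_trans (ler_norm_sum _ _ _))//.
apply: ler_sum => i _; rewrite -mulrA normrM ler_wpM2l//.
by rewrite ger0_norm ?HF// mulr_ge0 ?exprn_ge0 ?expR_ge0.
Qed.

Lemma is_derive_flat P (x : K) :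
  is_derive x 1 (flat P) (flat ('X^2 * (P - P^`())) x).
Proof.
have [x0|x0] := ltP 0 x.
  have N : \near x, P.[x^-1] * expR (- x^-1) = flat P x.
    near=> y; rewrite /flat ifT//; near: y.
    exact: lt_nbhsr.
  apply: (near_eq_is_derive N).
  rewrite /flat x0.
  have xn0 : x != 0 by rewrite gt_eqF.
  have dP (y : K) : is_derive y 1 (horner P) P^`().[y].
    by apply: DeriveDef; rewrite ?derivable_horner// -derive1E derivE.
  have dE (y : K) : is_derive y 1 (fun y : K => expR (- y)) (- expR (- y)).
    have := @is_derive1_comp K (@expR K) -%R y (expR (- y)) (-1).
    rewrite mulrN1; apply.
  have dPE (y : K) : is_derive y 1 (fun y : K => P.[y] * expR (- y))
      ((P^`() - P).[y] * expR (- y)).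
    have := is_deriveM (dP y) (dE y).
    move=> [D1 D2]; apply: DeriveDef; first exact: D1.
    rewrite [LHS]D2 /GRing.scale/= !hornerE; ring.
  have := is_derive1_comp (dPE x^-1) (is_deriveV xn0 (is_derive_id x 1)).
  move=> [D1 D2]; apply: DeriveDef; first exact: D1.
  rewrite [LHS]D2 [(- x ^- 2)%:A]mulr1 !hornerE.
  move: (P.[x^-1]) (P^`().[x^-1]) (expR _) => p q e; by field.
(* For x <= 0, boundedness of y^2 P(y) exp(-y) gives |flat P (x + h)| <= C (x + h)^2 <= C h^2 as
   soon as x + h > 0, so the derivative is 0, also at the gluing point. *)
have [C HC] := poly_expR_bounded ('X^2 * P).
rewrite [X in is_derive _ _ _ X](_ : _ = 0); last by rewrite /flat ltNge x0.
apply: (@is_derive_quadratic K _ 0 C).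
move=> h; rewrite mul0r subr0 [X in _ - X](_ : _ = 0) ?subr0; last by rewrite /flat ltNge x0.
have C0 : 0 <= C by apply: le_trans (HC 0 _).
rewrite /flat; case: ltP => xh; last by rewrite normr0 mulr_ge0// sqr_ge0.
have h0 : 0 < h by lra.
have := HC (x + h)^-1; rewrite invr_ge0 (ltW xh) => /(_ isT).
rewrite hornerM hornerXn -mulrA normrM => H.
rewrite -ler_pdivrMr ?exprn_gt0//; apply: le_trans H.
rewrite mulrC ler_wpM2r// ger0_norm ?exprn_ge0 ?invr_ge0 ?(ltW xh)// exprVn.
rewrite lef_pV2 ?posrE ?exprn_gt0// lerXn2r ?nnegrE ?(ltW xh) ?(ltW h0)//; lra.
Unshelve. all: by end_near. Qed.

Lemma smooth_flat P : smooth (flat P).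
Proof.
move=> n; elim: n P => //= n IH P; split.
  by move=> x; have [] := is_derive_flat P x.
rewrite (_ : derive1 _ = flat ('X^2 * (P - P^`()))) ?IH//.
by apply/funext => x; rewrite derive1E; have [_ ->] := is_derive_flat P x.
Qed.

Definition unit_bump (x : K) : K := flat 1 x * flat 1 (1 - x).

Lemma smooth_unit_bump : smooth unit_bump.
Proof.
apply: smoothM; first exact: smooth_flat.
rewrite (_ : (fun x => _) = (fun x => flat 1 (-1 * x + 1))).
  exact/smooth_affine/smooth_flat.
by apply/funext => x; congr flat; ring.
Qed.

Lemma unit_bump_ge0 x : 0 <= unit_bump x.
Proof.
rewrite /unit_bump /flat mulr_ge0//; case: ifP => // _;
by rewrite hornerC mul1r expR_ge0.
Qed.

Lemma unit_bump_eq0 x : ~~ (0 < x < 1) -> unit_bump x = 0.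
Proof.
rewrite /unit_bump /flat; case: ltP => x0; last by rewrite mul0r.
by rewrite subr_gt0; case: ltP => //; rewrite mulr0.
Qed.
End flat.

(** * Oscillatory integrals *)

Section compact_support.
Context {K : realType}.
Notation mu := (@lebesgue_measure K).
Implicit Types (f g Phi : K -> K).

Lemma compact_support_integral (f : K -> K) (a b M : K) : a <= b ->
  measurable_fun setT f -> (forall x, `|f x| <= M) ->
  (forall x, x \notin `[a, b] -> f x = 0) ->
  mu.-integrable setT (EFin \o f) /\ `|\int[mu]_x f x| <= M * (b - a).
Proof.
move=> ab mf fM f0.
have fE : f = f \_ `[a, b].
  apply/funext => x; rewrite patchE; case: ifPn => //; rewrite notin_setE => h.
  by apply: f0; apply/negP.
have M0 : 0 <= M by apply: le_trans (fM 0).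
have muab : mu `[a, b] = (b - a)%:E.
  by rewrite lebesgue_measure_itv/= lte_fin; case: ltgtP ab => // -> _; rewrite subrr.
have iab : mu.-integrable `[a, b] (EFin \o f).
  apply: measurable_bounded_integrable => //.
  - by rewrite [X in (X < _)%E]muab ltry.
  - exact: measurable_funS mf.
  - by exists M; split; [exact: num_real|move=> y My x _ /=; exact: le_trans (fM x) (ltW My)].
split.
  rewrite fE -restrict_EFin; apply/integrable_restrict => //=; rewrite ?setTI//.
rewrite fE -Rintegral_mkcond (le_trans (le_normr_Rintegral _ _))//.
have -> : M * (b - a) = \int[mu]_(x in `[a, b]) M.
  by rewrite Rintegral_cst//= [X in fine X]muab.
apply: le_Rintegral => //.
  exact: integrable_norm.
apply: measurable_bounded_integrable => //.
- by rewrite [X in (X < _)%E]muab ltry.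
- by exists `|M|; split=> [|y My x _ /=]; [exact: num_real|exact: ltW].
Qed.

Lemma integral_derive_compact_support (F f : K -> K) (A : K) : 0 < A ->
  (forall x : K, is_derive x 1 F (f x)) -> continuous f ->
  (forall x, A <= `|x| -> F x = 0) -> \int[mu]_x f x = 0.
Proof.
move=> A0 dF cf F0.
have cF : continuous F.
  by move=> x; apply/differentiable_continuous/derivable1_diffP; have [] := dF x.
have f0 x : A < `|x| -> f x = 0.
  move=> Ax; have [_ <-] := dF x.
  rewrite (@near_eq_derive _ _ _ F (cst 0)) ?derive_cst//.
  near=> y; rewrite F0//; apply/ltW; near: y.
  have := @norm_continuous _ _ x => /(_ _ (lt_nbhsr Ax)).
  by [].
have fE : f = f \_ `[-A, A].
  apply/funext => x; rewrite patchE; case: ifPn => //; rewrite notin_setE => h.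
  apply: f0; rewrite ltNge ler_norml; apply/negP => h'; apply: h.
  by rewrite /= in_itv.
have AA : - A < A by lra.
rewrite fE -Rintegral_mkcond /Rintegral.
rewrite (@continuous_FTC2 _ f F)//=.
- by rewrite !F0 ?subrr// ?normrN ger0_norm// ltW.
- exact: continuous_subspaceT.
- split.
  + by move=> x _; have [] := dF x.
  + by apply: cvg_at_right_filter; exact: cF.
  + by apply: cvg_at_left_filter; exact: cF.
- by move=> x _; rewrite derive1E; have [_ ->] := dF x.
Unshelve. all: by end_near. Qed.

Definition testfun Phi :=
  smooth Phi /\ exists2 A : K, 0 < A & forall x, A <= `|x| -> Phi x = 0.

Lemma testfun_smooth Phi : testfun Phi -> smooth Phi. Proof. by case. Qed.

Lemma testfun_continuous Phi : testfun Phi -> continuous Phi.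
Proof. by case=> /smooth_continuous. Qed.

Lemma testfun_measurable Phi : testfun Phi -> measurable_fun setT Phi.
Proof. by move=> /testfun_continuous; exact: continuous_measurable_fun. Qed.

Lemma testfun_bounded Phi : testfun Phi -> exists2 M : K, 0 <= M & forall x, `|Phi x| <= M.
Proof.
move=> tPhi; have cPhi := testfun_continuous tPhi; case: tPhi => _ [A A0 HA].
have AA : - A <= A by lra.
have [|c _ Hc] := @EVT_max K (fun x => `|Phi x|) _ _ AA.
  apply: continuous_subspaceT => x.
  by apply: continuous_comp; [exact: cPhi|exact: norm_continuous].
exists `|Phi c| => // x; have [xA|xA] := leP A `|x|.
  by rewrite HA// normr0.
by apply: Hc; rewrite in_itv/= -ler_norml ltW.
Qed.

Lemma testfun_derive1 Phi : testfun Phi -> testfun (derive1 Phi).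
Proof.
move=> [sPhi [A A0 HA]]; split; first exact: smooth_derive1.
exists (A + 1); first by rewrite addr_gt0.
move=> x Ax; rewrite derive1E.
rewrite (@near_eq_derive _ _ _ Phi (cst 0)) ?derive_cst//.
near=> y; rewrite HA//; apply/ltW; near: y.
have Ax1 : A < `|x| by rewrite (lt_le_trans _ Ax)// ltrDl.
exact: (@norm_continuous _ _ x _ (lt_nbhsr Ax1)).
Unshelve. all: by end_near. Qed.

Lemma testfunMl f Phi : smooth f -> testfun Phi -> testfun (f \* Phi).
Proof.
move=> sf [sPhi [A A0 HA]]; split; first exact: smoothM.
by exists A => // x /HA /= ->; rewrite mulr0.
Qed.

Lemma testfunX n Phi : testfun Phi -> testfun (fun x => x ^+ n * Phi x).
Proof.
move=> tPhi; elim: n => [|n IH].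
  by under eq_fun do rewrite expr0 mul1r.
rewrite (_ : (fun _ => _) = ((fun x : K => x) \* (fun x => x ^+ n * Phi x))).
  by apply: testfunMl => //; exact: smooth_id.
by apply/funext => x; rewrite /= exprS mulrA.
Qed.

Lemma testfunD f g : testfun f -> testfun g -> testfun (f \+ g).
Proof.
move=> [sf [A A0 HA]] [sg [B B0 HB]]; split; first exact: smoothD.
exists (Num.max A B); first by rewrite lt_max A0.
by move=> x; rewrite ge_max => /andP[/HA /= -> /HB ->]; rewrite addr0.
Qed.

Lemma testfun_sum n (F : 'I_n -> K -> K) : (forall i, testfun (F i)) ->
  testfun (fun x => \sum_(i < n) F i x).
Proof.
elim: n F => [|n IH] F tF.
  under eq_fun do rewrite big_ord0.
  by split; [exact: smooth_cst|exists 1].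
under eq_fun do rewrite big_ord_recl.
by apply: testfunD; [exact: tF|exact: IH].
Qed.

Lemma testfun_affine Phi (a c : K) : a != 0 -> testfun Phi ->
  testfun (fun x => Phi (a * x + c)).
Proof.
move=> a0 [sPhi [A A0 HA]]; split; first exact: smooth_affine.
have a1 : 0 < `|a| by rewrite normr_gt0.
exists ((A + `|c|) / `|a|); first by rewrite divr_gt0// ltr_wpDr.
move=> x; rewrite ler_pdivrMr// => h; apply: HA.
rewrite -(lerD2r `|c|) (le_trans h)// mulrC -normrM.
have -> : `|a * x| = `|a * x + c - c| by rewrite addrK.
exact: ler_normB.
Qed.

Lemma testfun_unit_bump : testfun unit_bump.
Proof.
split; first exact: smooth_unit_bump.
exists 1 => // x x1; apply: unit_bump_eq0; apply/negP => /andP[x0].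
by rewrite ltNge => /negP; apply; rewrite -(ger0_norm (ltW x0)).
Qed.

End compact_support.

(** * Integrals with quadratic phase: decay and Taylor expansion *)

Section oscillatory_integral.
Context {K : realType}.
Notation mu := (@lebesgue_measure K).
Implicit Types (Phi : K -> K) (th u w : K).

(** The real part of Phi(xi) exp(i (u xi + w xi^2 + th)). The free phase [th] keeps everything real:
    a sine is a cosine with [th] shifted by pi/2, so one family covers real and imaginary parts and
    is stable under integration by parts and under differentiation in [u] and [w]. *)
Definition osc Phi th u w (xi : K) := Phi xi * cos (u * xi + w * xi ^+ 2 + th).

Definition J Phi th u w : K := \int[mu]_xi osc Phi th u w xi.

Lemma continuous_phase th u w : continuous (fun xi : K => u * xi + w * xi ^+ 2 + th).
Proof.
move=> x; apply: cvgD; last exact: cvg_cst.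
apply: cvgD; first by apply: cvgM; [exact: cvg_cst|exact: cvg_id].
by apply: cvgM; [exact: cvg_cst|exact: exprn_continuous].
Qed.

Lemma osc_continuous Phi th u w : testfun Phi -> continuous (osc Phi th u w).
Proof.
move=> tPhi x; apply: cvgM; first exact: testfun_continuous.
apply: (@continuous_comp _ _ _ (fun xi : K => u * xi + w * xi ^+ 2 + th) cos).
  exact: continuous_phase.
exact: continuous_cos.
Qed.

Lemma norm_osc_le Phi th u w xi : `|osc Phi th u w xi| <= `|Phi xi|.
Proof. by rewrite normrM ler_piMr// cos_norm_le1. Qed.

Lemma osc_bound Phi th u w a b M : a <= b -> continuous Phi ->
  (forall x, `|Phi x| <= M) -> (forall x, x \notin `[a, b] -> Phi x = 0) ->
  mu.-integrable setT (EFin \o osc Phi th u w) /\ `|J Phi th u w| <= M * (b - a).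
Proof.
move=> ab cPhi PhiM Phi0; apply: compact_support_integral => //.
- apply: continuous_measurable_fun => x; apply: cvgM; first exact: cPhi.
  apply: (@continuous_comp _ _ _ (fun xi : K => u * xi + w * xi ^+ 2 + th) cos).
    exact: continuous_phase.
  exact: continuous_cos.
- by move=> x; exact: le_trans (norm_osc_le _ _ _ _ _) (PhiM x).
- by move=> x /Phi0; rewrite /osc => ->; rewrite mul0r.
Qed.

Lemma osc_integrable Phi th u w : testfun Phi ->
  mu.-integrable setT (EFin \o osc Phi th u w).
Proof.
move=> tPhi; have [M M0 HM] := testfun_bounded tPhi.
have := testfun_continuous tPhi; have [_ [A A0 HA]] := tPhi => cPhi.
have AA : - A <= A by lra.
have [] := @osc_bound Phi th u w (- A) A M AA cPhi HM; last by [].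
move=> x; rewrite in_itv/= -ler_norml -ltNge => /ltW; exact: HA.
Qed.

Lemma J_bounded Phi : testfun Phi -> exists2 M : K, 0 <= M & forall th u w, `|J Phi th u w| <= M.
Proof.
move=> tPhi; have [M M0 HM] := testfun_bounded tPhi.
have := testfun_continuous tPhi; have [_ [A A0 HA]] := tPhi => cPhi.
have AA : - A <= A by lra.
exists (M * (A - - A)); first by rewrite mulr_ge0// opprK addr_ge0// ltW.
move=> th u w.
have [] := @osc_bound Phi th u w (- A) A M AA cPhi HM; last by [].
move=> x; rewrite in_itv/= -ler_norml -ltNge => /ltW; exact: HA.
Qed.

(** The derivative of Phi times the sine of the phase has integral 0. The phase has derivative u + 2
    w x, and the sine left beside Phi' is a cosine with phase lowered by pi/2. *)
Lemma J_ibp Phi th u w : testfun Phi ->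
  u * J Phi th u w = - J (derive1 Phi) (th - pi / 2) u w
                     - 2 * w * J (fun x => x * Phi x) th u w.
Proof.
move=> tPhi.
have t1 := testfun_derive1 tPhi.
have t2 : testfun (fun x => x * Phi x) by exact: (testfunX 1).
have dP (x : K) : is_derive x 1 (fun xi => u * xi + w * xi ^+ 2 + th) (u + 2 * w * x).
  apply: (@is_derive_quadratic K _ _ `|w|) => h.
  have -> : u * (x + h) + w * (x + h) ^+ 2 + th - (u * x + w * x ^+ 2 + th) - (u + 2 * w * x) * h =
    w * h ^+ 2 by ring.
  by rewrite normrM [X in _ * X <= _]ger0_norm// sqr_ge0.
have dF (x : K) : is_derive x 1
   (fun xi => Phi xi * sin (u * xi + w * xi ^+ 2 + th))
   (u * osc Phi th u w x + (osc (derive1 Phi) (th - pi / 2) u w x +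
      2 * w * osc (fun x => x * Phi x) th u w x)).
  have dPhi := derivableP (smooth_derivable (testfun_smooth tPhi) (x := x)).
  have := is_deriveM dPhi (is_derive1_comp (is_derive_sin _) (dP x)).
  move=> [D1 D2]; apply: DeriveDef; first exact: D1.
  rewrite [LHS]D2 /osc /GRing.scale/= -derive1E.
  rewrite (_ : u * x + w * x ^+ 2 + (th - pi / 2) = u * x + w * x ^+ 2 + th - pi / 2).
    by rewrite cosBpihalf; ring.
  by ring.
have [_ [A A0 HA]] := tPhi.
have := integral_derive_compact_support A0 dF.
have io1 := osc_integrable th u w tPhi.
have io2 := osc_integrable (th - pi / 2) u w t1.
have io3 := osc_integrable th u w t2.
have io1' : mu.-integrable setT (EFin \o (fun x => u * osc Phi th u w x)).
  by under [X in EFin \o X]eq_fun do []; exact: (integrableZl _ u io1).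
have io3' : mu.-integrable setT (EFin \o (fun x => 2 * w * osc (fun x => x * Phi x) th u w x)).
  exact: (integrableZl _ (2 * w) io3).
rewrite RintegralD//; last first.
  exact: (integrableD _ io2 io3').
rewrite RintegralD// !RintegralZl// -!/(J _ _ _ _) => H.
apply/eqP; rewrite -subr_eq0 opprB opprK; apply/eqP.
rewrite -[RHS]H; first ring.
- move=> x; apply: cvgD; first by apply: cvgM; [exact: cvg_cst|exact: osc_continuous].
  apply: cvgD; first exact: osc_continuous.
  by apply: cvgM; [exact: cvg_cst|exact: osc_continuous].
- by move=> x /HA ->; rewrite mul0r.
Qed.

(** Each integration by parts gains a factor |u| and costs at most 1 + |w|, the cost coming from the
    quadratic term of the phase. The induction changes the amplitude to Phi' or x Phi, hence the
    quantification over [Phi]. *)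
Lemma J_decay N Phi : testfun Phi -> exists2 C : K, 0 <= C &
  forall th u w, `|u| ^+ N * `|J Phi th u w| <= C * (1 + `|w|) ^+ N.
Proof.
elim: N Phi => [|N IH] Phi tPhi.
  have [M M0 HM] := J_bounded tPhi.
  by exists M => // th u w; rewrite !expr0 mul1r mulr1.
have [C1 C10 H1] := IH _ (testfun_derive1 tPhi).
have [C2 C20 H2] := IH _ (testfunX 1 tPhi).
exists (C1 + 2 * C2); first by rewrite addr_ge0// mulr_ge0.
move=> th u w; rewrite exprSr -mulrA -normrM J_ibp//.
rewrite -opprD normrN.
have w1 : 1 <= 1 + `|w| by rewrite lerDl.
have := H1 (th - pi / 2) u w; have := H2 th u w; rewrite /= => h2 h1.
rewrite (@le_trans _ _ (`|u| ^+ N * (`|J (derive1 Phi) (th - pi / 2) u w| +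
   `|2 * w * J (fun x => x * Phi x) th u w|)))//.
  by rewrite ler_wpM2l ?exprn_ge0// ler_normD.
rewrite mulrDr [leRHS]mulrDl lerD//.
  rewrite (le_trans h1)// ler_wpM2l// exprS ler_peMl// exprn_ge0//; lra.
rewrite !normrM (ger0_norm (_ : 0 <= 2))// mulrCA -!mulrA ler_wpM2l// mulrCA.
rewrite (_ : J (fun x => x * Phi x) = J (fun x => x ^+ 1 * Phi x))//.
rewrite mulrCA (le_trans (ler_wpM2l _ h2))// mulrCA ler_wpM2l// exprS.
have w0 : 0 <= 1 + `|w| by lra.
rewrite ler_wpM2r ?exprn_ge0//; lra.
Qed.

(** Differentiation in [u] or [w] brings down x or x^2 and turns the cosine into minus the sine,
    which is the shift by pi/2. On the support [-A, A] the increment of the phase is at most (A +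
    A^2)(|du| + |dw|), so [cos_taylor] gives a remainder uniform in [th], [u] and [w]. *)
Lemma J_taylor Phi : testfun Phi -> exists2 C : K, 0 <= C & forall th u w du dw,
  `|J Phi th (u + du) (w + dw) - J Phi th u w
     - (du * J (fun x => x * Phi x) (th + pi / 2) u w
        + dw * J (fun x => x ^+ 2 * Phi x) (th + pi / 2) u w)|
  <= C * (`|du| + `|dw|) ^+ 2.
Proof.
move=> tPhi; have [M M0 HM] := testfun_bounded tPhi.
have [_ [A A0 HA]] := tPhi.
have t1 : testfun (fun x => x * Phi x) by exact: (testfunX 1).
have t2 : testfun (fun x => x ^+ 2 * Phi x) by exact: (testfunX 2).
have AA2 : 0 <= A - - A by lra.
exists (2 * M * (A + A ^+ 2) ^+ 2 * (A - - A)).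
  by rewrite mulr_ge0// mulr_ge0 ?sqr_ge0// mulr_ge0.
move=> th u w du dw.
pose g x := osc Phi th (u + du) (w + dw) x - osc Phi th u w x -
  (du * osc (fun x => x * Phi x) (th + pi / 2) u w x +
   dw * osc (fun x => x ^+ 2 * Phi x) (th + pi / 2) u w x).
have io1 := osc_integrable th u w tPhi.
have io2 := osc_integrable th (u + du) (w + dw) tPhi.
have io3 := integrableZl measurableT du (osc_integrable (th + pi / 2) u w t1).
have io4 := integrableZl measurableT dw (osc_integrable (th + pi / 2) u w t2).
have -> : J Phi th (u + du) (w + dw) - J Phi th u w
     - (du * J (fun x => x * Phi x) (th + pi / 2) u w
        + dw * J (fun x => x ^+ 2 * Phi x) (th + pi / 2) u w) = \int[mu]_x g x.
  rewrite /g RintegralB//=; last 2 first.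
    exact: (integrableB _ io2 io1).
    exact: (integrableD _ io3 io4).
  rewrite RintegralB//; congr (_ - _).
  by rewrite RintegralD// !RintegralZl//; exact: osc_integrable.
have gE x : g x = Phi x * (cos (u * x + w * x ^+ 2 + th + (du * x + dw * x ^+ 2))
   - cos (u * x + w * x ^+ 2 + th) + (du * x + dw * x ^+ 2) * sin (u * x + w * x ^+ 2 + th)).
  rewrite /g /osc !(addrA _ th (pi / 2)) !cosDpihalf.
  have -> : (u + du) * x + (w + dw) * x ^+ 2 + th =
    u * x + w * x ^+ 2 + th + (du * x + dw * x ^+ 2) by ring.
  ring.
rewrite [X in _ <= X](_ : _ = 2 * M * (A + A ^+ 2) ^+ 2 * (`|du| + `|dw|) ^+ 2 * (A - - A)); last first.
  ring.
have AA : - A <= A by lra.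
apply: (compact_support_integral AA _ _ _).2.
- apply: continuous_measurable_fun => x; apply: cvgB.
    by apply: cvgB; exact: osc_continuous.
  by apply: cvgD; (apply: cvgM; [exact: cvg_cst|exact: osc_continuous]).
- move=> x; rewrite gE normrM.
  have [xA|/ltW xA] := leP A `|x|.
    by rewrite HA// normr0 mul0r mulr_ge0 ?sqr_ge0// mulr_ge0 ?sqr_ge0// mulr_ge0.
  rewrite [leRHS](_ : _ = M * (2 * ((A + A ^+ 2) * (`|du| + `|dw|)) ^+ 2)); last by ring.
  apply: ler_pM => //.
  rewrite (le_trans (cos_taylor _ _))// ler_wpM2l//.
  rewrite -(real_normK (num_real (du * x + _))) lerXn2r ?nnegrE ?mulr_ge0 ?addr_ge0 ?sqr_ge0 ?(ltW A0)//.
  rewrite (le_trans (ler_normD _ _))// !normrM mulrDr.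
  have x2 : `|x ^+ 2| <= A ^+ 2 by rewrite normrX lerXn2r ?nnegrE ?(ltW A0).
  have A2 : 0 <= A ^+ 2 by rewrite sqr_ge0.
  rewrite ![_ * `|du|]mulrC ![_ * `|dw|]mulrC lerD// ler_wpM2l//.
    by rewrite (le_trans xA)// lerDl.
  by rewrite -normrM -expr2 (le_trans x2)// lerDr ltW.
- move=> x; rewrite in_itv/= -ler_norml -ltNge gE => /ltW /HA ->.
  by rewrite mul0r.
Qed.

End oscillatory_integral.

(** * Fubini for integrands dominated by tensor products *)

Section real_fubini.
Context d1 d2 (T1 : measurableType d1) (T2 : measurableType d2) (K : realType).
Variable m1 : {sigma_finite_measure set T1 -> \bar K}.
Variable m2 : {sigma_finite_measure set T2 -> \bar K}.

Lemma integrable_dominated d (T : measurableType d) (m : {measure set T -> \bar K})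
    (f g : T -> K) : measurable_fun setT f -> (forall x, `|f x| <= g x) ->
  m.-integrable setT (EFin \o g) -> m.-integrable setT (EFin \o f).
Proof.
move=> mf fg; apply: le_integrable => //; first exact/measurable_EFinP.
by move=> x _; rewrite /= lee_fin (le_trans (fg x))// ler_norm.
Qed.

Lemma RintegrableZl d (T : measurableType d) (m : {measure set T -> \bar K})
    (k : K) (f : T -> K) : m.-integrable setT (EFin \o f) ->
  m.-integrable setT (EFin \o (fun x => k * f x)).
Proof. by move=> fi; exact: (integrableZl measurableT k fi). Qed.

Lemma integrable_tensor (g : T1 -> K) (h : T2 -> K) :
  (forall x, 0 <= g x) -> (forall y, 0 <= h y) ->
  m1.-integrable setT (EFin \o g) -> m2.-integrable setT (EFin \o h) ->
  (m1 \x m2)%E.-integrable setT (EFin \o (fun z => g z.1 * h z.2)).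
Proof.
move=> g0 h0 ig ih.
have mg : measurable_fun setT g by exact/measurable_EFinP/(measurable_int _ ig).
have mh : measurable_fun setT h by exact/measurable_EFinP/(measurable_int _ ih).
apply/integrable12ltyP.
  apply/measurable_EFinP; apply: measurable_funM.
    by apply: measurableT_comp => //; exact: measurable_fst.
  by apply: measurableT_comp => //; exact: measurable_snd.
rewrite (eq_integral (fun x => (\int[m2]_y (h y)%:E) * (g x)%:E)%E); last first.
  move=> x _ /=; rewrite muleC -ge0_integralZl//; last 3 first.
    exact/measurable_EFinP.
    by move=> y _; rewrite lee_fin.
    by rewrite lee_fin.
  by apply: eq_integral => y _ /=; rewrite ger0_norm ?EFinM// mulr_ge0.
rewrite ge0_integralZl//; last 3 first.
  exact/measurable_EFinP.
  by move=> x _; rewrite lee_fin.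
  by apply: integral_ge0 => y _; rewrite lee_fin.
apply: lte_mul_pinfty.
- by apply: integral_ge0 => y _; rewrite lee_fin.
- exact: integrable_fin_num.
- by rewrite ltey_eq integrable_fin_num.
Qed.

Lemma Rintegral_prod12 (f : T1 * T2 -> K) :
  (m1 \x m2)%E.-integrable setT (EFin \o f) ->
  (forall x, m2.-integrable setT (fun y => (f (x, y))%:E)) ->
  \int[m1]_x (\int[m2]_y f (x, y)) = \int[(m1 \x m2)%E]_z f z.
Proof.
move=> fi fx; congr fine; rewrite -integral12_prod_meas1//.
by apply: eq_integral => x _; rewrite /fubini_F fineK//; exact: integrable_fin_num.
Qed.

Lemma Rintegral_prod21 (f : T1 * T2 -> K) :
  (m1 \x m2)%E.-integrable setT (EFin \o f) ->
  (forall y, m1.-integrable setT (fun x => (f (x, y))%:E)) ->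
  \int[m2]_y (\int[m1]_x f (x, y)) = \int[(m1 \x m2)%E]_z f z.
Proof.
move=> fi fx; congr fine; rewrite -integral21_prod_meas1//.
by apply: eq_integral => x _; rewrite /fubini_G fineK//; exact: integrable_fin_num.
Qed.

Section dominated.
Variables (f : T1 * T2 -> K) (g : T1 -> K) (h : T2 -> K).
Hypotheses (mf : measurable_fun setT f) (fgh : forall z, `|f z| <= g z.1 * h z.2).
Hypotheses (g0 : forall x, 0 <= g x) (h0 : forall y, 0 <= h y).
Hypotheses (ig : m1.-integrable setT (EFin \o g)) (ih : m2.-integrable setT (EFin \o h)).

Lemma dominated_integrable_prod : (m1 \x m2)%E.-integrable setT (EFin \o f).
Proof. exact: integrable_dominated mf fgh (integrable_tensor g0 h0 ig ih). Qed.

Lemma dominated_integrable1 x : m2.-integrable setT (fun y => (f (x, y))%:E).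
Proof.
apply: (@integrable_dominated _ _ m2 (fun y => f (x, y)) (fun y => g x * h y)).
- exact: measurableT_comp.
- by move=> y; exact: (fgh (x, y)).
- exact: integrableZl ih.
Qed.

Lemma dominated_integrable2 y : m1.-integrable setT (fun x => (f (x, y))%:E).
Proof.
apply: (@integrable_dominated _ _ m1 (fun x => f (x, y)) (fun x => g x * h y)).
- exact: measurableT_comp.
- by move=> x; exact: (fgh (x, y)).
- exact: integrableZr ig.
Qed.

Lemma dominated_fubini :
  \int[m1]_x (\int[m2]_y f (x, y)) = \int[m2]_y (\int[m1]_x f (x, y)).
Proof.
rewrite Rintegral_prod12; [|exact: dominated_integrable_prod|exact: dominated_integrable1].
by rewrite Rintegral_prod21;[|exact: dominated_integrable_prod|exact: dominated_integrable2].
Qed.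

End dominated.

End real_fubini.

Lemma measurable_Rintegral d1 d2 (T1 : measurableType d1) (T2 : measurableType d2)
    (K : realType) (m2 : {sigma_finite_measure set T2 -> \bar K}) (f : T1 * T2 -> K) : measurable_fun setT f ->
  measurable_fun setT (fun x => \int[m2]_y f (x, y)).
Proof.
move=> mf; apply: (@measurableT_comp _ _ _ _ _ _ fine) => //.
have mf' : measurable_fun setT (EFin \o f) by exact/measurable_EFinP.
rewrite (_ : (fun x => _) = (fun x => (\int[m2]_y (EFin \o f)^\+ (x, y))
   - \int[m2]_y (EFin \o f)^\- (x, y))%E).
  apply: emeasurable_funB.
    by apply: (@measurable_fun_fubini_tonelli_F _ _ T1 T2 K m2 (EFin \o f)^\+%E) => //; exact: measurable_funepos.
  by apply: (@measurable_fun_fubini_tonelli_F _ _ T1 T2 K m2 (EFin \o f)^\-%E) => //; exact: measurable_funeneg.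
apply/funext => x; rewrite [LHS]integralE; congr (_ - _)%E; apply: eq_integral => y _.
  by rewrite !funeposE.
by rewrite !funenegE.
Qed.

Section measurable_J.
Context d (T : measurableType d) (K : realType).

Lemma measurable_J (Phi : K -> K) (th u w : T -> K) : testfun Phi ->
  measurable_fun setT th -> measurable_fun setT u -> measurable_fun setT w ->
  measurable_fun setT (fun t => J Phi (th t) (u t) (w t)).
Proof.
move=> tPhi mth mu mw.
pose f (z : T * measurableTypeR K) := osc Phi (th z.1) (u z.1) (w z.1) z.2.
suff mf : measurable_fun setT f.
  exact: (@measurable_Rintegral _ _ T (measurableTypeR K) K (@lebesgue_measure K) f mf).
have m2 : measurable_fun setT (@snd T (measurableTypeR K)) by exact: measurable_snd.
have m1 (g : T -> K) : measurable_fun setT g ->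
    measurable_fun setT (fun z : T * measurableTypeR K => g z.1).
  by move=> mf; exact: (measurableT_comp mf measurable_fst).
apply: measurable_funM.
  by apply: measurableT_comp m2; exact: testfun_measurable.
apply: measurableT_comp.
  by apply: continuous_measurable_fun; exact: continuous_cos.
apply: measurable_funD; last exact: m1.
apply: measurable_funD; first by apply: measurable_funM => //; exact: m1.
by apply: measurable_funM; [exact: m1|exact: measurable_funX].
Qed.

End measurable_J.

(** * Lorentzians and affine substitution *)

Section lorentz.
Context {K : realType}.
Notation mu := (@lebesgue_measure K).

Lemma ge0_integral_affine (G : K -> K) (a c : K) : 0 < a -> continuous G ->
  (forall x, 0 <= G x) ->
  (\int[mu]_x (G x)%:E = \int[mu]_x (G (a * x + c) * a)%:E)%E.
Proof.
move=> a0 cG G0.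
have D (x : K) : is_derive x 1 (fun x : K => a * x + c) a.
  apply: (@is_derive_quadratic K _ a 0) => h.
  by rewrite (_ : _ - _ - _ = 0) ?normr0 ?mul0r//; ring.
have D1 : derive1 (fun x : K => a * x + c) = cst a.
  by apply/funext => x; rewrite derive1E; have [_ ->] := D x.
rewrite (@increasing_ge0_integration_by_substitutionT _ (fun x : K => a * x + c) G)//.
- by apply: eq_integral => x _; rewrite /= D1.
- by move=> x y xy; rewrite ltrD2r ltr_pM2l.
- by rewrite D1 => x; exact: cvg_cst.
- by rewrite D1; exact: is_cvg_cst.
- by rewrite D1; exact: is_cvg_cst.
- apply/cvgrNyPle => A; exists ((A - c) / a); split; first exact: num_real.
  by move=> x /= /ltW; rewrite ler_pdivlMr// mulrC -lerBrDr.
- apply/cvgryPge => A; exists ((A - c) / a); split; first exact: num_real.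
  by move=> x /= /ltW; rewrite ler_pdivrMr// mulrC lerBlDr.
Qed.

Definition lor (x : K) : K := (1 + x ^+ 2)^-1.

Lemma oneDsqr_gt0 (x : K) : 0 < 1 + x ^+ 2.
Proof. by rewrite ltr_wpDr// sqr_ge0. Qed.

Lemma lor_gt0 x : 0 < lor x.
Proof. by rewrite invr_gt0 oneDsqr_gt0. Qed.

Lemma lor_ge0 x : 0 <= lor x.
Proof. exact/ltW/lor_gt0. Qed.

Lemma lor_le1 x : lor x <= 1.
Proof. by rewrite invf_le1 ?oneDsqr_gt0// lerDl sqr_ge0. Qed.

Lemma continuous_lor : continuous lor.
Proof. exact: continuous_oneDsqrV. Qed.

Lemma measurable_lor : measurable_fun setT lor.
Proof. apply: continuous_measurable_fun; exact: continuous_lor. Qed.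

Lemma integral_lor : (\int[mu]_x (lor x)%:E = pi%:E)%E.
Proof.
rewrite ge0_symfun_integralT; [|exact: lor_ge0|exact: continuous_lor|]; last first.
  by move=> x; rewrite /lor /= sqrrN.
have -> : [set x : K | 0 <= x] = `[0, +oo[%classic by rewrite set_itvcy.
rewrite [X in (_ * X)%E]integral0y_oneDsqr -EFinM; congr EFin.
by rewrite mulrC divfK.
Qed.

Lemma integral_lor_affine (a c : K) : 0 < a ->
  (\int[mu]_x (lor (a * x + c))%:E = (pi / a)%:E)%E.
Proof.
move=> a0; have := ge0_integral_affine c a0 continuous_lor lor_ge0.
rewrite integral_lor.
under eq_integral do rewrite mulrC EFinM.
rewrite ge0_integralZl_EFin//.
- move=> /(congr1 (fun z => (a^-1)%:E * z)%E); rewrite muleA -!EFinM mulVf ?gt_eqF// mul1e.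
  by rewrite mulrC => <-.
- by move=> x _; rewrite lee_fin lor_ge0.
- apply/measurable_EFinP/measurableT_comp; first exact: measurable_lor.
  by apply: measurable_funD => //; exact: measurable_funM.
- exact: ltW.
Qed.

Lemma integrable_lor : mu.-integrable setT (EFin \o lor).
Proof.
apply/integrableP; split; first by apply/measurable_EFinP; exact: measurable_lor.
under eq_integral do rewrite /= ger0_norm ?lor_ge0//.
by rewrite integral_lor ltry.
Qed.

Lemma Rintegral_opp (f : K -> K) : measurable_fun setT f ->
  \int[mu]_x f (- x) = \int[mu]_x f x.
Proof.
move=> mf.
have H (g : K -> \bar K) : measurable_fun setT g -> (forall x, 0 <= g x)%E ->
    (\int[mu]_x g x = \int[mu]_x g (- x)%R)%E.
  move=> mg g0.
  rewrite (eq_measure_integral (pushforward mu (-%R : _ -> measurableTypeR K))); last first.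
    by move=> A mA _; exact/esym/lebesgue_measureN.
  by rewrite ge0_integral_pushforward// preimage_setT.
congr fine; rewrite integralE [in RHS]integralE; congr (_ - _)%E.
  rewrite [RHS]H//; last exact/measurable_funepos/measurable_EFinP.
  by apply: eq_integral => x _; rewrite !funeposE.
rewrite [RHS]H//; last exact/measurable_funeneg/measurable_EFinP.
by apply: eq_integral => x _; rewrite !funenegE.
Qed.

(** Adding [M * G] makes the integrand nonnegative, so [ge0_integral_affine] applies both to (H + M)
    G and to M G; the difference of the two identities is the claim. *)
Lemma Rintegral_affine (H G : K -> K) (a c M : K) : 0 < a ->
  continuous H -> continuous G -> (forall x, `|H x| <= M) -> (forall x, 0 <= G x) ->
  mu.-integrable setT (EFin \o G) ->
  \int[mu]_x (H x * G x) = \int[mu]_x (H (a * x + c) * (G (a * x + c) * a)).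
Proof.
move=> a0 cH cG HM G0 iG.
have mG : measurable_fun setT G by exact: continuous_measurable_fun.
have mH : measurable_fun setT H by exact: continuous_measurable_fun.
have maff : measurable_fun setT (fun x : K => a * x + c).
  by apply: measurable_funD => //; exact: measurable_funM.
have iGa : mu.-integrable setT (EFin \o (fun x => G (a * x + c) * a)).
  apply/integrableP; split.
    by apply/measurable_EFinP; apply: measurable_funM => //; exact: (measurableT_comp mG maff).
  under eq_integral do rewrite /= ger0_norm ?mulr_ge0 ?(ltW a0)//.
  rewrite -ge0_integral_affine//.
  by rewrite ltey_eq integrable_fin_num.
have M0 : 0 <= M by apply: le_trans (HM 0).
have H1 : mu.-integrable setT (EFin \o (fun x => M * G x)) by exact: RintegrableZl.
have H2 : mu.-integrable setT (EFin \o (fun x => H x * G x)).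
  apply: (integrable_dominated _ _ H1); first exact: measurable_funM.
  by move=> x; rewrite normrM (ger0_norm (G0 x)) ler_wpM2r.
have H3 : mu.-integrable setT (EFin \o (fun x => M * (G (a * x + c) * a))) by exact: RintegrableZl.
have H4 : mu.-integrable setT (EFin \o (fun x => H (a * x + c) * (G (a * x + c) * a))).
  apply: (integrable_dominated _ _ H3).
    apply: measurable_funM; first exact: (measurableT_comp mH maff).
    by apply: measurable_funM => //; exact: (measurableT_comp mG maff).
  have Ga0 x : 0 <= G (a * x + c) * a by rewrite mulr_ge0 ?(ltW a0).
  by move=> x; rewrite normrM (ger0_norm (Ga0 x)) ler_wpM2r.
have E1 := @ge0_integral_affine (fun x => H x * G x + M * G x) a c a0.
have E2 := @ge0_integral_affine (fun x => M * G x) a c a0.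
have -> : \int[mu]_x (H x * G x) =
   \int[mu]_x (H x * G x + M * G x) - \int[mu]_x (M * G x).
  by rewrite RintegralD// addrK.
have -> : \int[mu]_x (H (a * x + c) * (G (a * x + c) * a)) =
   \int[mu]_x (H (a * x + c) * (G (a * x + c) * a) + M * (G (a * x + c) * a))
     - \int[mu]_x (M * (G (a * x + c) * a)).
  by rewrite RintegralD// addrK.
congr (_ - _); rewrite /Rintegral.
  rewrite E1.
  - by congr fine; apply: eq_integral => x _; congr EFin; ring.
  - by move=> x; apply: cvgD; apply: cvgM => //; [exact: cH|exact: cG|exact: cvg_cst|exact: cG].
  - by move=> x; rewrite -mulrDl mulr_ge0//; have := HM x; rewrite ler_norml; lra.
rewrite E2.
- by congr fine; apply: eq_integral => x _; congr EFin; ring.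
- by move=> x; apply: cvgM => //; [exact: cvg_cst|exact: cG].
- by move=> x; rewrite mulr_ge0.
Qed.

End lorentz.

Section real_dominated_convergence.
Context d (T : measurableType d) (K : realType) (m : {measure set T -> \bar K}).

Lemma Rintegral_dominated_cvg (f_ : nat -> T -> K) (f g : T -> K) :
  (forall n, measurable_fun setT (f_ n)) -> measurable_fun setT f ->
  m.-integrable setT (EFin \o g) -> (forall n x, `|f_ n x| <= g x) ->
  (forall x, f_ n x @[n --> \oo] --> f x) ->
  \int[m]_x f_ n x @[n --> \oo] --> \int[m]_x f x.
Proof.
move=> mf_ mf ig fg cf.
have [||||fi _ H] := @dominated_convergence _ T K m setT measurableT
  (fun n => EFin \o f_ n) (EFin \o f) (EFin \o g) _ _ _ ig.
- by move=> n; exact/measurable_EFinP.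
- exact/measurable_EFinP.
- apply: aeW => x _; apply: cvg_EFin; last exact: cf.
  by apply: nearW.
- by apply: aeW => x n _; rewrite /= lee_fin.
by move: H; rewrite -(fineK (integrable_fin_num measurableT fi)); exact: fine_cvg.
Qed.

End real_dominated_convergence.

(** * Abel weights and the Poisson kernel *)

Section abel.
Context {K : realType}.
Notation mu := (@lebesgue_measure K).

(* Weight for the Abel summation of inverse Fourier integrals: its Fourier transform is
   the Poisson kernel, which only involves [lor]. *)
Definition abel (e x : K) := expR (- (e * `|x|)).

Lemma continuous_abel e : continuous (abel e).
Proof.
move=> x; apply: (@continuous_comp _ _ _ (fun x : K => - (e * `|x|)) expR); last exact: continuous_expR.
by apply: cvgN; apply: cvgM; [exact: cvg_cst|exact: norm_continuous].
Qed.

Lemma abel_ge0 e x : 0 <= abel e x. Proof. exact: expR_ge0. Qed.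

Lemma abel_le1 e x : 0 <= e -> abel e x <= 1.
Proof. by move=> e0; rewrite expR_le1 oppr_le0 mulr_ge0. Qed.

Lemma is_derive_linear (a x : K) : is_derive x 1 (fun x : K => a * x) a.
Proof.
apply: (@is_derive_quadratic K _ a 0) => h.
by rewrite (_ : _ - _ - _ = 0) ?normr0 ?mul0r//; ring.
Qed.

(** Using 1 + cos in place of cos keeps the integrand nonnegative, which is what the improper
    fundamental theorem [ge0_continuous_FTC2y] asks for. The contribution of the 1 is subtracted
    again in [Rintegral_abel_cos]. *)
Lemma integral_abel_half (e v : K) : 0 < e ->
  (\int[mu]_(x in `[0%R, +oo[) (expR (- e * x) * (1 + cos (v * x)))%:E =
   (e^-1 + e / (e ^+ 2 + v ^+ 2))%:E)%E.
Proof.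
move=> e0.
have ev : e ^+ 2 + v ^+ 2 != 0 by rewrite gt_eqF// ltr_pwDl ?sqr_ge0// exprn_gt0.
pose F x := - (expR (- e * x) * (e^-1 + (e * cos (v * x) - v * sin (v * x)) / (e ^+ 2 + v ^+ 2))).
have dE (x : K) : is_derive x 1 (fun x : K => expR (- e * x)) (- e * expR (- e * x)).
  have := is_derive1_comp (is_derive_expR _) (is_derive_linear (- e) x).
  by rewrite mulrC.
have dC (x : K) : is_derive x 1 (fun x : K => cos (v * x)) (- (v * sin (v * x))).
  have := is_derive1_comp (is_derive_cos _) (is_derive_linear v x).
  by rewrite mulNr mulrC.
have dS (x : K) : is_derive x 1 (fun x : K => sin (v * x)) (v * cos (v * x)).
  have := is_derive1_comp (is_derive_sin _) (is_derive_linear v x).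
  by rewrite mulrC.
have dF (x : K) : is_derive x 1 F (expR (- e * x) * (1 + cos (v * x))).
  have := is_deriveN (is_deriveM (dE x) (is_deriveD (is_derive_cst e^-1 x 1)
     (is_deriveM (is_deriveB (is_deriveZ e (dC x)) (is_deriveZ v (dS x)))
        (is_derive_cst (e ^+ 2 + v ^+ 2)^-1 x 1)))).
  move=> [D1 D2]; apply: DeriveDef; first exact: D1.
  rewrite [LHS]D2 /GRing.scale/= !fctE.
  rewrite -[(e \*: _) x]/(e * cos (v * x)) -[(v \*: _) x]/(v * sin (v * x)).
  by field; rewrite ev gt_eqF.
have cF x : {for x, continuous F}.
  by apply/differentiable_continuous/derivable1_diffP; have [] := dF x.
rewrite (@ge0_continuous_FTC2y _ _ F 0 0).
- rewrite /F !mulr0 sin0 cos0 expR0 mulr0 subr0 mulr1 mul1r -EFinB sub0r opprK//.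
- by move=> x _; rewrite mulr_ge0 ?expR_ge0// -lerBlDl sub0r cos_geN1.
- apply: continuous_subspaceT => x.
  have c1 : {for x, continuous (fun x0 : K => expR (- e * x0))}.
    by apply/differentiable_continuous/derivable1_diffP; have [] := dE x.
  have c2 : {for x, continuous (fun x0 : K => cos (v * x0))}.
    by apply/differentiable_continuous/derivable1_diffP; have [] := dC x.
  by apply: cvgM; [exact: c1|apply: cvgD; [exact: cvg_cst|exact: c2]].
(* [C] bounds the bracket in [F], and exp(e x) >= 1 + e x, so |F x| <= r once e r x > C. *)
- pose C := e^-1 + (e + `|v|) / (e ^+ 2 + v ^+ 2).
  have ev0 : 0 < e ^+ 2 + v ^+ 2 by rewrite ltr_pwDl ?sqr_ge0// exprn_gt0.
  apply/cvgrPdist_le => r r0; exists (C / (e * r)); split; first exact: num_real.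
  move=> x; rewrite ltr_pdivrMr ?mulr_gt0// => xr.
  rewrite sub0r opprK normrM ger0_norm ?expR_ge0// mulNr expRN.
  rewrite ler_pdivrMl ?expR_gt0//.
  have xe : C <= expR (e * x) * r.
    rewrite (le_trans (ltW xr))// mulrA ler_wpM2r ?(ltW r0)//.
    by rewrite (le_trans _ (expR_ge1Dx _))// mulrC lerDr.
  rewrite (le_trans _ xe)// (le_trans (ler_normD _ _))// lerD//.
    by rewrite ger0_norm// invr_ge0 ltW.
  rewrite normrM [X in _ * X <= _]ger0_norm ?invr_ge0 ?(ltW ev0)//.
  rewrite ler_wpM2r ?invr_ge0 ?(ltW ev0)// (le_trans (ler_normB _ _))// lerD//.
    by rewrite normrM (ger0_norm (ltW e0)) ler_piMr ?(ltW e0)// cos_norm_le1.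
  by rewrite normrM ler_piMr// sin_norm_le1.
- by move=> x _; have [] := dF x.
- by apply: cvg_at_right_filter; exact: cF.
- by move=> x _; rewrite derive1E; have [_ ->] := dF x.
Qed.

Lemma integral_abel_1Dcos (e v : K) : 0 < e ->
  (\int[mu]_x (abel e x * (1 + cos (v * x)))%:E =
   (2 * (e^-1 + e / (e ^+ 2 + v ^+ 2)))%:E)%E.
Proof.
move=> e0; rewrite ge0_symfun_integralT.
- rewrite (EFinM 2); congr (_ * _)%E; rewrite -(integral_abel_half v e0) -set_itvcy.
  apply: eq_integral => x; rewrite inE/= in_itv/= andbT => x0.
  by rewrite /abel ger0_norm// mulNr.
- by move=> x; rewrite mulr_ge0 ?abel_ge0// -lerBlDl sub0r cos_geN1.
- move=> x; apply: cvgM; first exact: continuous_abel.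
  apply: cvgD; first exact: cvg_cst.
  apply: (@continuous_comp _ _ _ (fun x : K => v * x) cos); last exact: continuous_cos.
  by apply: cvgM; [exact: cvg_cst|exact: cvg_id].
- by move=> x; rewrite /abel /= normrN mulrN cosN.
Qed.

Lemma integral_abel (e : K) : 0 < e -> (\int[mu]_x (abel e x)%:E = (2 / e)%:E)%E.
Proof.
move=> e0; have := integral_abel_1Dcos 0 e0.
under eq_integral do rewrite mul0r cos0 mulrC EFinM.
rewrite ge0_integralZl_EFin//.
- move=> /(congr1 (fun z => (2^-1)%:E * z)%E); rewrite muleA -!EFinM mulVf// mul1e => ->.
  congr EFin; rewrite expr0n addr0; field; exact: lt0r_neq0.
- by move=> x _; rewrite lee_fin abel_ge0.
- by apply/measurable_EFinP; apply: continuous_measurable_fun; exact: continuous_abel.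
Qed.

Lemma integrable_abel e : 0 < e -> mu.-integrable setT (EFin \o abel e).
Proof.
move=> e0; apply/integrableP; split.
  by apply/measurable_EFinP; apply: continuous_measurable_fun; exact: continuous_abel.
under eq_integral do rewrite /= ger0_norm ?abel_ge0//.
by rewrite integral_abel ?ltry.
Qed.

Lemma integrable_abelM e (f : K -> K) : 0 < e -> measurable_fun setT f ->
  (forall x, `|f x| <= 1) -> mu.-integrable setT (EFin \o (fun x => abel e x * f x)).
Proof.
move=> e0 mf f1; apply: (integrable_dominated _ _ (integrable_abel e0)).
  by apply: measurable_funM => //; apply: continuous_measurable_fun; exact: continuous_abel.
by move=> x; rewrite normrM ger0_norm ?abel_ge0// ler_piMr ?abel_ge0.
Qed.

Lemma measurable_cosM (v : K) : measurable_fun setT (fun x : K => cos (v * x)).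
Proof.
apply: continuous_measurable_fun => x.
apply: (@continuous_comp _ _ _ (fun x : K => v * x) cos); last exact: continuous_cos.
by apply: cvgM; [exact: cvg_cst|exact: cvg_id].
Qed.

Lemma measurable_sinM (v : K) : measurable_fun setT (fun x : K => sin (v * x)).
Proof.
apply: continuous_measurable_fun => x.
apply: (@continuous_comp _ _ _ (fun x : K => v * x) sin); last exact: continuous_sin.
by apply: cvgM; [exact: cvg_cst|exact: cvg_id].
Qed.

(** The weight is even, so after the addition formula the sine part integrates to 0 by the
    reflection x to - x. *)
Lemma Rintegral_abel_cos (e v om : K) : 0 < e ->
  \int[mu]_x (abel e x * cos (v * x + om)) = cos om * (2 * e / (e ^+ 2 + v ^+ 2)).
Proof.
move=> e0.
have ic := integrable_abelM e0 (measurable_cosM v) (fun x => cos_norm_le1 _).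
have is' := integrable_abelM e0 (measurable_sinM v) (fun x => sin_norm_le1 _).
have ia := integrable_abel e0.
have C : \int[mu]_x (abel e x * cos (v * x)) = 2 * e / (e ^+ 2 + v ^+ 2).
  have : \int[mu]_x (abel e x + abel e x * cos (v * x)) = 2 * (e^-1 + e / (e ^+ 2 + v ^+ 2)).
    rewrite -[RHS]/(fine (_%:E)) -integral_abel_1Dcos//; congr fine.
    by apply: eq_integral => x _; rewrite mulrDr mulr1.
  rewrite RintegralD// [X in X + _]/Rintegral integral_abel//= => H.
  by apply: (addrI (2 / e)); rewrite H; ring.
have S : \int[mu]_x (abel e x * sin (v * x)) = 0.
  have ms : measurable_fun setT (fun x => abel e x * sin (v * x)).
    apply: measurable_funM; last exact: measurable_sinM.
    by apply: continuous_measurable_fun; exact: continuous_abel.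
  have := Rintegral_opp ms.
  rewrite (@eq_Rintegral _ _ _ mu setT (fun x => -1 * (abel e x * sin (v * x)))); last first.
    by move=> x _; rewrite /abel normrN mulrN sinN; ring.
  rewrite RintegralZl//; lra.
rewrite (@eq_Rintegral _ _ _ mu setT (fun x => cos om * (abel e x * cos (v * x)) - sin om * (abel e x * sin (v * x)))); last first.
  by move=> x _; rewrite cosD; ring.
rewrite RintegralB//; [|exact: RintegrableZl|exact: RintegrableZl].
by rewrite !RintegralZl// C S mulr0 subr0.
Qed.

End abel.

(** * Fourier inversion *)

Section fourier_inversion.
Context {K : realType}.
Notation mu := (@lebesgue_measure K).
Implicit Types (Phi : K -> K) (th eta w e : K).

(** The integral of Phi(xi) cos(2 pi x (xi - eta) + w xi^2 + th) in xi: the real part of the inverse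
    Fourier transform at [x] of Phi(xi) exp(i (w xi^2 + th)), times exp(-2 pi i x eta). Its integral
    in [x] is thus the forward transform at [eta]. *)
Definition wave Phi th eta w (x : K) := J Phi (th - 2 * pi * eta * x) (2 * pi * x) w.

Lemma measurable_wave Phi th eta w : testfun Phi -> measurable_fun setT (wave Phi th eta w).
Proof.
move=> tPhi; apply: (@measurable_J _ (measurableTypeR K) K) => //.
  by apply: measurable_funB => //; exact: measurable_funM.
Qed.

Lemma pi2_ge1 : 1 <= 2 * pi :> K.
Proof. have := @pihalf_ge1 K; lra. Qed.

(** The decay estimates of orders 0 and 2 add up to the weight 1 + x^2, which makes [wave]
    integrable in [x]. *)
Lemma J_lor_bound Phi : testfun Phi -> exists2 C : K, 0 <= C &
  forall th x w, `|J Phi th (2 * pi * x) w| <= C * (1 + `|w|) ^+ 2 * lor x.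
Proof.
move=> tPhi.
have [C0 C00 H0] := J_decay 0 tPhi; have [C2 C20 H2] := J_decay 2 tPhi.
exists (C0 + C2); first by rewrite addr_ge0.
move=> th x w; rewrite /lor ler_pdivlMr ?oneDsqr_gt0//.
rewrite mulrDr mulr1.
have -> : (C0 + C2) * (1 + `|w|) ^+ 2 = C0 * (1 + `|w|) ^+ 2 + C2 * (1 + `|w|) ^+ 2 by ring.
have := H0 th (2 * pi * x) w; rewrite !expr0 mul1r mulr1 => h0.
have := H2 th (2 * pi * x) w => h2.
have w1 : 1 <= (1 + `|w|) ^+ 2 by rewrite exprn_ege1// lerDl.
apply: lerD; first by rewrite (le_trans h0)// ler_peMr.
rewrite (le_trans _ h2)// mulrC ler_wpM2r// -normrX ger0_norm ?sqr_ge0//.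
by rewrite exprMn ler_peMl ?sqr_ge0// exprn_ege1// pi2_ge1.
Qed.

Lemma integrable_wave Phi th eta w : testfun Phi ->
  mu.-integrable setT (EFin \o wave Phi th eta w).
Proof.
move=> tPhi; have [C C0 HC] := J_lor_bound tPhi.
apply: (@integrable_dominated K _ (measurableTypeR K) mu _ (fun x => C * (1 + `|w|) ^+ 2 * lor x)).
- exact: measurable_wave.
- by move=> x; exact: HC.
- by apply: RintegrableZl; exact: integrable_lor.
Qed.

Lemma Rintegral_abel_wave Phi th eta w e : testfun Phi -> 0 < e ->
  \int[mu]_x (abel e x * wave Phi th eta w x) =
  \int[mu]_xi (osc Phi th 0 w xi * (2 * e / (e ^+ 2 + (2 * pi * (xi - eta)) ^+ 2))).
Proof.
move=> tPhi e0.
have mPhi := testfun_measurable tPhi.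
pose f (z : measurableTypeR K * measurableTypeR K) :=
  abel e z.1 * osc Phi (th - 2 * pi * eta * z.1) (2 * pi * z.1) w z.2.
have mabel : measurable_fun setT (abel e).
  by apply: continuous_measurable_fun; exact: continuous_abel.
have m1 : measurable_fun setT (@fst (measurableTypeR K) (measurableTypeR K)) by exact: measurable_fst.
have m2 : measurable_fun setT (@snd (measurableTypeR K) (measurableTypeR K)) by exact: measurable_snd.
have mf : measurable_fun setT f.
  apply: measurable_funM; first exact: (measurableT_comp mabel m1).
  apply: measurable_funM; first exact: (measurableT_comp mPhi m2).
  apply: measurableT_comp.
    by apply: continuous_measurable_fun; exact: continuous_cos.
  apply: measurable_funD; last first.
    by apply: measurable_funB => //; exact: measurable_funM.
  apply: measurable_funD.
    by apply: measurable_funM => //; exact: measurable_funM.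
  by apply: measurable_funM => //; exact: measurable_funX.
have fb z : `|f z| <= abel e z.1 * `|Phi z.2|.
  rewrite normrM (ger0_norm (abel_ge0 _ _)) ler_wpM2l ?abel_ge0//.
  exact: norm_osc_le.
have iPhi : mu.-integrable setT (EFin \o (fun x => `|Phi x|)).
  have [M M0 HM] := testfun_bounded tPhi.
  have [_ [A A0 HA]] := tPhi.
  have AA : - A <= A by lra.
  apply: (compact_support_integral AA _ (M := M) _ _).1.
  - exact: measurableT_comp.
  - by move=> x; rewrite normr_id.
  - by move=> x; rewrite in_itv/= -ler_norml -ltNge => /ltW /HA ->; rewrite normr0.
have := @dominated_fubini _ _ _ _ K mu mu f (abel e) (fun x => `|Phi x|) mf fb
  (abel_ge0 e) (fun x => normr_ge0 _) (integrable_abel e0) iPhi.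
rewrite /f /= => H.
rewrite (_ : \int[mu]_x (abel e x * wave Phi th eta w x) =
  \int[mu]_x (\int[mu]_y (abel e x * osc Phi (th - 2 * pi * eta * x) (2 * pi * x) w y))); last first.
  apply: eq_Rintegral => x _; apply: esym.
  exact: (@RintegralZl _ (measurableTypeR K) K mu setT _ _ measurableT (osc_integrable _ _ _ tPhi)).
rewrite H; apply: eq_Rintegral => xi _.
rewrite (@eq_Rintegral _ _ _ mu setT (fun x => Phi xi * (abel e x * cos (2 * pi * (xi - eta) * x + (w * xi ^+ 2 + th))))); last first.
  move=> x _; rewrite /osc mulrCA; congr (_ * (_ * cos _)); ring.
move: (2 * pi * (xi - eta)) => v.
have iv : mu.-integrable setT (EFin \o (fun x : K => abel e x * cos (v * x + (w * xi ^+ 2 + th)))).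
  apply: (integrable_abelM e0 _ (fun x => cos_norm_le1 _)).
  apply: continuous_measurable_fun => x.
  apply: (@continuous_comp _ _ _ (fun x : K => v * x + (w * xi ^+ 2 + th)) cos); last exact: continuous_cos.
  by apply: cvgD; [apply: cvgM; [exact: cvg_cst|exact: cvg_id]|exact: cvg_cst].
rewrite (@RintegralZl _ (measurableTypeR K) K mu setT _ (Phi xi) measurableT iv).
by rewrite (Rintegral_abel_cos _ _ e0) mulrA /osc mul0r add0r.
Qed.

(** The substitution 2 pi (xi - eta) = e y turns the Poisson kernel into lor(y)/pi and moves the
    parameter [e] into the argument of the continuous factor, where it can tend to 0. *)
Lemma Rintegral_poisson_kernel Phi th eta w e : testfun Phi -> 0 < e ->
  \int[mu]_xi (osc Phi th 0 w xi * (2 * e / (e ^+ 2 + (2 * pi * (xi - eta)) ^+ 2))) =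
  pi^-1 * \int[mu]_y (osc Phi th 0 w (e / (2 * pi) * y + eta) * lor y).
Proof.
move=> tPhi e0.
have pi0 := @pi_gt0 K.
have p2 : 0 < 2 * pi :> K by rewrite mulr_gt0.
have [M M0 HM] := testfun_bounded tPhi.
pose G (xi : K) := 2 * e / (e ^+ 2 + (2 * pi * (xi - eta)) ^+ 2).
have GE xi : G xi = 2 / e * lor ((2 * pi / e) * xi + - (2 * pi / e) * eta).
  rewrite /G /lor.
  have ep : e ^+ 2 + (2 * pi * (xi - eta)) ^+ 2 != 0.
    by rewrite gt_eqF// ltr_pwDl ?sqr_ge0// exprn_gt0.
  have -> : 1 + (2 * pi / e * xi + - (2 * pi / e) * eta) ^+ 2 =
    (e ^+ 2 + (2 * pi * (xi - eta)) ^+ 2) / e ^+ 2.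
    by field; rewrite gt_eqF.
  move: ep; set D := (e ^+ 2 + _) => ep.
  by field; rewrite ep gt_eqF.
have cG : continuous G.
  have -> : G = (fun xi => 2 / e * lor ((2 * pi / e) * xi + - (2 * pi / e) * eta)) by apply/funext.
  move=> x; apply: cvgM; first exact: cvg_cst.
  apply: (@continuous_comp _ _ _ (fun x : K => (2 * pi / e) * x + - (2 * pi / e) * eta) lor); last exact: continuous_lor.
  by apply: cvgD; [apply: cvgM; [exact: cvg_cst|exact: cvg_id]|exact: cvg_cst].
have G0 xi : 0 <= G xi by rewrite GE mulr_ge0 ?lor_ge0// divr_ge0// ltW.
have iG : mu.-integrable setT (EFin \o G).
  have -> : G = (fun xi => 2 / e * lor ((2 * pi / e) * xi + - (2 * pi / e) * eta)) by apply/funext.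
  apply: RintegrableZl; apply/integrableP; split.
    apply/measurable_EFinP; apply: (measurableT_comp measurable_lor).
    by apply: measurable_funD => //; exact: measurable_funM.
  under eq_integral do rewrite /= ger0_norm ?lor_ge0//.
  by rewrite integral_lor_affine ?ltry// divr_gt0.
have ae : 0 < e / (2 * pi) by rewrite divr_gt0.
rewrite (@Rintegral_affine K (osc Phi th 0 w) G (e / (2 * pi)) eta M)//; last 2 first.
- exact: osc_continuous.
- by move=> x; exact: le_trans (norm_osc_le _ _ _ _ _) (HM x).
rewrite -RintegralZl//; last first.
  apply: (@integrable_dominated K _ (measurableTypeR K) mu _ (fun x => M * lor x)).
  - apply: measurable_funM; last exact: measurable_lor.
    apply: (@measurableT_comp _ _ _ _ _ _ (osc Phi th 0 w)).
      by apply: continuous_measurable_fun; exact: osc_continuous.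
    by apply: measurable_funD => //; exact: measurable_funM.
  - move=> x; rewrite normrM (ger0_norm (lor_ge0 _)) ler_wpM2r ?lor_ge0//.
    exact: le_trans (norm_osc_le _ _ _ _ _) (HM _).
  - by apply: RintegrableZl; exact: integrable_lor.
apply: eq_Rintegral => y _.
have en := lt0r_neq0 e0; have pn := lt0r_neq0 pi0.
have yE (q z : K) : q != 0 -> 2 * q / e * (e / (2 * q) * z + eta) + - (2 * q / e) * eta = z.
  by move=> qn; field; rewrite en qn.
have oE (q o l : K) : q != 0 -> o * (2 / e * l * (e / (2 * q))) = q^-1 * (o * l).
  by move=> qn; field; rewrite en qn.
by rewrite GE yE// oE.
Qed.

(** Pointwise Fourier inversion. The Abel-weighted integral has two expressions, and both converge
    dominatedly along e = 1/(n+1): one because [wave] is integrable, the other because [osc] is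
    bounded and continuous at [eta] and [lor] is integrable with integral pi. *)
Lemma Rintegral_wave Phi th eta w : testfun Phi ->
  \int[mu]_x wave Phi th eta w x = Phi eta * cos (w * eta ^+ 2 + th).
Proof.
move=> tPhi.
have [M M0 HM] := testfun_bounded tPhi.
pose e (n : nat) : K := n.+1%:R^-1.
have e0 n : 0 < e n by rewrite invr_gt0.
have ecvg : e n @[n --> \oo] --> 0 by exact: cvg_harmonic.
have mosc := continuous_measurable_fun (@osc_continuous K Phi th 0 w tPhi).
have L : \int[mu]_x (abel (e n) x * wave Phi th eta w x) @[n --> \oo] -->
    \int[mu]_x wave Phi th eta w x.
  apply: (@Rintegral_dominated_cvg _ (measurableTypeR K) K mu _ _ (fun x => `|wave Phi th eta w x|)).
  - move=> n; apply: measurable_funM; last exact: measurable_wave.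
    by apply: continuous_measurable_fun; exact: continuous_abel.
  - exact: measurable_wave.
  - by apply: integrable_norm; exact: integrable_wave.
  - by move=> n x; rewrite normrM ler_piMl// ger0_norm ?abel_ge0// abel_le1// ltW.
  - move=> x; rewrite -[X in _ --> X]mul1r.
    apply: cvgM; last exact: cvg_cst.
    rewrite -expR0 -oppr0 -(mul0r `|x|).
    apply: (@continuous_cvg _ _ _ _ _ _ expR); first exact: continuous_expR.
    by apply: cvgN; apply: cvgM; [exact: ecvg|exact: cvg_cst].
have R : pi^-1 * \int[mu]_y (osc Phi th 0 w (e n / (2 * pi) * y + eta) * lor y) @[n --> \oo] -->
    pi^-1 * \int[mu]_y (osc Phi th 0 w eta * lor y).
  apply: cvgM; first exact: cvg_cst.
  apply: (@Rintegral_dominated_cvg _ (measurableTypeR K) K mu _ _ (fun x => M * lor x)).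
  - move=> n; apply: measurable_funM; last exact: measurable_lor.
    apply: (measurableT_comp mosc).
    by apply: measurable_funD => //; exact: measurable_funM.
  - by apply: measurable_funM => //; exact: measurable_lor.
  - by apply: RintegrableZl; exact: integrable_lor.
  - move=> n x; rewrite normrM (ger0_norm (lor_ge0 _)) ler_wpM2r ?lor_ge0//.
    exact: le_trans (norm_osc_le _ _ _ _ _) (HM _).
  - move=> x; apply: cvgM; last exact: cvg_cst.
    apply: (@continuous_cvg _ _ _ _ _ _ (osc Phi th 0 w)); first exact: osc_continuous.
    rewrite -[X in _ --> X]add0r; apply: cvgD; last exact: cvg_cst.
    rewrite -(mul0r x); apply: cvgM; last exact: cvg_cst.
    by rewrite -(mul0r (2 * pi)^-1); apply: cvgM; [exact: ecvg|exact: cvg_cst].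
have E : (fun n => \int[mu]_x (abel (e n) x * wave Phi th eta w x)) =
  (fun n => pi^-1 * \int[mu]_y (osc Phi th 0 w (e n / (2 * pi) * y + eta) * lor y)).
  by apply/funext => n; rewrite Rintegral_abel_wave// Rintegral_poisson_kernel.
rewrite E in L.
rewrite (cvg_unique _ L R)// RintegralZl//; last exact: integrable_lor.
have -> : \int[mu]_x lor x = pi by rewrite /Rintegral integral_lor.
by rewrite mulrC mulrK ?unitfE ?gt_eqF ?pi_gt0// /osc mul0r add0r.
Qed.

End fourier_inversion.

(** * Complex-valued integrals and product measures *)

Section complex_integral.
Context {K : realType}.

Lemma Re_mulc (x y : K[i]) : complex.Re (x * y) =
  complex.Re x * complex.Re y - complex.Im x * complex.Im y.
Proof. by case: x => a b; case: y. Qed.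

Lemma Im_mulc (x y : K[i]) : complex.Im (x * y) =
  complex.Re x * complex.Im y + complex.Im x * complex.Re y.
Proof. by case: x => a b; case: y. Qed.

Lemma complex_eq (x y : K[i]) : complex.Re x = complex.Re y ->
  complex.Im x = complex.Im y -> x = y.
Proof. by case: x => a b; case: y => c e /= -> ->. Qed.

Lemma normc_ge0 (x : K[i]) : 0 <= Normc.normc x.
Proof. by case: x => a b; rewrite sqrtr_ge0. Qed.

Lemma normc_Re (x : K[i]) : `|complex.Re x| <= Normc.normc x.
Proof.
case: x => a b /=; rewrite -sqrtr_sqr ler_wsqrtr// lerDl sqr_ge0//.
Qed.

Lemma normc_Im (x : K[i]) : `|complex.Im x| <= Normc.normc x.
Proof.
case: x => a b /=; rewrite -sqrtr_sqr ler_wsqrtr// lerDr sqr_ge0//.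
Qed.

Lemma normc_le (x : K[i]) (M : K) : `|complex.Re x| <= M -> `|complex.Im x| <= M ->
  Normc.normc x <= 2 * M.
Proof.
case: x => a b /= aM bM.
have M0 : 0 <= M by exact: le_trans aM.
have M2 : 0 <= 2 * M by rewrite mulr_ge0.
rewrite -(ger0_norm M2) -sqrtr_sqr ler_wsqrtr//.
have a2 : a ^+ 2 <= M ^+ 2 by rewrite -(real_normK (num_real a)) lerXn2r ?nnegrE.
have b2 : b ^+ 2 <= M ^+ 2 by rewrite -(real_normK (num_real b)) lerXn2r ?nnegrE.
have := sqr_ge0 M; rewrite exprMn; lra.
Qed.

Lemma normc_prod I (r : seq I) (P : pred I) (F : I -> K[i]) :
  Normc.normc (\prod_(i <- r | P i) F i) = \prod_(i <- r | P i) Normc.normc (F i).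
Proof.
apply: (big_morph (@Normc.normc K)); first exact: Normc.normcM.
exact: Normc.normc1.
Qed.

Lemma expiD (a b : K) : expi (a + b) = expi a * expi b.
Proof. by apply: complex_eq; rewrite /expi ?Re_mulc ?Im_mulc/= ?cosD ?sinD//; ring. Qed.

Lemma expi0 : expi (0 : K) = 1.
Proof. by rewrite /expi cos0 sin0. Qed.

Lemma expi_sum I (r : seq I) (F : I -> K) :
  expi (\sum_(i <- r) F i) = \prod_(i <- r) expi (F i).
Proof. exact: (big_morph (@expi K) expiD expi0). Qed.

Section measure_space.
Context d (T : measurableType d) (m : {measure set T -> \bar K}).
Implicit Types f g : T -> K[i].

Definition cmeasurable f := measurable_fun setT (fun x => complex.Re (f x)) /\
  measurable_fun setT (fun x => complex.Im (f x)).

Definition cintegrable f := m.-integrable setT (fun x => (complex.Re (f x))%:E) /\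
  m.-integrable setT (fun x => (complex.Im (f x))%:E).

(** [Cintegral] is by conversion the case of [lebesgue_st]; the general measure lets Fubini split
    off one factor at a time. *)
Definition cint f : K[i] :=
  Complex (\int[m]_x complex.Re (f x)) (\int[m]_x complex.Im (f x)).

Lemma cmeasurable_integrable f : cintegrable f -> cmeasurable f.
Proof. by move=> [f1 f2]; split; apply/measurable_EFinP; [exact: measurable_int f1|exact: measurable_int f2]. Qed.

Lemma cmeasurableM f g : cmeasurable f -> cmeasurable g -> cmeasurable (fun x => f x * g x).
Proof.
move=> [f1 f2] [g1 g2]; split.
  rewrite (_ : (fun x => _) = (fun x => complex.Re (f x) * complex.Re (g x) -
    complex.Im (f x) * complex.Im (g x))); last by apply/funext => x; rewrite Re_mulc.
  by apply: measurable_funB; exact: measurable_funM.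
rewrite (_ : (fun x => _) = (fun x => complex.Re (f x) * complex.Im (g x) +
    complex.Im (f x) * complex.Re (g x))); last by apply/funext => x; rewrite Im_mulc.
by apply: measurable_funD; exact: measurable_funM.
Qed.

Lemma cmeasurable_cst (c : K[i]) : cmeasurable (fun=> c).
Proof. by split; exact: measurable_cst. Qed.

Lemma cmeasurable_prod I (r : seq I) (F : I -> T -> K[i]) :
  (forall i, cmeasurable (F i)) -> cmeasurable (fun x => \prod_(i <- r) F i x).
Proof.
move=> mF; elim: r => [|i r IH].
  by under eq_fun do rewrite big_nil; exact: cmeasurable_cst.
by under eq_fun do rewrite big_cons; exact: cmeasurableM.
Qed.

Lemma cintegrable_dominated f (g : T -> K) : cmeasurable f ->
  (forall x, Normc.normc (f x) <= g x) -> m.-integrable setT (EFin \o g) -> cintegrable f.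
Proof.
move=> [f1 f2] fg ig; split.
  by apply: (integrable_dominated f1 _ ig) => x; exact: le_trans (normc_Re _) (fg x).
by apply: (integrable_dominated f2 _ ig) => x; exact: le_trans (normc_Im _) (fg x).
Qed.

Lemma cintZl (c : K[i]) f : cintegrable f -> cint (fun x => c * f x) = c * cint f.
Proof.
move=> [f1 f2].
have i1 k := RintegrableZl k f1; have i2 k := RintegrableZl k f2.
apply: complex_eq; rewrite /cint ?Re_mulc ?Im_mulc/=.
  rewrite (@eq_Rintegral _ _ _ m setT (fun x => complex.Re c * complex.Re (f x) -
    complex.Im c * complex.Im (f x))); last by move=> x _; rewrite Re_mulc.
  by rewrite RintegralB ?RintegralZl.
rewrite (@eq_Rintegral _ _ _ m setT (fun x => complex.Re c * complex.Im (f x) +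
    complex.Im c * complex.Re (f x))); last by move=> x _; rewrite Im_mulc.
by rewrite RintegralD ?RintegralZl.
Qed.

Lemma eq_cint f g : f =1 g -> cint f = cint g.
Proof. by move=> /funext ->. Qed.

End measure_space.

Section product.
Context d1 d2 (T1 : measurableType d1) (T2 : measurableType d2).
Variable m1 : {sigma_finite_measure set T1 -> \bar K}.
Variable m2 : {sigma_finite_measure set T2 -> \bar K}.

Lemma Rintegral_tensor (g : T1 -> K) (h : T2 -> K) :
  m1.-integrable setT (EFin \o g) -> m2.-integrable setT (EFin \o h) ->
  (m1 \x m2)%E.-integrable setT (EFin \o (fun z => g z.1 * h z.2)) /\
  \int[(m1 \x m2)%E]_z (g z.1 * h z.2) = \int[m1]_x g x * \int[m2]_y h y.
Proof.
move=> ig ih.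
have mg : measurable_fun setT g by exact/measurable_EFinP/(measurable_int _ ig).
have mh : measurable_fun setT h by exact/measurable_EFinP/(measurable_int _ ih).
have mgh : measurable_fun setT (fun z : T1 * T2 => g z.1 * h z.2).
  apply: measurable_funM.
    by apply: measurableT_comp => //; exact: measurable_fst.
  by apply: measurableT_comp => //; exact: measurable_snd.
have ing := integrable_norm ig; have inh := integrable_norm ih.
have ii : (m1 \x m2)%E.-integrable setT (EFin \o (fun z => g z.1 * h z.2)).
  apply: (dominated_integrable_prod mgh _ _ _ ing inh) => //=.
  by move=> z; rewrite normrM.
split=> //; rewrite -Rintegral_prod12//; last first.
  by move=> x; exact: (RintegrableZl (g x) ih).
rewrite -RintegralZr//; apply: eq_Rintegral => x _.
by rewrite /= RintegralZl.
Qed.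

Lemma cint_tensor (g : T1 -> K[i]) (h : T2 -> K[i]) :
  cintegrable m1 g -> cintegrable m2 h ->
  cintegrable (m1 \x m2)%E (fun z => g z.1 * h z.2) /\
  cint (m1 \x m2)%E (fun z => g z.1 * h z.2) = cint m1 g * cint m2 h.
Proof.
move=> [g1 g2] [h1 h2].
have [i11 e11] := Rintegral_tensor g1 h1.
have [i12 e12] := Rintegral_tensor g1 h2.
have [i21 e21] := Rintegral_tensor g2 h1.
have [i22 e22] := Rintegral_tensor g2 h2.
have RE z : complex.Re (g z.1 * h z.2) = complex.Re (g z.1) * complex.Re (h z.2) -
   complex.Im (g z.1) * complex.Im (h z.2) by rewrite Re_mulc.
have IE z : complex.Im (g z.1 * h z.2) = complex.Re (g z.1) * complex.Im (h z.2) +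
   complex.Im (g z.1) * complex.Re (h z.2) by rewrite Im_mulc.
split.
  split.
    by under eq_fun do rewrite RE; exact: (integrableB measurableT i11 i22).
  by under eq_fun do rewrite IE; exact: (integrableD measurableT i12 i21).
apply: complex_eq; rewrite ?Re_mulc ?Im_mulc/=.
  transitivity (\int[(m1 \x m2)%E]_z (complex.Re (g z.1) * complex.Re (h z.2) -
      complex.Im (g z.1) * complex.Im (h z.2))).
    by apply: eq_Rintegral => z _; rewrite RE.
  by rewrite RintegralB// e11 e22.
transitivity (\int[(m1 \x m2)%E]_z (complex.Re (g z.1) * complex.Im (h z.2) +
    complex.Im (g z.1) * complex.Re (h z.2))).
  by apply: eq_Rintegral => z _; rewrite IE.
by rewrite RintegralD// e12 e21.
Qed.

Section dominated.
Variables (f : T1 * T2 -> K[i]) (g : T1 -> K) (h : T2 -> K).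
Hypotheses (mf : cmeasurable f) (fgh : forall z, Normc.normc (f z) <= g z.1 * h z.2).
Hypotheses (g0 : forall x, 0 <= g x) (h0 : forall y, 0 <= h y).
Hypotheses (ig : m1.-integrable setT (EFin \o g)) (ih : m2.-integrable setT (EFin \o h)).

Let fRe z : `|complex.Re (f z)| <= g z.1 * h z.2.
Proof. exact: le_trans (normc_Re _) (fgh z). Qed.
Let fIm z : `|complex.Im (f z)| <= g z.1 * h z.2.
Proof. exact: le_trans (normc_Im _) (fgh z). Qed.

Lemma cint_prod12 : cint (m1 \x m2)%E f = cint m1 (fun x => cint m2 (fun y => f (x, y))).
Proof.
have [m1' m2'] := mf; apply: complex_eq => /=.
  rewrite -Rintegral_prod12//.
    exact: dominated_integrable_prod m1' fRe g0 h0 ig ih.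
  exact: (dominated_integrable1 m1' fRe ih).
rewrite -Rintegral_prod12//.
  exact: dominated_integrable_prod m2' fIm g0 h0 ig ih.
exact: (dominated_integrable1 m2' fIm ih).
Qed.

Lemma cint_prod21 : cint (m1 \x m2)%E f = cint m2 (fun y => cint m1 (fun x => f (x, y))).
Proof.
have [m1' m2'] := mf; apply: complex_eq => /=.
  rewrite -Rintegral_prod21//.
    exact: dominated_integrable_prod m1' fRe g0 h0 ig ih.
  exact: (dominated_integrable2 m1' fRe ig).
rewrite -Rintegral_prod21//.
  exact: dominated_integrable_prod m2' fIm g0 h0 ig ih.
exact: (dominated_integrable2 m2' fIm ig).
Qed.

End dominated.
End product.

(** The induction follows [lebesgue_rV]: for n = 0 a Dirac mass, which integrates the empty product
    to 1, and then the image under [consrV] of a product measure, which splits off the first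
    factor. *)
Lemma cint_lebesgue_rV_prod n (f : 'I_n -> K -> K[i]) :
  (forall i, cintegrable (@lebesgue_measure K) (f i)) ->
  cintegrable (lebesgue_rV n) (fun v : 'rV[K]_n => \prod_i f i (v ord0 i)) /\
  cint (lebesgue_rV n) (fun v : 'rV[K]_n => \prod_i f i (v ord0 i)) =
  \prod_i cint (@lebesgue_measure K) (f i).
Proof.
elim: n f => [|n IHn] f fi.
  have m1 : cmeasurable (fun v : 'rV[K]_0 => \prod_i f i (v ord0 i)).
    by under eq_fun do rewrite big_ord0; exact: cmeasurable_cst.
  have E (v : 'rV[K]_0) : \prod_i f i (v ord0 i) = 1 by rewrite big_ord0.
  split.
    apply: (cintegrable_dominated (g := fun=> 1)) => //.
      by move=> x; rewrite E Normc.normc1.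
    by apply: finite_measure_integrable_cst.
  rewrite big_ord0 /cint /Rintegral; apply: complex_eq => /=.
    under eq_integral do rewrite E.
    by rewrite integral_dirac// diracE mem_set// mul1e.
  under eq_integral do rewrite E.
  by rewrite integral_dirac// diracE mem_set// mul1e.
have [IH1 IH2] := IHn (fun i => f (lift ord0 i)) (fun i => fi _).
have [T1 T2] := cint_tensor (fi ord0) IH1.
have cE x : \prod_i f i (@consrV K n x ord0 i) =
    f ord0 x.1 * \prod_i f (lift ord0 i) (x.2 ord0 i).
  rewrite big_ord_recl consrV0; congr (_ * _).
  by apply: eq_bigr => i _; rewrite consrVS.
have mE : cmeasurable (fun v : 'rV[K]_n.+1 => \prod_i f i (v ord0 i)).
  apply: cmeasurable_prod => i.
  have [f1 f2] := cmeasurable_integrable (fi i).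
  split.
    exact: (measurableT_comp f1 (@measurable_coord _ (measurableTypeR K) _ i)).
  exact: (measurableT_comp f2 (@measurable_coord _ (measurableTypeR K) _ i)).
have [m1 m2] := mE; have [i1 i2] := T1.
have j1 : (lebesgue_measure \x lebesgue_rV n)%E.-integrable setT
   ((fun v : 'rV[K]_n.+1 => (complex.Re (\prod_i f i (v ord0 i)))%:E) \o @consrV K n).
  by apply: eq_integrable i1 => // x _ /=; rewrite cE.
have j2 : (lebesgue_measure \x lebesgue_rV n)%E.-integrable setT
   ((fun v : 'rV[K]_n.+1 => (complex.Im (\prod_i f i (v ord0 i)))%:E) \o @consrV K n).
  by apply: eq_integrable i2 => // x _ /=; rewrite cE.
have mc := @measurable_consrV K n.
split.
  split.
    apply: (@integrable_pushforward _ _ _ _ _ _ mc _ setT) => //.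
      exact/measurable_EFinP.
  apply: (@integrable_pushforward _ _ _ _ _ _ mc _ setT) => //.
  exact/measurable_EFinP.
rewrite big_ord_recl -IH2 -T2; apply: complex_eq => /=; congr fine.
  rewrite [LHS](@integral_pushforward _ _ _ _ _ _ mc _ setT)//; last exact/measurable_EFinP.
  by rewrite preimage_setT; apply: eq_integral => x _ /=; rewrite cE.
rewrite [LHS](@integral_pushforward _ _ _ _ _ _ mc _ setT)//; last exact/measurable_EFinP.
by rewrite preimage_setT; apply: eq_integral => x _ /=; rewrite cE.
Qed.

Lemma Rintegral_lebesgue_rV_prod n (f : 'I_n -> K -> K) :
  (forall i, (@lebesgue_measure K).-integrable setT (EFin \o f i)) ->
  (lebesgue_rV n).-integrable setT (EFin \o (fun v : 'rV[K]_n => \prod_i f i (v ord0 i))) /\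
  \int[lebesgue_rV n]_v \prod_i f i (v ord0 i) =
  \prod_i \int[@lebesgue_measure K]_x f i x.
Proof.
move=> fi.
have fc i : cintegrable (@lebesgue_measure K) (fun x => (f i x)%:C%C).
  split; first exact: fi.
  by apply: eq_integrable (RintegrableZl 0 (fi i)) => // x _; rewrite /= mul0r.
have [[H1 _] H2] := cint_lebesgue_rV_prod fc.
have cE (v : 'rV[K]_n) : \prod_i (f i (v ord0 i))%:C%C = (\prod_i f i (v ord0 i))%:C%C.
  by rewrite rmorph_prod.
split; first by move: H1; under eq_fun do rewrite cE.
move: H2 => /(congr1 (@complex.Re K)) /=.
under eq_Rintegral do rewrite cE.
move=> ->.
rewrite (eq_bigr (fun i => (\int[@lebesgue_measure K]_x f i x)%:C%C)); last first.
  move=> i _; apply: complex_eq => //=.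
  by rewrite /Rintegral integral0.
by rewrite -rmorph_prod.
Qed.

End complex_integral.

(** * Wave packets *)

Section complex_wave.
Context {K : realType}.
Notation mu := (@lebesgue_measure K).
Implicit Types (Phi psi : K -> K) (th u w : K).

(* The shift of the phase by -pi/2 turns the cosine of [osc] into a sine. *)
Definition cJ Phi th u w : K[i] := Complex (J Phi th u w) (J Phi (th - pi / 2) u w).

Lemma J_phase Phi th al u w : testfun Phi ->
  J Phi (th + al) u w = cos al * J Phi th u w - sin al * J Phi (th - pi / 2) u w.
Proof.
move=> tPhi.
have i1 := osc_integrable th u w tPhi.
have i2 := osc_integrable (th - pi / 2) u w tPhi.
rewrite /J -!RintegralZl// -RintegralB//; [|exact: RintegrableZl|exact: RintegrableZl].
apply: eq_Rintegral => x _; rewrite /osc !addrA cosBpihalf cosD; ring.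
Qed.

Lemma J_Bpi Phi th u w : testfun Phi -> J Phi (th - pi / 2 - pi / 2) u w = - J Phi th u w.
Proof.
move=> tPhi; transitivity (-1 * J Phi th u w); last by rewrite mulN1r.
rewrite /J -RintegralZl//; last exact: osc_integrable.
by apply: eq_Rintegral => x _; rewrite /osc !addrA cosBpihalf sinBpihalf; ring.
Qed.

Lemma cJ_expi Phi th al u w : testfun Phi -> cJ Phi th u w * expi al = cJ Phi (th + al) u w.
Proof.
move=> tPhi; apply: complex_eq; rewrite ?Re_mulc ?Im_mulc /=.
  by rewrite [RHS]J_phase//; ring.
have -> : th + al - pi / 2 = (th - pi / 2) + al by ring.
by rewrite [RHS]J_phase// J_Bpi//; ring.
Qed.

Lemma cint_wave Phi th eta w : testfun Phi ->
  cintegrable mu (fun x => cJ Phi (th - 2 * pi * eta * x) (2 * pi * x) w) /\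
  cint mu (fun x => cJ Phi (th - 2 * pi * eta * x) (2 * pi * x) w) =
  (Phi eta)%:C%C * expi (w * eta ^+ 2 + th).
Proof.
move=> tPhi.
have E x : th - 2 * pi * eta * x - pi / 2 = th - pi / 2 - 2 * pi * eta * x by ring.
split.
  split; first exact: integrable_wave.
  by under eq_fun do rewrite /= E; exact: integrable_wave.
apply: complex_eq; rewrite ?Re_mulc ?Im_mulc /=.
  by rewrite mul0r subr0; exact: Rintegral_wave.
rewrite mul0r addr0 -cosBpihalf -addrA.
transitivity (\int[mu]_x wave Phi (th - pi / 2) eta w x); last exact: Rintegral_wave.
by apply: eq_Rintegral => x _; rewrite E.
Qed.

Lemma cJ_cint Phi u w : testfun Phi ->
  cintegrable mu (fun x => (Phi x)%:C%C * expi (u * x + w * x ^+ 2)) /\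
  cint mu (fun x => (Phi x)%:C%C * expi (u * x + w * x ^+ 2)) = cJ Phi 0 u w.
Proof.
move=> tPhi.
have RE x : complex.Re ((Phi x)%:C%C * expi (u * x + w * x ^+ 2)) = osc Phi 0 u w x.
  by rewrite Re_mulc/= mul0r subr0 /osc addr0.
have IE x : complex.Im ((Phi x)%:C%C * expi (u * x + w * x ^+ 2)) = osc Phi (0 - pi / 2) u w x.
  by rewrite Im_mulc/= mul0r addr0 /osc sub0r cosBpihalf.
split.
  split; [under eq_fun do rewrite RE|under eq_fun do rewrite IE]; exact: osc_integrable.
by apply: complex_eq; rewrite /=; apply: eq_Rintegral => x _; [exact: RE|exact: IE].
Qed.

(** The substitution y = a x - c in the quadratic phase. The cross term 2 w c / a^2 added to the
    linear coefficient is the Galilean shift that later gives a packet its velocity; w / a^2 is the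
    parabolic rescaling of time. *)
Lemma J_affine Phi (a c th u w : K) : 0 < a -> testfun Phi ->
  J (fun x => Phi (a * x - c)) th u w =
  a^-1 * J Phi (th + u * c / a + w * c ^+ 2 / a ^+ 2) (u / a + 2 * w * c / a ^+ 2) (w / a ^+ 2).
Proof.
move=> a0 tPhi; set th' := th + _ + _; set u' := _ + _; set w' := w / _.
(* [osc] has no sign, so it is split into a bounded continuous factor and the integrable [lor], the
   shape that [Rintegral_affine] treats. *)
pose H x := osc Phi th' u' w' x * (1 + x ^+ 2).
have HE x : osc Phi th' u' w' x = H x * lor x.
  by rewrite /H -mulrA divff ?mulr1// gt_eqF// oneDsqr_gt0.
have [M0 M00 HM0] := testfun_bounded tPhi.
have [M2 M20 HM2] := testfun_bounded (testfunX 2 tPhi).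
have cH : continuous H.
  move=> x; apply: cvgM; first exact: osc_continuous.
  exact: continuous_oneDsqr.
have HM x : `|H x| <= M0 + M2.
  rewrite /H mulrDr mulr1 (le_trans (ler_normD _ _))// lerD//.
    by rewrite (le_trans (norm_osc_le _ _ _ _ _)).
  rewrite mulrC normrM (le_trans _ (HM2 x))// [leRHS]normrM ler_wpM2l//.
  exact: norm_osc_le.
have -> : J Phi th' u' w' = \int[mu]_x (H x * lor x).
  by apply: eq_Rintegral => x _; exact: HE.
rewrite (@Rintegral_affine K H lor a (- c) (M0 + M2))//; last 3 first.
- exact: continuous_lor.
- exact: lor_ge0.
- exact: integrable_lor.
have an : a != 0 by rewrite gt_eqF.
have E (x : K) : H (a * x + - c) * (lor (a * x + - c) * a) = a * osc (fun x => Phi (a * x - c)) th u w x.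
  rewrite mulrA -HE mulrC /osc; congr (_ * (_ * cos _)).
  by rewrite /th' /u' /w'; field.
have tac : testfun (fun x => Phi (a * x - c)) by exact: testfun_affine.
transitivity (a^-1 * \int[mu]_x (a * osc (fun x => Phi (a * x - c)) th u w x)); last first.
  by congr (_ * _); apply: eq_Rintegral => x _; rewrite E.
rewrite RintegralZl ?mulKf//; exact: osc_integrable.
Qed.

Lemma J_translate Phi c th u : testfun Phi ->
  J (fun x => Phi (x - c)) th u 0 = J Phi (u * c + th) u 0.
Proof.
move=> tPhi; have := @J_affine Phi 1 c th u 0 ltr01 tPhi.
under [X in J X]eq_fun do rewrite mul1r.
by rewrite !expr1n !invr1 !mulr1 mul1r !mulr0 !mul0r !addr0 addrC.
Qed.

Lemma J_weight N Phi : testfun Phi -> exists2 C : K, 0 <= C &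
  forall th u w, (1 + `|u|) ^+ N * `|J Phi th u w| <= C * (1 + `|w|) ^+ N.
Proof.
move=> tPhi.
have [C0 C00 H0] := J_decay 0 tPhi; have [C1 C10 H1] := J_decay N tPhi.
exists (2 ^+ N * (C0 + C1)); first by rewrite mulr_ge0 ?exprn_ge0 ?addr_ge0.
move=> th u w.
have := H0 th u w; rewrite !expr0 mul1r mulr1 => h0.
have h1 := H1 th u w.
have w1 : 1 <= (1 + `|w|) ^+ N by rewrite exprn_ege1// lerDl.
have u1 : (1 + `|u|) ^+ N <= 2 ^+ N * (1 + `|u| ^+ N).
  have [uu|/ltW uu] := leP `|u| 1.
    rewrite (@le_trans _ _ (2 ^+ N))//; first by rewrite lerXn2r ?nnegrE ?addr_ge0//; lra.
    by rewrite ler_peMr ?exprn_ge0// lerDl exprn_ge0.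
  rewrite (@le_trans _ _ ((2 * `|u|) ^+ N))//.
    by rewrite lerXn2r ?nnegrE ?addr_ge0 ?mulr_ge0//; lra.
  by rewrite exprMn ler_wpM2l ?exprn_ge0// lerDr.
rewrite (le_trans (ler_wpM2r _ u1))// -!mulrA ler_wpM2l ?exprn_ge0//.
rewrite !mulrDl mul1r lerD//.
by rewrite (le_trans h0)// ler_peMr.
Qed.

Lemma normc_cJ_weight N Phi : testfun Phi -> exists2 C : K, 0 <= C &
  forall th u w, (1 + `|u|) ^+ N * Normc.normc (cJ Phi th u w) <= C * (1 + `|w|) ^+ N.
Proof.
move=> tPhi; have [C C0 H] := J_weight N tPhi.
exists (2 * C); first by rewrite mulr_ge0.
move=> th u w.
have u0 : 0 < (1 + `|u|) ^+ N by rewrite exprn_gt0// ltr_wpDr.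
rewrite mulrC -ler_pdivlMr// -!mulrA; apply: normc_le => /=;
  by rewrite mulrA ler_pdivlMr// mulrC.
Qed.

End complex_wave.

(** * Fourier transforms of packets *)

Section wave_packet.
Context {K : realType} (d : nat).
Notation mu := (@lebesgue_measure K).
Notation E := ('rV[K]_d * K)%type.
Implicit Types (psi : K -> K) (Phi : 'I_d -> K -> K) (z : E).

(** The inverse Fourier transform of [spectrum] in factored form: the shear of the last frequency by
    |xi|^2 has become the quadratic coefficient 2 pi t of each spatial integral. *)
Definition packet psi Phi z : K[i] :=
  cJ psi 0 (2 * pi * z.2) 0 * \prod_i cJ (Phi i) 0 (2 * pi * z.1 ord0 i) (2 * pi * z.2).

Definition spectrum psi Phi z : K :=
  psi (z.2 - dotrV z.1 z.1) * \prod_i Phi i (z.1 ord0 i).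

Lemma onorm_ge1 (t : K) : 1 <= 1 + `|t|. Proof. by rewrite lerDl. Qed.

Lemma onorm_lor (t : K) : 1 <= (1 + `|t|) ^+ 2 * lor t.
Proof.
rewrite /lor ler_pdivlMr ?oneDsqr_gt0// mul1r -(real_normK (num_real t)).
have := normr_ge0 t; nra.
Qed.

Lemma onorm_pi (t : K) : 1 + `|t| <= 1 + `|2 * pi * t|.
Proof.
rewrite lerD2l normrM ler_peMl// ger0_norm ?(le_trans _ pi2_ge1)//.
Qed.

Lemma onorm_pi_le (t : K) : 1 + `|2 * pi * t| <= 2 * pi * (1 + `|t|).
Proof.
have := @pi2_ge1 K => p1.
rewrite normrM (ger0_norm (_ : 0 <= 2 * pi)); lra.
Qed.

Lemma packet_bound psi Phi : testfun psi -> (forall i, testfun (Phi i)) ->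
  exists2 C : K, 0 <= C & forall z, Normc.normc (packet psi Phi z) <=
    (\prod_i lor (z.1 ord0 i)) * (C * lor z.2).
Proof.
move=> tpsi tPhi.
(* Each of the d spatial factors loses (1 + |t|)^2; order 2d + 2 pays for these losses and leaves (1
   + |t|)^-2, which is at most [lor z.2]. *)
have [C C0 HC] := normc_cJ_weight (2 * d + 2) tpsi.
have /choice [D HD] : forall i, exists D : K, 0 <= D /\ forall th u w,
   (1 + `|u|) ^+ 2 * Normc.normc (cJ (Phi i) th u w) <= D * (1 + `|w|) ^+ 2.
  by move=> i; have [D D0 H] := normc_cJ_weight 2 (tPhi i); exists D.
have D0 i := (HD i).1; have {}HD i := (HD i).2.
have p0 : 0 <= 2 * pi :> K by rewrite (le_trans _ pi2_ge1).
exists (C * \prod_i (D i * (2 * pi) ^+ 2)).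
  by rewrite mulr_ge0// prodr_ge0// => i _; rewrite mulr_ge0// exprn_ge0.
move=> z; rewrite /packet Normc.normcM normc_prod.
have t1 := onorm_ge1 z.2.
have t0 : 0 < 1 + `|z.2| by rewrite (lt_le_trans _ t1).
have h1 i : Normc.normc (cJ (Phi i) 0 (2 * pi * z.1 ord0 i) (2 * pi * z.2)) <=
    lor (z.1 ord0 i) * (D i * (2 * pi) ^+ 2) * (1 + `|z.2|) ^+ 2.
  have := HD i 0 (2 * pi * z.1 ord0 i) (2 * pi * z.2).
  have := onorm_lor (z.1 ord0 i).
  have := normc_ge0 (cJ (Phi i) 0 (2 * pi * z.1 ord0 i) (2 * pi * z.2)).
  have : (1 + `|z.1 ord0 i|) ^+ 2 <= (1 + `|2 * pi * z.1 ord0 i|) ^+ 2.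
    by rewrite lerXn2r ?nnegrE ?addr_ge0// onorm_pi.
  have : (1 + `|2 * pi * z.2|) ^+ 2 <= (2 * pi) ^+ 2 * (1 + `|z.2|) ^+ 2.
    have pl := onorm_pi_le z.2.
    rewrite -exprMn lerXn2r ?nnegrE//.
    by rewrite mulr_ge0// ltW.
  have := lor_ge0 (z.1 ord0 i); have := D0 i.
  move: (Normc.normc _) (lor _) (D i) ((1 + `|z.1 ord0 i|) ^+ 2).
  move: ((1 + `|2 * pi * z.1 ord0 i|) ^+ 2) ((1 + `|2 * pi * z.2|) ^+ 2).
  move: ((2 * pi) ^+ 2 : K) ((1 + `|z.2|) ^+ 2) => P T X2 T2 N l Di X Di0 l0 TP XX N0 Xl H.
  rewrite (le_trans (ler_peMl N0 Xl))// mulrAC [leRHS](_ : _ = Di * (P * T) * l); last by ring.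
  rewrite ler_wpM2r// (le_trans (ler_wpM2r N0 XX))// (le_trans H)//.
  by rewrite ler_wpM2l.
have h2 : \prod_i Normc.normc (cJ (Phi i) 0 (2 * pi * z.1 ord0 i) (2 * pi * z.2)) <=
    (\prod_i lor (z.1 ord0 i)) * (\prod_i (D i * (2 * pi) ^+ 2)) * (1 + `|z.2|) ^+ (2 * d).
  rewrite [X in _ <= _ * X](_ : _ = \prod_(i < d) (1 + `|z.2|) ^+ 2); last first.
    by rewrite prodr_const card_ord exprM.
  rewrite -!big_split; apply: ler_prod => i _; apply/andP.
  by split; [exact: normc_ge0|exact: h1].
have h3 : (1 + `|z.2|) ^+ (2 * d + 2) * Normc.normc (cJ psi 0 (2 * pi * z.2) 0) <= C.
  have := HC 0 (2 * pi * z.2) 0; rewrite normr0 addr0 expr1n mulr1; apply: le_trans.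
  by rewrite ler_wpM2r ?normc_ge0// lerXn2r ?nnegrE ?addr_ge0// onorm_pi.
rewrite (le_trans (ler_wpM2l (normc_ge0 _) h2))//.
have P0 : 0 <= (\prod_i lor (z.1 ord0 i)) * (\prod_i (D i * (2 * pi) ^+ 2)).
  rewrite mulr_ge0// prodr_ge0// => i _; first exact: lor_ge0.
  by rewrite mulr_ge0// exprn_ge0.
have T0 : 0 <= (1 + `|z.2|) ^+ (2 * d) by rewrite exprn_ge0// ltW.
move: h3 P0 T0 (onorm_lor z.2) (lor_ge0 z.2) (normc_ge0 (cJ psi 0 (2 * pi * z.2) 0)).
rewrite exprD.
move: (Normc.normc _) (lor z.2) (\prod_i lor _) (\prod_i (D i * _)).
move: ((1 + `|z.2|) ^+ (2 * d)) ((1 + `|z.2|) ^+ 2) => T T2 N l L P h3 P0 T0 Tl l0 N0.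
rewrite [leLHS](_ : _ = L * P * (N * T)); last by ring.
rewrite [leRHS](_ : _ = L * P * (C * l)); last by ring.
rewrite ler_wpM2l// (le_trans (ler_peMl (mulr_ge0 N0 T0) Tl))//.
rewrite [leLHS](_ : _ = T * T2 * N * l); last by ring.
by rewrite ler_wpM2r.
Qed.

Lemma cmeasurable_packet psi Phi : testfun psi -> (forall i, testfun (Phi i)) ->
  cmeasurable (packet psi Phi : 'rV[K]_d * measurableTypeR K -> K[i]).
Proof.
move=> tpsi tPhi.
have m2 : measurable_fun setT (@snd 'rV[K]_d (measurableTypeR K)) by exact: measurable_snd.
have m1 i : measurable_fun setT (fun z : 'rV[K]_d * measurableTypeR K => z.1 ord0 i).
  exact: (measurableT_comp (@measurable_coord _ (measurableTypeR K) d i) measurable_fst).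
apply: cmeasurableM.
  by split; apply: measurable_J => //; exact: measurable_funM.
by apply: cmeasurable_prod => i; split; apply: measurable_J => //; exact: measurable_funM.
Qed.

Lemma integrable_prod_lor :
  (lebesgue_rV d).-integrable setT (EFin \o (fun v : 'rV[K]_d => \prod_i lor (v ord0 i))).
Proof.
by have [] := @Rintegral_lebesgue_rV_prod K d (fun _ => lor) (fun _ => integrable_lor).
Qed.

Lemma prod_lor_ge0 (v : 'rV[K]_d) : 0 <= \prod_i lor (v ord0 i).
Proof. by apply: prodr_ge0 => i _; exact: lor_ge0. Qed.

Lemma cmeasurable_expi d' (T : measurableType d') (f : T -> K) : measurable_fun setT f ->
  cmeasurable (fun y => expi (f y)).
Proof.
move=> mf; split => /=.
  by apply: (measurableT_comp _ mf); apply: continuous_measurable_fun; exact: continuous_cos.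
by apply: (measurableT_comp _ mf); apply: continuous_measurable_fun; exact: continuous_sin.
Qed.

Lemma normc_expi (t : K) : Normc.normc (expi t) = 1.
Proof. by rewrite /= cos2Dsin2 sqrtr1. Qed.

Lemma measurable_dot_st (x : E) :
  measurable_fun setT (fun z : 'rV[K]_d * measurableTypeR K => dot_st x z).
Proof.
apply: measurable_funD; last by apply: measurable_funM => //; exact: measurable_snd.
apply: measurable_sum => i; apply: measurable_funM => //.
exact: (measurableT_comp (@measurable_coord _ (measurableTypeR K) d i) measurable_fst).
Qed.

Lemma dot_stC (x y : E) : dot_st x y = dot_st y x.
Proof.
rewrite /dot_st /dotrV mulrC; congr (_ + _).
by apply: eq_bigr => i _; rewrite mulrC.
Qed.

(** Space is integrated first, at fixed t: inversion in each coordinate gives Phi_i(eta_i) exp(2 pi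
    i t eta_i^2). These phases add up to 2 pi t |eta|^2 and shift the frequency sigma to sigma -
    |eta|^2 in the remaining inversion in t. *)
Lemma fourier_packet psi Phi : testfun psi -> (forall i, testfun (Phi i)) ->
  fourier (packet psi Phi) = fun z => (spectrum psi Phi z)%:C%C.
Proof.
move=> tpsi tPhi; apply/funext => -[eta sigma].
have [C C0 HC] := packet_bound tpsi tPhi.
pose f (z : 'rV[K]_d * measurableTypeR K) :=
  packet psi Phi z * expi (- (2 * pi * dot_st z (eta, sigma))).
have mf : cmeasurable f.
  apply: cmeasurableM; first exact: cmeasurable_packet.
  apply: cmeasurable_expi; apply: measurableT_comp => //; apply: measurable_funM => //.
  by under eq_fun do rewrite dot_stC; exact: measurable_dot_st.
have fb z : Normc.normc (f z) <= (\prod_i lor (z.1 ord0 i)) * (C * lor z.2).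
  by rewrite Normc.normcM normc_expi mulr1; exact: HC.
have fE x t : f (x, t) = cJ psi (0 - 2 * pi * sigma * t) (2 * pi * t) 0 *
   \prod_i cJ (Phi i) (0 - 2 * pi * eta ord0 i * x ord0 i) (2 * pi * x ord0 i) (2 * pi * t).
  rewrite /f /packet /=.
  have -> : - (2 * pi * dot_st (x, t) (eta, sigma)) =
     (- (2 * pi * sigma * t)) + \sum_i (- (2 * pi * eta ord0 i * x ord0 i)).
    rewrite /dot_st /dotrV /= mulrDr opprD addrC; congr (_ + _); first by ring.
    rewrite mulr_sumr -sumrN; apply: eq_bigr => i _; ring.
  rewrite expiD expi_sum mulrACA cJ_expi// -big_split/=; congr (_ * _).
  by apply: eq_bigr => i _; rewrite cJ_expi.
rewrite /fourier.
transitivity (cint (lebesgue_rV d \x @lebesgue_measure K)%E f); first by [].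
have h0 (t : K) : 0 <= C * lor t by rewrite mulr_ge0// lor_ge0.
have ih := RintegrableZl C (@integrable_lor K).
rewrite (cint_prod21 mf fb prod_lor_ge0 h0 integrable_prod_lor ih).
transitivity (cint (@lebesgue_measure K) (fun t => (\prod_i Phi i (eta ord0 i))%:C%C *
   cJ psi (0 - 2 * pi * (sigma - dotrV eta eta) * t) (2 * pi * t) 0)).
  apply: eq_cint => t.
  under eq_fun do rewrite fE.
  have ci i := cint_wave 0 (eta ord0 i) (2 * pi * t) (tPhi i).
  have [P1 P2] := cint_lebesgue_rV_prod (fun i => (ci i).1).
  rewrite cintZl// P2.
  rewrite (eq_bigr (fun i => (Phi i (eta ord0 i))%:C%C * expi (2 * pi * t * eta ord0 i ^+ 2 + 0))); last first.
    by move=> i _; rewrite (ci i).2.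
  rewrite big_split/= -rmorph_prod -expi_sum.
  rewrite mulrCA.
  rewrite cJ_expi//.
  congr (_ * _).
  congr (cJ psi _ _ _).
  rewrite (eq_bigr (fun i => 2 * pi * t * (eta ord0 i * eta ord0 i))); last first.
    by move=> i _; rewrite addr0 expr2.
  rewrite -mulr_sumr -/(dotrV eta eta); ring.
have [W1 W2] := cint_wave 0 (sigma - dotrV eta eta) 0 tpsi.
rewrite cintZl// W2 mul0r add0r expi0 mulr1 -rmorphM; congr (_%:C)%C.
by rewrite /spectrum /= mulrC.
Qed.

Lemma testfun_lor_bound (f : K -> K) : testfun f ->
  exists2 C : K, 0 <= C & forall x, `|f x| <= C * lor x.
Proof.
move=> tf; have [M M0 HM] := testfun_bounded tf.
have [N N0 HN] := testfun_bounded (testfunX 2 tf).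
exists (M + N) => [|x]; first by rewrite addr_ge0.
rewrite /lor ler_pdivlMr ?oneDsqr_gt0// mulrDr mulr1 lerD//.
by rewrite (le_trans _ (HN x))// normrM mulrC ler_wpM2r// ler_norm.
Qed.

Lemma spectrum_bound psi Phi : testfun psi -> (forall i, testfun (Phi i)) ->
  exists2 C : K, 0 <= C & forall z, `|spectrum psi Phi z| <=
    (\prod_i lor (z.1 ord0 i)) * (C * lor z.2).
Proof.
move=> tpsi tPhi.
have /choice [D HD] : forall i, exists D : K, 0 <= D /\ forall x, `|Phi i x| <= D * lor x.
  by move=> i; have [D D0 H] := testfun_lor_bound (tPhi i); exists D.
have /choice [A HA] : forall i, exists A : K, forall x, A <= `|x| -> Phi i x = 0.
  by move=> i; have [_ [A _ H]] := tPhi i; exists A.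
have [M M0 HM] := testfun_bounded tpsi.
have [_ [A0 A00 HA0]] := tpsi.
(* Where the spectrum is nonzero, |x_i| < A_i and |t - |x|^2| < A0, so |t| <= B, and the factor 1 +
   B^2 makes up for [lor t]. *)
pose B := A0 + \sum_i A i ^+ 2.
have P0 : 0 <= \prod_i D i by apply: prodr_ge0 => i _; exact: (HD i).1.
have C0 : 0 <= M * (1 + B ^+ 2) * \prod_i D i.
  by rewrite mulr_ge0// mulr_ge0// ltW// oneDsqr_gt0.
exists (M * (1 + B ^+ 2) * \prod_i D i) => // -[x t] /=.
have R0 : 0 <= \prod_i lor (x ord0 i) * (M * (1 + B ^+ 2) * (\prod_i D i) * lor t).
  by rewrite mulr_ge0 ?prod_lor_ge0// mulr_ge0// lor_ge0.
rewrite /spectrum /=.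
have [/existsP[i /HA xi]|] := boolP [exists i, A i <= `|x ord0 i|].
  by rewrite (bigD1 i)//= xi mul0r mulr0 normr0.
rewrite negb_exists => /forallP xA.
have [/HA0 ->|tA] := leP A0 `|t - dotrV x x|; first by rewrite mul0r normr0.
have x0 : 0 <= dotrV x x.
  by apply: sumr_ge0 => i _; rewrite -expr2 sqr_ge0.
have xB : dotrV x x <= \sum_i A i ^+ 2.
  apply: ler_sum => i _; rewrite -expr2 -(real_normK (num_real (x ord0 i))).
  have := xA i; rewrite -ltNge => /ltW xAi.
  by rewrite lerXn2r ?nnegrE// (le_trans _ xAi).
have tB : t ^+ 2 <= B ^+ 2.
  have tB : `|t| <= B.
    have tE : t = (t - dotrV x x) + dotrV x x by rewrite subrK.
    rewrite {1}tE (le_trans (ler_normD _ _))// lerD//; first exact: ltW.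
    by rewrite ger0_norm.
  rewrite -(real_normK (num_real t)) lerXn2r ?nnegrE//.
  by rewrite (le_trans _ tB).
have l1 : 1 <= (1 + B ^+ 2) * lor t.
  by rewrite /lor ler_pdivlMr ?oneDsqr_gt0// mul1r lerD2l.
rewrite normrM normr_prod.
have -> : \prod_i lor (x ord0 i) * (M * (1 + B ^+ 2) * (\prod_i D i) * lor t) =
   (M * ((1 + B ^+ 2) * lor t)) * ((\prod_i D i) * \prod_i lor (x ord0 i)) by ring.
apply: ler_pM => //.
- by apply: prodr_ge0.
- by rewrite (le_trans (HM _))// ler_peMr.
- rewrite -big_split/=; apply: ler_prod => i _.
  by rewrite normr_ge0 (HD i).2.
Qed.

(** Here the last frequency is integrated first: the translate of [psi] by |y|^2 contributes exp(2
    pi i t |y|^2), whose terms join the linear phases coordinate by coordinate. *)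
Lemma inv_fourier_spectrum psi Phi : testfun psi -> (forall i, testfun (Phi i)) ->
  inv_fourier (fun z => (spectrum psi Phi z)%:C%C) = packet psi Phi.
Proof.
move=> tpsi tPhi; apply/funext => -[x t].
have [C C0 HC] := spectrum_bound tpsi tPhi.
pose f (z : 'rV[K]_d * measurableTypeR K) :=
  (spectrum psi Phi z)%:C%C * expi (2 * pi * dot_st (x, t) z).
have m2 : measurable_fun setT (@snd 'rV[K]_d (measurableTypeR K)) by exact: measurable_snd.
have m1 i : measurable_fun setT (fun z : 'rV[K]_d * measurableTypeR K => z.1 ord0 i).
  exact: (measurableT_comp (@measurable_coord _ (measurableTypeR K) d i) measurable_fst).
have mf : cmeasurable f.
  apply: cmeasurableM.
    split; last exact: measurable_cst.
    apply: measurable_funM.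
      apply: (measurableT_comp (testfun_measurable tpsi)).
      apply: measurable_funB => //; apply: measurable_sum => i.
      exact: measurable_funM.
    apply: measurable_prod => i _; exact: (measurableT_comp (testfun_measurable (tPhi i)) (m1 i)).
  apply: cmeasurable_expi; apply: measurable_funM => //.
  exact: measurable_dot_st.
have fb z : Normc.normc (f z) <= (\prod_i lor (z.1 ord0 i)) * (C * lor z.2).
  by rewrite Normc.normcM normc_expi mulr1 /= expr0n addr0 sqrtr_sqr; exact: HC.
have fE y s : f (y, s) = (\prod_i ((Phi i (y ord0 i))%:C%C * expi (2 * pi * x ord0 i * y ord0 i))) *
   ((psi (s - dotrV y y))%:C%C * expi (2 * pi * t * s + 0 * s ^+ 2)).
  rewrite /f /spectrum /=.
  have -> : 2 * pi * dot_st (x, t) (y, s) =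
     (2 * pi * t * s + 0 * s ^+ 2) + \sum_i (2 * pi * x ord0 i * y ord0 i).
    rewrite /dot_st /dotrV /= mulrDr addrC; congr (_ + _); first by ring.
    rewrite mulr_sumr; apply: eq_bigr => i _; ring.
  rewrite expiD expi_sum rmorphM rmorph_prod/= big_split/=; ring.
have h0 (s : K) : 0 <= C * lor s by rewrite mulr_ge0// lor_ge0.
have ih := RintegrableZl C (@integrable_lor K).
rewrite /inv_fourier.
transitivity (cint (lebesgue_rV d \x @lebesgue_measure K)%E f); first by [].
rewrite (cint_prod12 mf fb prod_lor_ge0 h0 integrable_prod_lor ih).
transitivity (cint (lebesgue_rV d) (fun y => cJ psi 0 (2 * pi * t) 0 *
   \prod_i ((Phi i (y ord0 i))%:C%C * expi (2 * pi * x ord0 i * y ord0 i + 2 * pi * t * y ord0 i ^+ 2)))).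
  apply: eq_cint => y.
  under eq_fun do rewrite fE.
  have tpsi' : testfun (fun s => psi (s - dotrV y y)).
    have := testfun_affine (- dotrV y y) (oner_neq0 K) tpsi.
    by under eq_fun do rewrite mul1r.
  have [I1 I2] := cJ_cint (2 * pi * t) 0 tpsi'.
  rewrite cintZl// I2.
  have -> : cJ (fun s => psi (s - dotrV y y)) 0 (2 * pi * t) 0 =
     cJ psi 0 (2 * pi * t) 0 * expi (2 * pi * t * dotrV y y).
    rewrite cJ_expi//; apply: complex_eq => /=; rewrite J_translate//.
      by rewrite addr0 add0r.
    by congr (J _ _ _ _); ring.
  rewrite mulrCA; congr (_ * _).
  rewrite mulr_sumr expi_sum -big_split/=; apply: eq_bigr => i _.
  by rewrite -[LHS]mulrA; congr (_ * _); rewrite -expiD; congr expi; ring.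
have ci i := cJ_cint (2 * pi * x ord0 i) (2 * pi * t) (tPhi i).
have [P1 P2] := cint_lebesgue_rV_prod (fun i => (ci i).1).
rewrite cintZl// P2 /packet/=; congr (_ * _).
by apply: eq_bigr => i _; rewrite (ci i).2.
Qed.

End wave_packet.

(** * Decay of iterated derivatives and the Schwartz property *)

Section bounded_derivatives.
Context {K : realType} {V : normedModType K}.
Implicit Types (f g : V -> K) (P Q S : (V -> K) -> Prop).

(** Recursion on arbitrary directions matches [iter_derive]. The class [P] is a parameter because
    the factors of a packet lie in different decay classes, and [derivatives_inM] runs the Leibniz
    rule between them. *)
Fixpoint derivatives_in P n f : Prop := P f /\
  if n is m.+1 then (forall x, differentiable f x) /\
    forall v, derivatives_in P m (fun x => 'D_v f x) else True.

Lemma derivatives_inP P n f : derivatives_in P n f -> P f.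
Proof. by case: n => [|n] []. Qed.

Lemma derivatives_inW P n f : derivatives_in P n.+1 f -> derivatives_in P n f.
Proof.
elim: n f => [|n IH] f [Pf [df Df]]; first by [].
by split=> //; split=> // v; apply: IH; exact: Df.
Qed.

Lemma derivatives_inD P n f g : (forall f g, P f -> P g -> P (fun x => f x + g x)) ->
  derivatives_in P n f -> derivatives_in P n g -> derivatives_in P n (fun x => f x + g x).
Proof.
move=> PD; elim: n f g => [|n IH] f g [Pf Hf] [Pg Hg]; first by split=> //; exact: PD.
have [df Df] := Hf; have [dg Dg] := Hg.
split; first exact: PD.
split; first by move=> x; exact: differentiableD.
move=> v; rewrite (_ : (fun x => _) = (fun x => 'D_v f x + 'D_v g x)); first by apply: IH; [exact: Df|exact: Dg].
by apply/funext => x; rewrite -[LHS]/('D_v (f + g) x) deriveD//; exact: diff_derivable.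
Qed.

Lemma derivatives_inZ P n c f : (forall f, P f -> P (fun x => c * f x)) ->
  derivatives_in P n f -> derivatives_in P n (fun x => c * f x).
Proof.
move=> PZ; elim: n f => [|n IH] f [Pf Hf]; first by split=> //; exact: PZ.
have [df Df] := Hf.
split; first exact: PZ.
split; first by move=> x; exact: (@differentiableZ _ _ _ f c).
move=> v; rewrite (_ : (fun x => _) = (fun x => c * 'D_v f x)); first by apply: IH; exact: Df.
by apply/funext => x; rewrite -[LHS]/('D_v (c \*: f) x) deriveZ//; exact: diff_derivable.
Qed.

Lemma derivatives_inM P Q S n f g :
  (forall f g, P f -> Q g -> S (fun x => f x * g x)) ->
  (forall f g, S f -> S g -> S (fun x => f x + g x)) ->
  derivatives_in P n f -> derivatives_in Q n g -> derivatives_in S n (fun x => f x * g x).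
Proof.
move=> PQS SD; elim: n f g => [|n IH] f g Hf Hg.
  by split=> //; apply: PQS; [exact: derivatives_inP Hf|exact: derivatives_inP Hg].
have [Pf [df Df]] := Hf; have [Qg [dg Dg]] := Hg.
split; first exact: PQS.
split; first by move=> x; exact: differentiableM.
move=> v; rewrite (_ : (fun x => _) = (fun x => 'D_v f x * g x + f x * 'D_v g x)).
  apply: derivatives_inD => //.
    by apply: IH; [exact: Df|exact: derivatives_inW Hg].
  by apply: IH; [exact: derivatives_inW Hf|exact: Dg].
apply/funext => x; rewrite -[LHS]/('D_v (f * g) x) deriveM//; last 2 first.
- exact: diff_derivable.
- exact: diff_derivable.
by rewrite addrC /GRing.scale/= mulrC.
Qed.

End bounded_derivatives.

Section schwartz_packet.
Context {K : realType} (d : nat).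
Notation E := ('rV[K]_d * K)%type.
Implicit Types (f g : E -> K) (z : E).

(** Decay in the coordinates listed in [s], at a polynomial cost in time. A spatial factor of a
    packet decays in its own coordinate only, and the list grows as factors are multiplied until it
    enumerates all of them. *)
Definition space_decay (s : seq 'I_d) f := forall N : nat, exists C : K, exists M : nat,
  0 <= C /\ forall z, (\prod_(i <- s) (1 + `|z.1 ord0 i|)) ^+ N * `|f z| <= C * (1 + `|z.2|) ^+ M.

Definition time_decay f := forall N : nat, exists C : K,
  0 <= C /\ forall z, (1 + `|z.2|) ^+ N * `|f z| <= C.

Definition rapid_decay f := forall N : nat, exists C : K, forall z, (1 + `|z|) ^+ N * `|f z| <= C.

Lemma prod_onorm_ge1 (s : seq 'I_d) (x : 'rV[K]_d) : 1 <= \prod_(i <- s) (1 + `|x ord0 i|).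
Proof.
elim: s => [|i s IH]; first by rewrite big_nil.
by rewrite big_cons mulr_ege1// lerDl.
Qed.

Lemma space_decayD s f g : space_decay s f -> space_decay s g -> space_decay s (fun z => f z + g z).
Proof.
move=> Hf Hg N; have [C [M [C0 H]]] := Hf N; have [C' [M' [C'0 H']]] := Hg N.
exists (C + C'), (M + M')%N; split=> [|z]; first exact: addr_ge0.
have P1 := prod_onorm_ge1 s z.1.
have PN : 0 <= (\prod_(i <- s) (1 + `|z.1 ord0 i|)) ^+ N by rewrite exprn_ge0// (le_trans _ P1).
rewrite (le_trans (ler_wpM2l PN (ler_normD _ _)))// mulrDr mulrDl.
have t1 : 1 <= 1 + `|z.2| by rewrite lerDl.
rewrite lerD//.
  by rewrite (le_trans (H z))// ler_wpM2l// ler_weXn2l// leq_addr.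
by rewrite (le_trans (H' z))// ler_wpM2l// ler_weXn2l// leq_addl.
Qed.

Lemma space_decayZ s c f : space_decay s f -> space_decay s (fun z => c * f z).
Proof.
move=> Hf N; have [C [M [C0 H]]] := Hf N.
exists (`|c| * C), M; split=> [|z]; first by rewrite mulr_ge0.
by rewrite normrM mulrCA -mulrA ler_wpM2l.
Qed.

Lemma space_decayM s s' f g : space_decay s f -> space_decay s' g ->
  space_decay (s ++ s') (fun z => f z * g z).
Proof.
move=> Hf Hg N; have [C [M [C0 H]]] := Hf N; have [C' [M' [C'0 H']]] := Hg N.
exists (C * C'), (M + M')%N; split=> [|z]; first exact: mulr_ge0.
have P1 := prod_onorm_ge1 s z.1; have P2 := prod_onorm_ge1 s' z.1.
rewrite big_cat/= exprMn normrM mulrACA exprD [leRHS]mulrACA.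
by apply: ler_pM => //; rewrite mulr_ge0// exprn_ge0// (le_trans _ P1, le_trans _ P2).
Qed.

Lemma space_decay_cst c : space_decay [::] (fun=> c).
Proof.
move=> N; exists `|c|, 0%N; split=> // z.
by rewrite big_nil expr1n mul1r expr0 mulr1.
Qed.

Lemma time_decayZ c f : time_decay f -> time_decay (fun z => c * f z).
Proof.
move=> Hf N; have [C [C0 H]] := Hf N.
exists (`|c| * C); split=> [|z]; first by rewrite mulr_ge0.
by rewrite normrM mulrCA ler_wpM2l.
Qed.

Lemma rapid_decayD f g : rapid_decay f -> rapid_decay g -> rapid_decay (fun z => f z + g z).
Proof.
move=> Hf Hg N; have [C H] := Hf N; have [C' H'] := Hg N.
exists (C + C') => z.
have TN : 0 <= (1 + `|z|) ^+ N by rewrite exprn_ge0// addr_ge0.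
by rewrite (le_trans (ler_wpM2l TN (ler_normD _ _)))// mulrDr lerD.
Qed.

Lemma rapid_decayZ c f : rapid_decay f -> rapid_decay (fun z => c * f z).
Proof.
move=> Hf N; have [C H] := Hf N; exists (`|c| * C) => z.
by rewrite normrM mulrCA ler_wpM2l.
Qed.

Lemma coord_norm (x : 'rV[K]_d) i : `|x ord0 i| <= `|x|.
Proof.
rewrite [leRHS]/Num.norm /= mx_normrE; apply/bigmax_geP; right => /=.
by exists (ord0, i).
Qed.

Lemma fst_coord_norm (z : E) i : `|z.1 ord0 i| <= `|z|.
Proof. by rewrite (le_trans (coord_norm _ _))// le_max lexx. Qed.

Lemma snd_norm (z : E) : `|z.2| <= `|z|.
Proof. by rewrite le_max lexx orbT. Qed.

Lemma onorm_le_prod z : 1 + `|z| <= (1 + `|z.2|) * \prod_(i <- index_enum 'I_d) (1 + `|z.1 ord0 i|).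
Proof.
have P1 := prod_onorm_ge1 (index_enum 'I_d) z.1.
have P0 := le_trans ler01 P1.
have Pi i : 1 + `|z.1 ord0 i| <= \prod_(i <- index_enum 'I_d) (1 + `|z.1 ord0 i|).
  rewrite (bigD1 i)//= ler_peMr ?addr_ge0//.
  elim/big_ind : _ => // [x y x1 y1|j _]; first by rewrite mulr_ege1.
  by rewrite lerDl.
have x1 : `|z.1| <= \prod_(i <- index_enum 'I_d) (1 + `|z.1 ord0 i|) - 1.
  rewrite [leLHS]/Num.norm /= mx_normrE; apply/bigmax_leP; split=> [|[i j] _ /=].
    by rewrite subr_ge0.
  by rewrite ord1 lerBrDl.
have t0 := normr_ge0 z.2.
have : `|z| <= Num.max (\prod_(i <- index_enum 'I_d) (1 + `|z.1 ord0 i|) - 1) `|z.2|.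
  by rewrite [leLHS]/Num.norm /= ge_max !le_max x1 lexx orbT.
rewrite le_max; move: P1 t0; clear P0 Pi x1.
by move: (\prod_(i <- _) _) `|z| `|z.2| => P n t P1 t0 /orP[h|h]; nra.
Qed.

(** The spatial estimate of order [N] costs (1 + |t|)^M for some [M] depending on [N]; time decay of
    order N + M absorbs this and still provides order [N]. *)
Lemma rapid_decayM f g : time_decay f -> space_decay (index_enum 'I_d) g ->
  rapid_decay (fun z => f z * g z).
Proof.
move=> Hf Hg N; have [C [M [C0 H]]] := Hg N; have [C' [C'0 H']] := Hf (N + M)%N.
exists (C' * C) => z.
have P1 := prod_onorm_ge1 (index_enum 'I_d) z.1.
have z1 := onorm_le_prod z.
rewrite normrM.
have {}z1 : (1 + `|z|) ^+ N <= (1 + `|z.2|) ^+ N * (\prod_(i <- index_enum 'I_d) (1 + `|z.1 ord0 i|)) ^+ N.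
  rewrite -exprMn lerXn2r ?nnegrE ?addr_ge0//.
  by rewrite (le_trans _ z1)// addr_ge0.
have fg0 : 0 <= `|f z| * `|g z| by rewrite mulr_ge0.
rewrite (le_trans (ler_wpM2r fg0 z1))//.
have {}H := H z; have {}H' := H' z; rewrite exprD in H'.
have T0 : 0 <= (1 + `|z.2|) ^+ N * `|f z| by rewrite mulr_ge0// exprn_ge0// addr_ge0.
rewrite mulrACA (le_trans (ler_wpM2l T0 H))// mulrCA mulrC ler_wpM2r//.
by rewrite mulrAC.
Qed.

Lemma derive_J_space (a : K) Phi th i : 0 <= a -> testfun Phi ->
  let f := fun z : E => J Phi th (a * z.1 ord0 i) (a * z.2) in
  forall z, differentiable f z /\ forall v, 'D_v f z =
    a * v.1 ord0 i * J (fun x => x * Phi x) (th + pi / 2) (a * z.1 ord0 i) (a * z.2) +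
    a * v.2 * J (fun x => x ^+ 2 * Phi x) (th + pi / 2) (a * z.1 ord0 i) (a * z.2).
Proof.
move=> a0 tPhi f z; have [C C0 HC] := J_taylor tPhi.
set A := J _ _ _ _; set B := J _ _ _ _.
apply: (@differentiable_quadratic _ _ _ _ (a * `|A| + a * `|B|) (C * (a + a) ^+ 2)).
- by move=> c [u1 u2] [v1 v2] /=; rewrite !mxE /GRing.scale/=; ring.
- move=> v; rewrite (le_trans (ler_normD _ _))// !normrM (ger0_norm a0).
  have := fst_coord_norm v i; have := snd_norm v.
  have := normr_ge0 A; have := normr_ge0 B; have := a0.
  move: `|A| `|B| `|v| `|_| `|_| => A' B' w w1 w2 p0 B0 A0 h2 h1.
  by rewrite mulrDl lerD// mulrAC ler_wpM2l// mulr_ge0.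
- move=> h; rewrite /f /= mxE !(mulrDr a) (le_trans (HC _ _ _ _ _))//.
  rewrite -mulrA ler_wpM2l// -exprMn lerXn2r ?nnegrE ?addr_ge0 ?mulr_ge0 ?addr_ge0//.
  have := fst_coord_norm h i; have := snd_norm h.
  rewrite !normrM (ger0_norm a0) mulrDl.
  by move=> h2 h1; rewrite lerD// ler_wpM2l.
Qed.

Lemma derive_J_time (a : K) Phi th : 0 <= a -> testfun Phi ->
  let f := fun z : E => J Phi th (a * z.2) 0 in
  forall z, differentiable f z /\ forall v, 'D_v f z =
    a * v.2 * J (fun x => x * Phi x) (th + pi / 2) (a * z.2) 0.
Proof.
move=> a0 tPhi f z; have [C C0 HC] := J_taylor tPhi.
set A := J _ _ _ _.
apply: (@differentiable_quadratic _ _ _ _ (a * `|A|) (C * a ^+ 2)).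
- by move=> c [u1 u2] [v1 v2] /=; rewrite /GRing.scale/=; ring.
- move=> v; rewrite !normrM mulrAC (ger0_norm a0).
  by rewrite ler_wpM2l ?mulr_ge0// snd_norm.
- move=> h; have := HC th (a * z.2) 0 (a * h.2) 0.
  rewrite addr0 mul0r addr0 normr0 addr0 /f /= mulrDr -/A => H.
  rewrite (le_trans H)// -[leRHS]mulrA ler_wpM2l// -exprMn.
  rewrite lerXn2r ?nnegrE ?mulr_ge0// normrM (ger0_norm a0).
  by rewrite ler_wpM2l// snd_norm.
Qed.

(** A derivative is a combination of integrals of the same kind with amplitudes x Phi and x^2 Phi
    and a shifted phase, so the induction runs over all amplitudes and phases at once. *)
Lemma derivatives_J_space n Phi th i : testfun Phi ->
  derivatives_in (space_decay [:: i]) n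
    (fun z : E => J Phi th (2 * pi * z.1 ord0 i) (2 * pi * z.2)).
Proof.
have B Phi' th' : testfun Phi' -> space_decay [:: i]
    (fun z : E => J Phi' th' (2 * pi * z.1 ord0 i) (2 * pi * z.2)).
  move=> tPhi N; have [C C0 HC] := J_weight N tPhi.
  exists (C * (2 * pi) ^+ N), N; split=> [|z].
    by rewrite mulr_ge0// exprn_ge0// mulr_ge0// pi_ge0.
  rewrite big_seq1.
  have h1 : (1 + `|z.1 ord0 i|) ^+ N <= (1 + `|2 * pi * z.1 ord0 i|) ^+ N.
    by rewrite lerXn2r ?nnegrE ?addr_ge0// onorm_pi.
  rewrite (le_trans (ler_wpM2r (normr_ge0 _) h1))// (le_trans (HC _ _ _))//.
  rewrite -[leRHS]mulrA ler_wpM2l// -exprMn.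
  have pl := onorm_pi_le z.2.
  rewrite lerXn2r ?nnegrE ?addr_ge0//.
  by rewrite mulr_ge0 ?addr_ge0// mulr_ge0// pi_ge0.
elim: n Phi th => [|n IH] Phi th tPhi; first by split=> //; exact: B.
split; first exact: B.
have D := derive_J_space th i (le_trans ler01 (@pi2_ge1 K)) tPhi.
split; first by move=> z; have [] := D z.
move=> v; under eq_fun do rewrite (D _).2.
apply: derivatives_inD; first exact: space_decayD.
  apply: derivatives_inZ; first by move=> f; exact: space_decayZ.
  by apply: IH; exact: (testfunX 1).
apply: derivatives_inZ; first by move=> f; exact: space_decayZ.
by apply: IH; exact: (testfunX 2).
Qed.

Lemma derivatives_J_time n Phi th : testfun Phi ->
  derivatives_in time_decay n (fun z : E => J Phi th (2 * pi * z.2) 0).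
Proof.
have B Phi' th' : testfun Phi' -> time_decay (fun z : E => J Phi' th' (2 * pi * z.2) 0).
  move=> tPhi N; have [C C0 HC] := J_weight N tPhi.
  exists C; split=> // z.
  have h1 : (1 + `|z.2|) ^+ N <= (1 + `|2 * pi * z.2|) ^+ N.
    by rewrite lerXn2r ?nnegrE ?addr_ge0// onorm_pi.
  rewrite (le_trans (ler_wpM2r (normr_ge0 _) h1))// (le_trans (HC _ _ _))//.
  by rewrite normr0 addr0 expr1n mulr1.
elim: n Phi th => [|n IH] Phi th tPhi; first by split=> //; exact: B.
split; first exact: B.
have D := derive_J_time th (le_trans ler01 (@pi2_ge1 K)) tPhi.
split; first by move=> z; have [] := D z.
move=> v; under eq_fun do rewrite (D _).2.
apply: derivatives_inZ; first by move=> f; exact: time_decayZ.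
by apply: IH; exact: (testfunX 1).
Qed.

Definition cderivatives_in P n (F : E -> K[i]) :=
  derivatives_in P n (fun z => complex.Re (F z)) /\
  derivatives_in P n (fun z => complex.Im (F z)).

Lemma cderivatives_inM (P Q S : (E -> K) -> Prop) n F G :
  (forall f g, P f -> Q g -> S (fun x => f x * g x)) ->
  (forall f g, S f -> S g -> S (fun x => f x + g x)) ->
  (forall c f, S f -> S (fun x => c * f x)) ->
  cderivatives_in P n F -> cderivatives_in Q n G ->
  cderivatives_in S n (fun x => F x * G x).
Proof.
move=> PQS SD SZ [F1 F2] [G1 G2].
have FG f g : derivatives_in P n f -> derivatives_in Q n g ->
  derivatives_in S n (fun x => f x * g x) by exact: derivatives_inM.
split.
  rewrite (_ : (fun z => _) = (fun z => complex.Re (F z) * complex.Re (G z) +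
    -1 * (complex.Im (F z) * complex.Im (G z)))).
    apply: derivatives_inD => //; first exact: FG.
    by apply: derivatives_inZ; [exact: SZ|exact: FG].
  by apply/funext => z; rewrite Re_mulc mulN1r.
rewrite (_ : (fun z => _) = (fun z => complex.Re (F z) * complex.Im (G z) +
    complex.Im (F z) * complex.Re (G z))).
  by apply: derivatives_inD => //; exact: FG.
by apply/funext => z; rewrite Im_mulc.
Qed.

Lemma derivatives_in_cst n (c : K) : derivatives_in (space_decay [::]) n (fun=> c).
Proof.
elim: n c => [|n IH] c; first by split=> //; exact: space_decay_cst.
split; first exact: space_decay_cst.
split; first by move=> z; exact: differentiable_cst.
by move=> v; under eq_fun do rewrite -[X in 'D_v X _]/(cst c) derive_cst.
Qed.

Lemma cderivatives_packet n psi Phi : testfun psi -> (forall i, testfun (Phi i)) ->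
  cderivatives_in rapid_decay n (packet psi Phi : E -> K[i]).
Proof.
move=> tpsi tPhi; apply: (cderivatives_inM rapid_decayM rapid_decayD rapid_decayZ).
  by split; exact: derivatives_J_time.
elim: (index_enum 'I_d) => [|i s IH].
  by under eq_fun do rewrite big_nil; split; exact: derivatives_in_cst.
under eq_fun do rewrite big_cons.
rewrite -cat1s; apply: cderivatives_inM IH.
- exact: space_decayM.
- exact: space_decayD.
- exact: space_decayZ.
- by split; exact: derivatives_J_space.
Qed.

Lemma derivatives_in_iter P m (vs : seq E) f :
  derivatives_in P (m + size vs) f -> derivatives_in P m (iter_derive vs f).
Proof.
elim: vs m => [|v vs IH] m /=; first by rewrite addn0.
rewrite addnS -addSn => /IH [_ [_ H]]; exact: H.
Qed.

Lemma schwartz_packet psi Phi : testfun psi -> (forall i, testfun (Phi i)) ->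
  schwartz (packet psi Phi : E -> K[i]).
Proof.
move=> tpsi tPhi; have H n := cderivatives_packet n tpsi tPhi.
split=> vs; have [H1 H2] := H (1 + size vs)%N.
  by have [P [D _]] := derivatives_in_iter H1; split.
by have [P [D _]] := derivatives_in_iter H2; split.
Qed.

End schwartz_packet.

(** * The Knapp example *)

Section knapp_packets.
Context {K : realType}.
Notation mu := (@lebesgue_measure K).

Definition bump_at (a c xi : K) : K := unit_bump (a * xi - c).

Lemma testfun_bump_at (a c : K) : 0 < a -> testfun (bump_at a c).
Proof.
by move=> a0; apply: testfun_affine; [rewrite gt_eqF|exact: testfun_unit_bump].
Qed.

Lemma normc_sqr (x : K[i]) :
  Normc.normc x ^+ 2 = complex.Re x ^+ 2 + complex.Im x ^+ 2.
Proof. by case: x => a b /=; rewrite sqr_sqrtr// addr_ge0 ?sqr_ge0. Qed.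

(** [J_affine] reduces to the unit bump at the rescaled time t / a^2 and at a position that is
    constant along the ray of the packet. The square of the Lorentzian that arises is weakened to a
    single one, which is still integrable. *)
Lemma normc_bump_at_space : exists2 C : K, 0 < C & forall a k x t : K, 0 < a ->
  Normc.normc (cJ (bump_at a k) 0 (2 * pi * x) (2 * pi * t)) ^+ 2 <=
  C * a ^- 2 * (1 + `|t / a ^+ 2|) ^+ 4 * lor (x / a + 2 * t * k / a ^+ 2).
Proof.
have [C C0 HC] := J_lor_bound (@testfun_unit_bump K).
exists (2 * (C * (2 * pi) ^+ 2) ^+ 2 + 1).
  by rewrite ltr_wpDl// mulr_ge0// sqr_ge0.
move=> a k x t a0.
have an : a != 0 by rewrite gt_eqF.
set y := x / a + 2 * t * k / a ^+ 2; set tau := t / a ^+ 2.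
have H th : J (bump_at a k) th (2 * pi * x) (2 * pi * t) ^+ 2 <=
    a ^- 2 * ((C * (2 * pi) ^+ 2) ^+ 2 * (1 + `|tau|) ^+ 4 * lor y).
  rewrite J_affine//; last exact: testfun_unit_bump.
  set th' := th + _ + _.
  have -> : 2 * pi * x / a + 2 * (2 * pi * t) * k / a ^+ 2 = 2 * pi * y by rewrite /y; ring.
  have -> : 2 * pi * t / a ^+ 2 = 2 * pi * tau by rewrite /tau; ring.
  rewrite exprMn exprVn ler_wpM2l ?invr_ge0 ?sqr_ge0//.
  rewrite -(real_normK (num_real (J _ _ _ _))).
  have := HC th' y (2 * pi * tau); have := normr_ge0 (J unit_bump th' (2 * pi * y) (2 * pi * tau)).
  move: `|J _ _ _ _| => N N0 HN.
  have pt := onorm_pi_le tau.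
  have p0 : 0 <= 2 * pi :> K by rewrite (le_trans _ (@pi2_ge1 K)).
  have P0 : 0 <= (2 * pi * (1 + `|tau|)) ^+ 2 by rewrite exprn_ge0// mulr_ge0// addr_ge0.
  have N1 : N <= C * (2 * pi * (1 + `|tau|)) ^+ 2 * lor y.
    rewrite (le_trans HN)// ler_wpM2r ?lor_ge0// ler_wpM2l//.
    by rewrite lerXn2r ?nnegrE ?addr_ge0// mulr_ge0// addr_ge0.
  have l0 := lor_ge0 y; have l1 := lor_le1 y.
  rewrite (@le_trans _ _ ((C * (2 * pi * (1 + `|tau|)) ^+ 2 * lor y) ^+ 2))//.
    by rewrite lerXn2r ?nnegrE// mulr_ge0// mulr_ge0.
  rewrite [leLHS](_ : _ = (C * (2 * pi) ^+ 2) ^+ 2 * (1 + `|tau|) ^+ 4 * (lor y * lor y)); last by ring.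
  rewrite ler_wpM2l ?ler_piMl// mulr_ge0 ?sqr_ge0// exprn_ge0// addr_ge0//.
rewrite normc_sqr /=.
have T0 : 0 <= a ^- 2 * ((1 + `|tau|) ^+ 4 * lor y).
  by rewrite mulr_ge0 ?invr_ge0 ?sqr_ge0// mulr_ge0 ?lor_ge0// exprn_ge0// addr_ge0.
rewrite (le_trans (lerD (H _) (H _)))//.
rewrite [leLHS](_ : _ = (2 * (C * (2 * pi) ^+ 2) ^+ 2) * (a ^- 2 * ((1 + `|tau|) ^+ 4 * lor y))); last by ring.
rewrite [leRHS](_ : _ = (2 * (C * (2 * pi) ^+ 2) ^+ 2 + 1) * (a ^- 2 * ((1 + `|tau|) ^+ 4 * lor y))); last by ring.
by rewrite ler_wpM2r// lerDl.
Qed.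

Lemma normc_bump_at_time N : exists2 C : K, 0 < C & forall R t : K, 0 < R ->
  (1 + `|t / R ^+ 2|) ^+ N * Normc.normc (cJ (bump_at (R ^+ 2) 0) 0 (2 * pi * t) 0) <= C * R ^- 2.
Proof.
have [C C0 HC] := J_weight N (@testfun_unit_bump K).
exists (2 * C + 1); first by rewrite ltr_wpDl// mulr_ge0.
move=> R t R0.
have R2 : 0 < R ^+ 2 by rewrite exprn_gt0.
set tau := t / R ^+ 2.
have T0 : 0 < (1 + `|tau|) ^+ N by rewrite exprn_gt0// ltr_wpDr.
have H th : `|J (bump_at (R ^+ 2) 0) th (2 * pi * t) 0| <= C * R ^- 2 / (1 + `|tau|) ^+ N.
  rewrite J_affine//; last exact: testfun_unit_bump.
  rewrite !mulr0 !mul0r !addr0 normrM ger0_norm ?invr_ge0 ?(ltW R2)//.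
  rewrite [leRHS](_ : _ = R ^- 2 * (C / (1 + `|tau|) ^+ N)); last by ring.
  rewrite ler_wpM2l ?invr_ge0 ?(ltW R2)//.
  rewrite ler_pdivlMr// mulrC.
  have -> : 2 * pi * t / R ^+ 2 = 2 * pi * tau by rewrite /tau; ring.
  have := HC th (2 * pi * tau) 0; rewrite normr0 addr0 expr1n mulr1; apply: le_trans.
  by rewrite ler_wpM2r// lerXn2r ?nnegrE ?addr_ge0// onorm_pi.
have HN : Normc.normc (cJ (bump_at (R ^+ 2) 0) 0 (2 * pi * t) 0) <=
   2 * (C / R ^+ 2 / (1 + `|tau|) ^+ N) by apply: normc_le; exact: H.
rewrite mulrC -ler_pdivlMr// (le_trans HN)//.
rewrite !mulrA ler_wpM2r ?invr_ge0 ?(ltW T0)// ler_wpM2r ?invr_ge0 ?(ltW R2)//.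
by rewrite lerDl.
Qed.

(** On the support the phase is at most 1/2 in absolute value, so its cosine is at least 1 - 1/4,
    which exceeds the claimed 1/2. *)
Lemma J_lower (Phi : K -> K) (u w : K) : testfun Phi -> (forall x, 0 <= Phi x) ->
  (forall x, ~~ (0 <= x <= 1) -> Phi x = 0) -> `|u| + `|w| <= 2^-1 ->
  J Phi 0 0 0 / 2 <= J Phi 0 u w.
Proof.
move=> tPhi P0 PS uw.
have i1 := osc_integrable 0 0 0 tPhi; have i2 := osc_integrable 0 u w tPhi.
rewrite mulrC /J -RintegralZl//.
apply: le_Rintegral => // [|x _].
  exact: RintegrableZl.
have [/andP[x0 x1]|/PS Px] := boolP (0 <= x <= 1); last by rewrite /osc Px !mul0r mulr0.
rewrite /osc !mul0r !addr0 cos0 mulr1 mulrC ler_wpM2l//.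
have h : `|u * x + w * x ^+ 2| <= 2^-1.
  rewrite (le_trans (ler_normD _ _))// (le_trans _ uw)// !normrM (ger0_norm x0).
  rewrite lerD// ler_piMr// ?normrX ?exprn_ile1//.
  by rewrite -expr2 exprn_ile1.
have := abs_cosB1_le (u * x + w * x ^+ 2).
have : (u * x + w * x ^+ 2) ^+ 2 <= 4^-1.
  rewrite -(real_normK (num_real _)) (_ : 4^-1 = 2^-1 ^+ 2); last by field.
  by rewrite lerXn2r ?nnegrE.
rewrite ler_norml => h2 /andP[h3 _]; lra.
Qed.

Lemma J_bump_at0 (a k : K) : 0 < a -> J (bump_at a k) 0 0 0 = a^-1 * J unit_bump 0 0 0.
Proof.
move=> a0; rewrite J_affine//; last exact: testfun_unit_bump.
by rewrite !mulr0 !mul0r !addr0.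
Qed.

Lemma J_sum n (Phi : 'I_n -> K -> K) th u w : (forall i, testfun (Phi i)) ->
  J (fun x => \sum_(i < n) Phi i x) th u w = \sum_(i < n) J (Phi i) th u w.
Proof.
elim: n Phi => [|n IH] Phi tPhi.
  rewrite big_ord0; under [X in J X]eq_fun do rewrite big_ord0.
  rewrite /J (@eq_Rintegral _ _ _ mu setT (fun=> 0)); first by rewrite /Rintegral integral0.
  by move=> x _; rewrite /osc mul0r.
rewrite big_ord_recl -IH//.
rewrite /J -RintegralD//; last 2 first.
- exact: osc_integrable.
- by apply: osc_integrable; apply: testfun_sum.
by apply: eq_Rintegral => x _; rewrite /osc big_ord_recl mulrDl.
Qed.

Lemma J0_unit_bump_gt0 : 0 < J unit_bump 0 0 0 :> K.
Proof.
have tb := @testfun_unit_bump K.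
(* On [1/4, 3/4] both 1/x and 1/(1 - x) are at most 4, so each factor of the bump is at least
   exp(-4). *)
pose m : K := expR (- 4) ^+ 2.
have m0 : 0 < m by rewrite exprn_gt0// expR_gt0.
have H x : x \in `[4^-1, 3 / 4] -> m <= unit_bump x.
  rewrite in_itv/= => /andP[x1 x2].
  have x0 : 0 < x by lra.
  have y0 : 0 < 1 - x by lra.
  rewrite /unit_bump /flat x0 y0 !hornerC !mul1r /m expr2.
  apply: ler_pM; rewrite ?expR_ge0// ler_expR lerN2.
    by rewrite -[4]invrK lef_pV2 ?posrE.
  by rewrite -[4]invrK lef_pV2 ?posrE//; lra.
have i1 := osc_integrable 0 0 0 tb.
have oE x : osc unit_bump 0 0 0 x = unit_bump x by rewrite /osc !mul0r !addr0 cos0 mulr1.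
rewrite (@lt_le_trans _ _ (m * 2^-1))//; first by rewrite mulr_gt0.
have -> : m * 2^-1 = \int[mu]_(x in `[4^-1, 3 / 4]) m.
  rewrite Rintegral_cst//= lebesgue_measure_itv/= lte_fin ifT; last by lra.
  by rewrite -EFinB/=; congr (_ * _); field.
rewrite (@le_trans _ _ (\int[mu]_(x in `[4^-1, 3 / 4]) osc unit_bump 0 0 0 x))//.
  apply: le_Rintegral => //.
  - apply: measurable_bounded_integrable => //.
      by rewrite /= lebesgue_measure_itv/=; case: ifP => _; rewrite ltry.
    by exists `|m|; split=> [|y My x _ /=]; [exact: num_real|exact: ltW].
  - exact: integrableS i1.
  - by move=> x xI; rewrite oE; apply: H.
rewrite /J /Rintegral fine_le//.
- by apply: integrable_fin_num => //; exact: integrableS i1.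
- exact: integrable_fin_num.
- apply: ge0_subset_integral => //.
  + by apply/measurable_EFinP; apply: continuous_measurable_fun; exact: osc_continuous.
  + by move=> x _; rewrite lee_fin oE unit_bump_ge0.
Qed.

(* The wave packet of frequency k/R moves along the ray x = - 2tk/R. *)
Definition lor_sum (n : nat) (R x t : K) : K :=
  \sum_(k < n) lor (x / R + 2 * t * k%:R / R ^+ 2).

Lemma lor_sum_ge0 n R x t : 0 <= lor_sum n R x t.
Proof. by apply: sumr_ge0 => i _; exact: lor_ge0. Qed.

Lemma lor_sum_le n R x t : lor_sum n R x t <= n%:R.
Proof.
rewrite (@le_trans _ _ (\sum_(k < n) 1))//; first by apply: ler_sum => i _; exact: lor_le1.
by rewrite sumr_const card_ord.
Qed.

(* Sum-integral comparison, with atan in the role of the integral. *)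
Lemma lor_sum_atan (n : nat) (al be : K) : 0 < be ->
  \sum_(k < n) lor (al + be * k%:R) <= 2 * (1 + be ^+ 2) / be * pi.
Proof.
move=> be0.
have step k : lor (al + be * k%:R) <= 2 * (1 + be ^+ 2) / be *
    (atan (al + be * k.+1%:R) - atan (al + be * k%:R)).
  set x := al + be * k%:R.
  have -> : al + be * k.+1%:R = x + be by rewrite /x -natr1; ring.
  have dat (y : K) : is_derive y 1 atan (lor y).
    by apply: DeriveDef; [exact: derivable_atan|rewrite -derive1E derive1_atan].
  have [c [cx ->]] := MVT_derive dat x (x + be).
  rewrite (_ : x + be - x = be); last by ring.
  rewrite [leRHS](_ : _ = 2 * (1 + be ^+ 2) * lor c); last by field; rewrite gt_eqF.
  have {}cx : x <= c <= x + be by case: cx => //; lra.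
  rewrite /lor ler_pdivlMr ?oneDsqr_gt0// mulrC ler_pdivrMr ?oneDsqr_gt0//.
  move: cx => /andP[c1 c2].
  (* From |c - x| <= be follows c^2 <= 2 x^2 + 2 be^2, the gap being at least (c - 2x)^2 >= 0; hence
     1 + c^2 <= 2 (1 + be^2)(1 + x^2). *)
  have h : (c - x) ^+ 2 <= be ^+ 2 by rewrite lerXn2r ?nnegrE; lra.
  have h1 := sqr_ge0 (c - 2 * x).
  have h2 : 0 <= be ^+ 2 * x ^+ 2 by rewrite mulr_ge0 ?sqr_ge0.
  have h3 := sqr_ge0 x.
  nra.
rewrite (@le_trans _ _ (\sum_(k < n) (2 * (1 + be ^+ 2) / be *
    (atan (al + be * k.+1%:R) - atan (al + be * k%:R)))))//.
  by apply: ler_sum => i _; exact: step.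
rewrite -mulr_sumr ler_wpM2l//.
  by rewrite divr_ge0 ?(ltW be0)// mulr_ge0// ltW// oneDsqr_gt0.
rewrite -(big_mkord xpredT (fun k => atan (al + be * k.+1%:R) - atan (al + be * k%:R))).
rewrite telescope_sumr//.
have := atan_ltpi2 (al + be * n%:R); have := atan_gtNpi2 (al + be * 0%:R); lra.
Qed.

Lemma lor_sum_sym n R x t : exists al, lor_sum n R x t =
  \sum_(k < n) lor (al + `|2 * t / R ^+ 2| * k%:R).
Proof.
have [t0|t0] := leP 0 (2 * t / R ^+ 2).
  exists (x / R); apply: eq_bigr => k _; congr lor; rewrite ger0_norm//; ring.
exists (- (x / R)); apply: eq_bigr => k _; rewrite ltr0_norm//.
rewrite /lor -sqrrN; congr (1 + _ ^+ 2)^-1; ring.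
Qed.

(** For |t| <= R every term is at most 1 and lor(t/R) >= 1/2. For |t| > R, put tau = |t|/R^2:
    [lor_sum_atan] with spacing 2 tau bounds the sum by 4 pi (1 + tau)^2 / tau, and tau^-2 <= 2 R^2
    lor(t/R). The loss (1 + tau)^4 is repaid by the decay of the time bump. *)
Lemma lor_sum_sqr n (R x t : K) : 0 < R -> n%:R <= R ->
  lor_sum n R x t ^+ 2 <= 32 * pi ^+ 2 * (1 + `|t / R ^+ 2|) ^+ 4 * R ^+ 2 * lor (t / R).
Proof.
move=> R0 nR.
have R2 : 0 < R ^+ 2 by rewrite exprn_gt0.
have T0 := lor_sum_ge0 n R x t.
have p1 : 1 <= pi :> K by have := @pihalf_ge1 K; lra.
set tau := `|t / R ^+ 2|.
have tau0 : 0 <= tau by exact: normr_ge0.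
have t1 : 1 <= 1 + tau by rewrite lerDl.
have [tR|tR] := leP `|t| R.
  have h1 : lor_sum n R x t ^+ 2 <= R ^+ 2.
    by rewrite lerXn2r ?nnegrE ?(ltW R0)// (le_trans (lor_sum_le _ _ _ _)).
  have h2 : 1 <= 2 * lor (t / R).
    rewrite /lor ler_pdivlMr ?oneDsqr_gt0// mul1r expr_div_n.
    have : t ^+ 2 / R ^+ 2 <= 1.
      rewrite ler_pdivrMr// mul1r -(real_normK (num_real t)).
      by rewrite lerXn2r ?nnegrE ?(ltW R0).
    lra.
  have h3 : 1 <= 16 * pi ^+ 2 * (1 + tau) ^+ 4.
    rewrite mulr_ege1//; last by rewrite exprn_ege1.
    by rewrite mulr_ege1 ?exprn_ege1// ler1n.
  rewrite (le_trans h1)//.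
  rewrite [leRHS](_ : _ = (16 * pi ^+ 2 * (1 + tau) ^+ 4) * (2 * lor (t / R)) * R ^+ 2); last by ring.
  by rewrite ler_peMl ?(ltW R2)// mulr_ege1.
have t0 : 0 < `|t| by rewrite (lt_trans R0).
have [al ->] := lor_sum_sym n R x t.
have beE : `|2 * t / R ^+ 2| = 2 * tau.
  by rewrite -mulrA normrM (ger0_norm (_ : 0 <= 2)).
have taugt0 : 0 < tau by rewrite /tau normrM normfV (ger0_norm (ltW R2)) divr_gt0.
have be0 : 0 < 2 * tau by rewrite mulr_gt0.
have := lor_sum_atan n al be0; rewrite beE.
have : 0 <= \sum_(k < n) lor (al + 2 * tau * k%:R) by apply: sumr_ge0 => i _; exact: lor_ge0.
move: (\sum_(k < n) _) => S S0 HS.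
have h1 : S <= 4 * (1 + tau) ^+ 2 * pi / tau.
  rewrite (le_trans HS)// [leLHS](_ : _ = (1 + (2 * tau) ^+ 2) * pi / tau); last first.
    by field; rewrite gt_eqF.
  rewrite ler_wpM2r ?invr_ge0// ler_wpM2r ?pi_ge0//; nra.
have h2 : tau ^- 2 <= 2 * R ^+ 2 * lor (t / R).
  have -> : tau ^- 2 = R ^+ 2 * (R ^+ 2 / `|t| ^+ 2).
    rewrite /tau normrM normfV (ger0_norm (ltW R2)).
    by field; rewrite !gt_eqF.
  rewrite [leRHS](_ : _ = R ^+ 2 * (2 * lor (t / R))); last by ring.
  rewrite ler_wpM2l ?(ltW R2)//.
  rewrite /lor ler_pdivlMr ?oneDsqr_gt0// expr_div_n -(real_normK (num_real t)).
  rewrite mulrDr mulr1 [X in _ + X](_ : _ = 1); last by field; rewrite !gt_eqF.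
  suff : R ^+ 2 / `|t| ^+ 2 <= 1 by lra.
  by rewrite ler_pdivrMr ?exprn_gt0// mul1r lerXn2r ?nnegrE ?(ltW R0) ?(ltW tR).
rewrite (@le_trans _ _ ((4 * (1 + tau) ^+ 2 * pi / tau) ^+ 2))//.
  by rewrite lerXn2r ?nnegrE// (le_trans S0).
rewrite [leLHS](_ : _ = 16 * pi ^+ 2 * (1 + tau) ^+ 4 * tau ^- 2); last by rewrite exprMn exprVn; ring.
rewrite [leRHS](_ : _ = 16 * pi ^+ 2 * (1 + tau) ^+ 4 * (2 * R ^+ 2 * lor (t / R))); last by ring.
rewrite ler_wpM2l// mulr_ge0 ?exprn_ge0// ?(le_trans _ t1)// mulr_ge0// sqr_ge0//.
Qed.

Lemma integral_lor_sum n (R t : K) : 0 < R ->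
  mu.-integrable setT (EFin \o (fun x => lor_sum n R x t)) /\
  \int[mu]_x lor_sum n R x t = n%:R * (pi * R).
Proof.
move=> R0.
have Ri : 0 < R^-1 by rewrite invr_gt0.
have li (c : K) : mu.-integrable setT (EFin \o (fun x => lor (x / R + c))).
  apply/integrableP; split.
    apply/measurable_EFinP; apply: (measurableT_comp measurable_lor).
    by apply: measurable_funD => //; exact: measurable_funM.
  under eq_integral do rewrite /= ger0_norm ?lor_ge0// mulrC.
  by rewrite integral_lor_affine ?ltry.
have lE (c : K) : \int[mu]_x lor (x / R + c) = pi * R.
  rewrite /Rintegral; under eq_integral do rewrite mulrC.
  by rewrite integral_lor_affine// invrK.
rewrite /lor_sum; elim: n => [|n [IH1 IH2]].
  split.
    under eq_fun do rewrite big_ord0.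
    by apply: eq_integrable (RintegrableZl 0 (li 0)) => // x _; rewrite /= mul0r.
  rewrite mul0r /Rintegral.
  by under eq_integral do rewrite big_ord0; rewrite integral0.
split.
  under eq_fun do rewrite big_ord_recr/=.
  exact: (integrableD measurableT IH1 (li _)).
transitivity (\int[mu]_x (\sum_(k < n) lor (x / R + 2 * t * k%:R / R ^+ 2) +
    lor (x / R + 2 * t * n%:R / R ^+ 2))).
  by apply: eq_Rintegral => x _; rewrite big_ord_recr.
by rewrite RintegralD// IH2 lE -[n.+1%:R]natr1; ring.
Qed.

End knapp_packets.

(** * The Knapp function: projections and Fourier support *)

Section knapp_example.
Context {K : realType} (d : nat).
Notation E := ('rV[K]_d * K)%type.

(* [tooth n R k] is the part of [comb n R] cut out by the frequency interval
   [k/R, (k+1)/R]; it vanishes unless k is one of the n frequencies present. *)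
Definition comb n (R xi : K) : K := \sum_(k < n) bump_at R k%:R xi.

Definition tooth n (R : K) (m : int) (xi : K) : K :=
  if 0 <= m < n%:Z then bump_at R m%:~R xi else 0.

Definition knapp n (R : K) : E -> K[i] :=
  packet (bump_at (R ^+ 2) 0) (fun _ : 'I_d => comb n R).

Lemma testfun_comb n (R : K) : 0 < R -> testfun (comb n R).
Proof. by move=> R0; apply: testfun_sum => i; exact: testfun_bump_at. Qed.

Lemma testfun_tooth n (R : K) m : 0 < R -> testfun (tooth n R m).
Proof.
move=> R0; rewrite /tooth; have [_|_] := boolP (0 <= m < n%:Z); first exact: testfun_bump_at.
have := @testfun_comb 0 R R0; rewrite /comb.
by under [X in testfun X -> _]eq_fun do rewrite big_ord0.
Qed.

Lemma tooth_eq0 n (R : K) m xi : ~~ (0 <= R * xi - m%:~R <= 1) -> tooth n R m xi = 0.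
Proof.
rewrite /tooth; case: ifP => // _ h; apply: unit_bump_eq0; apply: contra h.
by move=> /andP[h1 h2]; rewrite !ltW.
Qed.

(** The bumps vanish outside the open unit interval, so at an end point shared by two closed
    intervals both the comb and the tooth are 0. *)
Lemma comb_tooth n (R : K) m xi : 0 <= R * xi - m%:~R <= 1 -> comb n R xi = tooth n R m xi.
Proof.
move=> /andP[h1 h2].
have E0 (k : int) : k != m -> bump_at R k%:~R xi = 0.
  move=> km; apply: unit_bump_eq0; apply/negP => /andP[h3 h4].
  have : k < m + 1 by rewrite -(ltr_int K) intrD; lra.
  have : m < k + 1 by rewrite -(ltr_int K) intrD; lra.
  by rewrite !ltzD1 => mk km'; move: km; rewrite eq_le mk km'.
rewrite /tooth /comb; case: ifP => [|mn].
  case: m h1 h2 E0 => // m h1 h2 E0; rewrite ltz_nat /= => mn.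
  rewrite (bigD1 (Ordinal mn))//= big1 ?addr0// => i im.
  by apply: (E0 i%:Z); move: im; apply: contra => /eqP[im]; apply/eqP/val_inj.
apply: big1 => i _; apply: (E0 i%:Z); apply: contraFN mn => /eqP <-.
by rewrite ltz_nat ltn_ord.
Qed.

Lemma comb_ge0 n (R : K) xi : 0 <= comb n R xi.
Proof. by apply: sumr_ge0 => i _; exact: unit_bump_ge0. Qed.

Lemma comb_support n (R : K) xi : 0 < R -> comb n R xi != 0 -> 0 <= xi <= n%:R / R.
Proof.
move=> R0; apply: contraNT => h; apply/eqP; apply: big1 => i _.
apply: unit_bump_eq0; apply: contra h => /andP[h1 h2].
have i0 : 0 <= i%:R :> K by [].
have i1 : i%:R + 1 <= n%:R :> K by rewrite natr1 ler_nat.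
rewrite ler_pdivlMr// mulrC; apply/andP; split; last lra.
by rewrite -(pmulr_rge0 _ R0); lra.
Qed.

(** Because the spectrum vanishes on the faces of the cubes, multiplying it by the indicator selects
    one tooth per coordinate; the result is again a smooth [spectrum], to which
    [inv_fourier_spectrum] applies. *)
Lemma freq_proj_knapp n (R : K) (k : 'rV[int]_d) : 0 < R ->
  freq_proj R k (knapp n R) =
  packet (bump_at (R ^+ 2) 0) (fun i => tooth n R (k ord0 i)).
Proof.
move=> R0.
have tb : testfun (bump_at (R ^+ 2) (0 : K)) by apply: testfun_bump_at; rewrite exprn_gt0.
have tt i : testfun (tooth n R (k ord0 i)) by exact: testfun_tooth.
rewrite -inv_fourier_spectrum// /freq_proj /knapp fourier_packet//; last first.
  by move=> _; exact: testfun_comb.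
congr inv_fourier; apply/funext => z; rewrite -rmorphM; congr (_ %:C%C).
rewrite /spectrum mulrCA; congr (_ * _); rewrite indicE.
have [/set_mem h|/negP h] := boolP (_ \in _).
  rewrite mul1r; apply: eq_bigr => i _; apply: comb_tooth.
  by have := h i; rewrite !mxE.
rewrite mul0r; have [i hi] : exists i, ~~ (0 <= R * z.1 ord0 i - (k ord0 i)%:~R <= 1).
  apply: contrapT => H; apply: h; apply/mem_set => i; rewrite !mxE.
  by apply: contrapT => /negP hi; apply: H; exists i.
by rewrite (bigD1 i)//= (tooth_eq0 _ hi) mul0r.
Qed.

Lemma fsupp_knapp n (R : K) : (0 < d)%N -> 1 <= R -> n%:R / R <= d%:R^-1 ->
  fsupp (fourier (knapp n R)) `<=` paraboloid_nbhd d R.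
Proof.
move=> d0 R1 nR.
have R0 : 0 < R by rewrite (lt_le_trans _ R1).
have R2 : 0 < R ^+ 2 by rewrite exprn_gt0.
rewrite /fsupp fourier_packet//; last 2 first.
- exact: testfun_bump_at.
- by move=> _; exact: testfun_comb.
(* [fsupp] is a closure, so the nonvanishing set is enclosed in a closed set given by weak
   inequalities. *)
pose S : set E := [set z : E | 0 <= z.2 - dotrV z.1 z.1 <= R ^- 2] `&`
  \bigcap_(i in [set: 'I_d]) [set z : E | 0 <= z.1 ord0 i <= d%:R^-1].
have coordc (i : 'I_d) : continuous (fun z : E => z.1 ord0 i).
  move=> z; apply: (@continuous_comp _ _ _ fst (fun v : 'rV[K]_d => v ord0 i)).
    exact: cvg_fst.
  exact: coord_continuous.
have dotc : continuous (fun z : E => dotrV z.1 z.1).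
  rewrite /dotrV; elim: (index_enum _) => [|i r IH].
    by under [X in continuous X]eq_fun do rewrite big_nil; exact: cst_continuous.
  under [X in continuous X]eq_fun do rewrite big_cons.
  by move=> z; apply: cvgD; [apply: cvgM; exact: coordc|exact: IH].
have closed_seg (f : E -> K) (b : K) : continuous f -> closed [set z | 0 <= f z <= b].
  move=> cf; rewrite (_ : [set _ | _] = f @^-1` (`[0, b])); last first.
    by apply/seteqP; split => z /=; rewrite in_itv.
  by apply: preimage_closed; [move=> z _; exact: cf|exact: interval_closed].
have cS : closed S.
  apply: closedI.
    apply: closed_seg => z; apply: cvgB; first exact: cvg_snd.
    exact: dotc.
  by apply: closed_bigI => i _; apply: closed_seg; exact: coordc.
have sub : [set z : E | (spectrum (bump_at (R ^+ 2) 0) (fun=> comb n R) z)%:C%C != 0] `<=` S.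
  move=> z /=; rewrite fmorph_eq0 mulf_eq0 negb_or => /andP[h1 /prodf_neq0 h2].
  split => /=.
    apply: contraNT h1 => h; apply/eqP; apply: unit_bump_eq0; apply: contra h.
    rewrite subr0 pmulr_rgt0// => /andP[h1 h3].
    by rewrite (ltW h1) -[_ ^- _]mul1r ler_pdivlMr// mulrC ltW.
  move=> i _ /=; have /andP[h3 h4] := comb_support R0 (h2 i isT).
  by rewrite h3 (le_trans h4).
move=> z /(closureS sub); rewrite -(proj1 (closure_id S) cS) => -[/= /andP[h1 h2] h3].
exists z.1, (z.2 - dotrV z.1 z.1).
have D0 : 0 <= dotrV z.1 z.1 by apply: sumr_ge0 => i _; rewrite -expr2 sqr_ge0.
split.
(* Each coordinate lies in [0, 1/d], so its square is at most 1/d and the d squares sum to at most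
   1. *)
- rewrite /enorm -[leRHS]sqrtr1 ler_sqrt//.
  rewrite (@le_trans _ _ (\sum_(i < d) d%:R^-1))//; last first.
    by rewrite sumr_const card_ord -[_ *+ _]mulr_natr mulVf// pnatr_eq0 -lt0n.
  apply: ler_sum => i _; have /andP[h4 h5] := h3 i I.
  have di : d%:R^-1 <= 1 :> K by rewrite invf_le1 ?ltr0n// ler1n.
  by rewrite (le_trans _ h5)// ler_piMr// (le_trans h5).
- by rewrite ger0_norm.
- by rewrite /enorm sqr_sqrtr// addrC subrK; case: z {h1 h2 h3 D0}.
Qed.

End knapp_example.

(** * Upper bound for the square function *)

Lemma esum_int_box (K : realType) d n (A : K) (a : int -> 'I_d -> K) : 0 <= A ->
  (forall m i, 0 <= a m i) -> (forall m i, ~~ (0 <= m < n%:Z) -> a m i = 0) ->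
  (\esum_(k in [set: 'rV[int]_d]) (A * \prod_i a (k ord0 i) i)%:E =
   (A * \prod_i \sum_(m < n) a m%:Z i)%:E)%E.
Proof.
move=> A0 a0 aS.
pose e (g : {ffun 'I_d -> 'I_n}) : 'rV[int]_d := \row_i (g i)%:Z.
have T0 (k : 'rV[int]_d) : (0 <= (A * \prod_i a (k ord0 i) i)%:E)%E.
  by rewrite lee_fin mulr_ge0// prodr_ge0.
rewrite (esumID (range e))// setTI [X in (_ + X)%E]esum1 ?adde0; last first.
  move=> k [_ ke]; have [i hi] : exists i, ~~ (0 <= k ord0 i < n%:Z).
    apply: contrapT => H; apply: ke.
    have /choice[g Hg] : forall i, exists m : 'I_n, m%:Z = k ord0 i.
      move=> i; have : 0 <= k ord0 i < n%:Z.
        by apply: contrapT => /negP hi; apply: H; exists i.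
      case: (k ord0 i) => // m; rewrite ltz_nat /= => mn.
      by exists (Ordinal mn).
    by exists (finfun g) => //; apply/rowP => i; rewrite mxE ffunE.
  by rewrite (bigD1 i)//= aS// mul0r mulr0.
rewrite esum_image; last first.
  move=> g h _ _ /rowP gh; apply/ffunP => i; apply/val_inj.
  by have := gh i; rewrite !mxE => -[].
rewrite esum_fset; [|exact: finite_finset|by move=> g _; exact: T0].
have <- : [set` index_enum {ffun 'I_d -> 'I_n}] = setT.
  by apply/seteqP; split => // g _; rewrite /= mem_index_enum.
rewrite -fsbig_seq ?index_enum_uniq// sumEFin; congr (_ %:E).
rewrite -mulr_sumr bigA_distr_bigA; congr (_ * _); apply: eq_bigr => g _.
by apply: eq_bigr => i _; rewrite mxE.
Qed.

(** Read off from the integral as a supremum over simple functions, so that it applies to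
    [square_fun] directly, with no measurability proof. *)
Lemma ge0_le_integralT d (T : measurableType d) (K : realType)
    (m : {measure set T -> \bar K}) (f g : T -> \bar K) :
  (forall x, (0 <= f x)%E) -> (forall x, (f x <= g x)%E) ->
  (\int[m]_x f x <= \int[m]_x g x)%E.
Proof.
move=> f0 fg; have g0 x : (0 <= g x)%E by rewrite (le_trans (f0 x)).
rewrite !ge0_integralTE//; apply: ereal_sup_le => _ [h hf <-].
by exists h => // x; rewrite (le_trans (hf x)).
Qed.

Section knapp_upper.
Context {K : realType} (d : nat).
Notation E := ('rV[K]_d * K)%type.

Lemma square_fun_knappE n (R : K) (z : E) : 0 < R ->
  square_fun R (knapp n R) z =
  ((Normc.normc (cJ (bump_at (R ^+ 2) 0) 0 (2 * pi * z.2) 0) ^+ 2 *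
    \prod_(i < d) \sum_(m < n)
      Normc.normc (cJ (bump_at R m%:R) 0 (2 * pi * z.1 ord0 i) (2 * pi * z.2)) ^+ 2) `^ 2^-1)%:E.
Proof.
move=> R0; rewrite /square_fun -poweR_EFin; congr (_ `^ _)%E.
pose a m i := Normc.normc (cJ (tooth n R m) 0 (2 * pi * z.1 ord0 i) (2 * pi * z.2)) ^+ 2.
transitivity (\esum_(k in [set: 'rV[int]_d])
    (Normc.normc (cJ (bump_at (R ^+ 2) 0) 0 (2 * pi * z.2) 0) ^+ 2 *
     \prod_i a (k ord0 i) i)%:E)%E.
  apply: eq_esum => k _.
  by rewrite freq_proj_knapp// /packet Normc.normcM normc_prod exprMn -prodrXl.
rewrite (@esum_int_box K d n _ a) ?sqr_ge0// => [|m i|m i mn].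
- congr (_ * _)%:E; apply: eq_bigr => i _; apply: eq_bigr => m _.
  by rewrite /a /tooth ltz_nat ltn_ord.
- exact: sqr_ge0.
- rewrite /a (_ : tooth n R m = (fun=> 0)); last by rewrite /tooth (negbTE mn).
  have J0 th u w : J (fun=> 0 : K) th u w = 0.
    by rewrite /J /Rintegral; under eq_integral do rewrite /osc mul0r; rewrite integral0.
  by rewrite /cJ !J0 normc_sqr /= expr0n/= addr0.
Qed.

(** The square function is the square root of [A * G], and p/2 = 1 + 2/d. One power of the product
    [P] of Lorentzian sums stays for the integration in x; the other, P^(2/d), is replaced by a
    bound depending on time only. The factor R^(-2(d+2)) is R^-4 from the squared time bump and R^-2
    from each coordinate. *)
Lemma square_fun_knapp_le (p : K) : (0 < d)%N -> p = 2 * (d%:R + 2) / d%:R ->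
  exists2 Q : K, 0 < Q & forall n (R : K) (z : E), 1 <= R -> n%:R <= R ->
  (square_fun R (knapp n R) z `^ p <=
   ((Q * (R ^- 2) ^+ (d + 2)) `^ (p / 2) * (32 * pi ^+ 2 * R ^+ 2) *
    (\prod_(i < d) lor_sum n R (z.1 ord0 i) z.2 * lor (z.2 / R)))%:E)%E.
Proof.
move=> d0 pE.
have [C1 C10 H1] := @normc_bump_at_space K.
(* Squared, this order gives X^-(4d+4) with X = 1 + |t/R^2|: the spatial factors consume X^(4d), and
   the last X^4 is the loss in [lor_sum_sqr]. *)
have [C2 C20 H2] := @normc_bump_at_time K (2 * d + 2).
exists (C2 ^+ 2 * C1 ^+ d); first by rewrite mulr_gt0// exprn_gt0.
move=> n R z R1 nR.
have R0 : 0 < R by rewrite (lt_le_trans _ R1).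
rewrite square_fun_knappE//.
set A := Normc.normc _ ^+ 2; set G := \prod_(i < d) _.
set P := \prod_(i < d) _; set X := 1 + `|z.2 / R ^+ 2|.
have X1 : 1 <= X by rewrite lerDl.
have X0 : 0 < X by rewrite (lt_le_trans _ X1).
have P0 : 0 <= P by apply: prodr_ge0 => i _; exact: lor_sum_ge0.
have G0 : 0 <= G by apply: prodr_ge0 => i _; apply: sumr_ge0 => m _; exact: sqr_ge0.
have A0 : 0 <= A by exact: sqr_ge0.
have GP : G <= (C1 * R ^- 2 * X ^+ 4) ^+ d * P.
  rewrite -[X in _ ^+ X]card_ord -prodr_const -big_split /=.
  apply: ler_prod => i _; rewrite sumr_ge0 => [|m _]; last exact: sqr_ge0.
  by rewrite mulr_sumr; apply: ler_sum => m _; exact: H1.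
have AX : A <= (C2 * R ^- 2) ^+ 2 * X^-1 ^+ (4 * d + 4).
  have := H2 R z.2 R0; rewrite -/X mulrC -ler_pdivlMr ?exprn_gt0// => h.
  rewrite /A (@le_trans _ _ ((C2 * R ^- 2 / X ^+ (2 * d + 2)) ^+ 2))//.
    by rewrite lerXn2r ?nnegrE ?normc_ge0// (le_trans _ h)// normc_ge0.
  rewrite [leLHS]exprMn ler_wpM2l ?sqr_ge0// -exprVn -exprM.
  by rewrite (_ : ((2 * d + 2) * 2 = 4 * d + 4)%N)// mulnDl mulnAC.
have B2 : P ^+ 2 <= (32 * pi ^+ 2 * X ^+ 4 * R ^+ 2 * lor (z.2 / R)) ^+ d.
  set B := 32 * _ * _ * _ * _; rewrite -[leRHS](_ : \prod_(i < d) B = _); last first.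
    by rewrite prodr_const card_ord.
  rewrite /P -prodrXl; apply: ler_prod => i _; rewrite sqr_ge0/=; exact: lor_sum_sqr.
have Q0 : 0 <= C2 ^+ 2 * C1 ^+ d * (R ^- 2) ^+ (d + 2).
  by rewrite !mulr_ge0 ?exprn_ge0 ?invr_ge0 ?(ltW C10) ?(ltW C20) ?(ltW R0)// sqr_ge0.
have AG : A * G <= C2 ^+ 2 * C1 ^+ d * (R ^- 2) ^+ (d + 2) * (X ^- 4 * P).
  rewrite (le_trans (ler_pM _ _ AX GP))//.
  rewrite le_eqVlt; apply/orP; left; apply/eqP.
  have : X^-1 ^+ (4 * d) * (X ^+ 4) ^+ d = 1.
    by rewrite exprM -exprMn -exprMn mulVf ?expr1n// gt_eqF.
  rewrite (exprD X^-1 (4 * d)) [(_ * X ^+ 4) ^+ d]exprMn [(C1 * _) ^+ d]exprMn [(R ^- 2) ^+ (d + 2)]exprD -[X ^- 4]exprVn.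
  set v := X^-1 ^+ (4 * d); set w := (X ^+ 4) ^+ d => vw.
  transitivity (v * w * (C2 ^+ 2 * C1 ^+ d * ((R ^- 2) ^+ d * (R ^- 2) ^+ 2) * (X^-1 ^+ 4 * P))).
    by ring.
  by rewrite vw mul1r.
have Xi : 0 <= X ^- 4 by rewrite invr_ge0 exprn_ge0// ltW.
have XP0 : 0 <= X ^- 4 * P by exact: mulr_ge0.
have e0 : 0 <= 2 / d%:R :> K by rewrite divr_ge0.
have e1 : 0 <= 1 + 2 / d%:R :> K by rewrite addr_ge0.
have dn : d%:R != 0 :> K by rewrite pnatr_eq0 -lt0n.
have pq : 2^-1 * p = 1 + 2 / d%:R by rewrite pE; field.
rewrite poweR_EFin lee_fin -powRrM (mulrC p) pq.
rewrite (@le_trans _ _ ((C2 ^+ 2 * C1 ^+ d * (R ^- 2) ^+ (d + 2) * (X ^- 4 * P)) `^ (1 + 2 / d%:R)))//.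
  by apply: ge0_ler_powR; rewrite // nnegrE; [exact: mulr_ge0|exact: mulr_ge0 Q0 XP0].
rewrite powRM//.
rewrite -[leRHS]mulrA ler_wpM2l ?powR_ge0//.
(* [B2] bounds P^2 by a dth power, and its dth root bounds P^(2/d) uniformly in x. *)
have Pe : P `^ (2 / d%:R) <= 32 * pi ^+ 2 * X ^+ 4 * R ^+ 2 * lor (z.2 / R).
  set B := 32 * _ * _ * _ * _ in B2 *.
  have B0 : 0 <= B.
    by rewrite /B !mulr_ge0 ?lor_ge0 ?exprn_ge0 ?pi_ge0 ?(ltW X0) ?(ltW R0).
  rewrite powRrM powR_mulrn// [leRHS](_ : _ = (B ^+ d) `^ d%:R^-1).
    by rewrite ge0_ler_powR ?nnegrE ?exprn_ge0.
  by rewrite -powR_mulrn// -powRrM mulfV// powRr1.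
(* As X >= 1 and the exponent is at least 1, the power of X^-4 is at most X^-4, exactly what cancels
   the X^4 in [Pe]. *)
rewrite (@le_trans _ _ (X ^- 4 * P `^ (1 + 2 / d%:R)))//.
  rewrite ge1r_powRZ ?lerDl// invr_gt0 exprn_gt0//= invf_le1 ?exprn_gt0//.
  by rewrite exprn_ege1.
rewrite -mulr_powRB1//.
rewrite (_ : 1 + 2 / d%:R - 1 = 2 / d%:R); last by rewrite addrAC subrr add0r.
rewrite (@le_trans _ _ (X ^- 4 * (P * (32 * pi ^+ 2 * X ^+ 4 * R ^+ 2 * lor (z.2 / R)))))//.
  by rewrite ler_wpM2l// ler_wpM2l.
rewrite le_eqVlt; apply/orP; left; apply/eqP; field.
by rewrite gt_eqF.
Qed.

End knapp_upper.

Section knapp_upper_integral.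
Context {K : realType} (d : nat).
Notation E := ('rV[K]_d * measurableTypeR K)%type.

Let majorant n (R : K) (z : E) : K :=
  \prod_(i < d) lor_sum n R (z.1 ord0 i) z.2 * lor (z.2 / R).

Let majorant_ge0 n R z : 0 <= majorant n R z.
Proof. by rewrite mulr_ge0 ?lor_ge0// prodr_ge0// => i _; exact: lor_sum_ge0. Qed.

Let measurable_majorant n R : measurable_fun setT (majorant n R).
Proof.
have m2 : measurable_fun setT (@snd 'rV[K]_d (measurableTypeR K)) by exact: measurable_snd.
have m1 i : measurable_fun setT (fun z : E => z.1 ord0 i).
  exact: (measurableT_comp (@measurable_coord _ (measurableTypeR K) d i) measurable_fst).
apply: measurable_funM; last first.
  by apply: (measurableT_comp measurable_lor); exact: measurable_funM.
apply: measurable_prod => i _; apply: measurable_sum => k.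
apply: (measurableT_comp measurable_lor); apply: measurable_funD.
  exact: measurable_funM.
by do 2 apply: measurable_funM => //; exact: measurable_funM.
Qed.

(** At every time the spatial integral is n pi R per coordinate, since moving the Lorentzians along
    their rays does not change their mass; only [lor (t / R)] then remains to be integrated in t. *)
Let integral_majorant n (R : K) : 0 < R ->
  (\int[lebesgue_st d]_z (majorant n R z)%:E = ((n%:R * (pi * R)) ^+ d * (pi * R))%:E)%E.
Proof.
move=> R0.
rewrite /lebesgue_st fubini_tonelli2//=; last 2 first.
- by apply/measurable_EFinP; exact: measurable_majorant.
- by move=> z; rewrite lee_fin.
rewrite /fubini_G /=.
under eq_integral => t _.
  rewrite (_ : (\int[_]_x _ = ((n%:R * (pi * R)) ^+ d)%:E * (lor (t / R))%:E)%E); last first.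
    have [I1 I2] := @Rintegral_lebesgue_rV_prod K d (fun _ x => lor_sum n R x t)
      (fun _ => (integral_lor_sum n t R0).1).
    rewrite /majorant /=.
    under eq_integral do rewrite EFinM.
    rewrite ge0_integralZr//; last 3 first.
    + by case/integrableP: I1.
    + by move=> x _; rewrite lee_fin prodr_ge0// => i _; exact: lor_sum_ge0.
    + by rewrite lee_fin lor_ge0.
    congr (_ * _)%E; rewrite -[LHS]fineK ?integrable_fin_num//; congr EFin.
    apply: (etrans I2); under eq_bigr do rewrite (integral_lor_sum n t R0).2.
    by rewrite prodr_const card_ord.
  over.
rewrite ge0_integralZl//; last 3 first.
- apply/measurable_EFinP; apply: (measurableT_comp measurable_lor).
  exact: measurable_funM.
- by move=> t _; rewrite lee_fin lor_ge0.
- by rewrite lee_fin exprn_ge0// mulr_ge0// mulr_ge0 ?pi_ge0// ltW.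
rewrite EFinM; congr (_ * _)%E.
have := @integral_lor_affine K R^-1 0; rewrite invr_gt0 invrK => <-//.
by apply: eq_integral => t _; rewrite addr0 mulrC.
Qed.

(** The power R^(2d+3) collects R^2 from the pointwise bound, R^2 per coordinate from n pi R with n
    <= R, and R from the integral in time. *)
Lemma integral_square_fun_knapp (p : K) : (0 < d)%N -> p = 2 * (d%:R + 2) / d%:R ->
  exists Q L : K, [/\ 0 < Q, 0 < L & forall n (R : K), 1 <= R -> n%:R <= R ->
  (\int[lebesgue_st d]_z (square_fun R (knapp n R) z `^ p) <=
   ((Q * (R ^- 2) ^+ (d + 2)) `^ (p / 2) * (L * R ^+ (2 * d + 3)))%:E)%E].
Proof.
move=> d0 pE; have [Q Q0 HQ] := square_fun_knapp_le d0 pE.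
exists Q, (32 * pi ^+ 2 * pi ^+ d * pi); split=> //.
  by rewrite !mulr_gt0 ?exprn_gt0 ?pi_gt0.
move=> n R R1 nR; have R0 : 0 < R by rewrite (lt_le_trans _ R1).
pose c := (Q * (R ^- 2) ^+ (d + 2)) `^ (p / 2) * (32 * pi ^+ 2 * R ^+ 2).
apply: (@le_trans _ _ (\int[lebesgue_st d]_z (c * majorant n R z)%:E)%E).
  by apply: ge0_le_integralT => z; [exact: poweR_ge0|exact: HQ].
have q0 : 0 <= 32 * pi ^+ 2 * R ^+ 2.
  by apply: mulr_ge0; [apply: mulr_ge0 => //; exact: sqr_ge0|exact: sqr_ge0].
have c0 : 0 <= c.
  by apply: mulr_ge0; [exact: powR_ge0|exact: q0].
under eq_integral do rewrite EFinM.
rewrite ge0_integralZl//; last 2 first.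
- by apply/measurable_EFinP; exact: measurable_majorant.
- by move=> z _; rewrite lee_fin; exact: majorant_ge0.
rewrite integral_majorant// -EFinM lee_fin /c -[leLHS]mulrA ler_wpM2l ?powR_ge0//.
rewrite (@le_trans _ _ (32 * pi ^+ 2 * R ^+ 2 * ((R * (pi * R)) ^+ d * (pi * R))))//.
  apply: ler_wpM2l; first exact: q0.
  rewrite ler_wpM2r ?mulr_ge0 ?pi_ge0 ?(ltW R0)//.
  have pR : 0 <= pi * R by rewrite mulr_ge0 ?pi_ge0 ?(ltW R0).
  apply: lerXn2r; last exact: ler_wpM2r.
  - by rewrite nnegrE; exact: mulr_ge0.
  - by rewrite nnegrE; apply: mulr_ge0 => //; exact: ltW.
rewrite (mulrCA R) (exprMn d pi) [R ^+ (2 * d + 3)]exprD [R ^+ (2 * d)]exprM.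
by rewrite le_eqVlt; apply/orP; left; apply/eqP; ring.
Qed.

End knapp_upper_integral.

(** * Lower bound near the origin *)

Section knapp_lower.
Context {K : realType} (d : nat).
Notation mu := (@lebesgue_measure K).
Notation E := ('rV[K]_d * measurableTypeR K)%type.

(** Chosen so that |2 pi x| <= 1/4 on [0, r]: a linear and a quadratic coefficient of this size add
    up to the 1/2 allowed by [J_lower]. *)
Let r : K := (8 * pi)^-1.

Let r_gt0 : 0 < r. Proof. by rewrite invr_gt0 mulr_gt0// pi_gt0. Qed.

Let pir x : 0 <= x <= r -> `|2 * pi * x| <= 4^-1.
Proof.
move=> /andP[x0 xr]; have p0 : 0 < pi :> K by exact: pi_gt0.
rewrite ger0_norm; last by apply: mulr_ge0 => //; apply: mulr_ge0 => //; exact: ltW.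
rewrite (@le_trans _ _ (2 * pi * r))//.
  by apply: ler_wpM2l => //; apply: mulr_ge0 => //; exact: ltW.
rewrite /r; move: p0; move: (pi : K) => q q0.
by rewrite [leLHS](_ : _ = 4^-1)//; field; rewrite gt_eqF.
Qed.

Lemma normc_knapp_ge : (0 < d)%N -> exists2 c : K, 0 < c & forall n (R : K) (z : E),
  1 <= R -> R = d%:R * n%:R -> (forall i, 0 <= z.1 ord0 i <= r) -> 0 <= z.2 <= r ->
  c * R ^- 2 <= Normc.normc (knapp n R z).
Proof.
move=> d0; set I0 := J unit_bump 0 0 0 : K.
have I00 : 0 < I0 by exact: J0_unit_bump_gt0.
have dg0 : 0 < d%:R :> K by rewrite ltr0n.
(* The time factor contributes I0 R^-2 / 2. In each coordinate n bumps of mass I0 / R add up to I0 /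
   d, because R = d n, and [J_lower], applied to the whole comb at once, keeps half of it. *)
exists (I0 / 2 * (I0 / d%:R / 2) ^+ d).
  by rewrite mulr_gt0 ?exprn_gt0 ?divr_gt0.
move=> n R z R1 RE z1 z2.
have R0 : 0 < R by rewrite (lt_le_trans _ R1).
have R2 : 0 < R ^+ 2 by rewrite exprn_gt0.
have n0 : n%:R != 0 :> K by apply: contraTneq R0 => n0; rewrite RE n0 mulr0 ltxx.
have h2 := pir z2.
rewrite /knapp /packet Normc.normcM normc_prod [leLHS]mulrAC.
apply: ler_pM.
- by rewrite mulr_ge0 ?invr_ge0 ?(ltW R2)// divr_ge0// ltW.
- by rewrite exprn_ge0// divr_ge0// divr_ge0// ltW.
- rewrite (le_trans _ (normc_Re _))//= (le_trans _ (ler_norm _))//.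
  rewrite mulrAC (mulrC I0) -(@J_bump_at0 K _ 0)//; apply: J_lower.
  + exact: testfun_bump_at.
  + by move=> x; exact: unit_bump_ge0.
  + move=> x; apply: contraNeq; apply: contraNT => h; apply/eqP/unit_bump_eq0.
    rewrite subr0; apply: contra h => /andP[h3 h4].
    move: h3; rewrite pmulr_rgt0// => x0; rewrite (ltW x0)/=.
    by rewrite (le_trans _ (ltW h4))// ler_peMl ?(ltW x0)// exprn_ege1.
  + by rewrite normr0; lra.
- rewrite -[leLHS](_ : \prod_(i < d) (I0 / d%:R / 2) = _); last first.
    by rewrite prodr_const card_ord.
  apply: ler_prod => i _; apply/andP; split.
    by rewrite divr_ge0// divr_ge0// ltW.
  rewrite (le_trans _ (normc_Re _))//= (le_trans _ (ler_norm _))//.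
  rewrite -[I0 / d%:R](_ : J (comb n R) 0 0 0 = _); last first.
    rewrite /comb J_sum => [|k]; last exact: testfun_bump_at.
    under eq_bigr do rewrite J_bump_at0//.
    rewrite sumr_const card_ord -/I0 RE -mulr_natr; field.
    by rewrite n0 gt_eqF.
  apply: J_lower.
  + exact: testfun_comb.
  + exact: comb_ge0.
  + move=> x h; apply: contraNeq h => /(comb_support R0) /andP[-> h]/=.
    rewrite (le_trans h)// RE invfM mulrCA mulfV// mulr1.
    by rewrite invf_le1// ler1n.
  + have := pir (z1 i); lra.
Qed.

Lemma integral_knapp_ge (p : K) : (0 < d)%N -> 0 < p ->
  exists c v : K, [/\ 0 < c, 0 < v & forall n (R : K), 1 <= R -> R = d%:R * n%:R ->
  (((c * R ^- 2) `^ p * v)%:E <=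
   \int[lebesgue_st d]_z ((Normc.normc (knapp n R z))%:E `^ p))%E].
Proof.
move=> d0 p0; have [c c0 Hc] := normc_knapp_ge d0.
(* The second witness is the volume of the box [0, r]^(d+1), on which the pointwise bound holds. *)
exists c, (r ^+ d * r); split=> // [|n R R1 RE]; first by rewrite mulr_gt0 ?exprn_gt0.
have R0 : 0 < R by rewrite (lt_le_trans _ R1).
pose B1 : set 'rV[K]_d := [set v | forall i, `[0, r]%classic (v ord0 i)].
have mB1 : measurable B1.
  rewrite (_ : B1 = \bigcap_(i in [set: 'I_d]) [set v | `[0, r]%classic (v ord0 i)]); last first.
    by apply/seteqP; split => x /= h => [i _|i]; exact: h.
  apply: fin_bigcap_measurable => // i _; rewrite -[X in measurable X]setTI.
  by apply: (@measurable_coord _ (measurableTypeR K) d i) => //; exact: measurable_itv.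
have mB : measurable (B1 `*` `[0, r]%classic : set E).
  by apply: measurableX => //; exact: measurable_itv.
have Er : mu `[0, r]%classic = r%:E.
  by rewrite lebesgue_measure_itv/= lte_fin r_gt0 oppr0 addr0.
have muB : lebesgue_st d (B1 `*` `[0, r]%classic) = (r ^+ d * r)%:E.
  rewrite /lebesgue_st product_measure1E; [|exact: mB1|exact: (measurable_itv `[0, r])].
  have B1E : lebesgue_rV d B1 = (r ^+ d)%:E.
    rewrite (@lebesgue_rV_box K d (fun=> `[0, r]%classic)); last first.
      by move=> _; exact: (measurable_itv `[0, r]).
    by under eq_bigr do rewrite Er; rewrite prodEFin prodr_const card_ord.
  by rewrite EFinM; exact: (congr2 mule B1E Er).
rewrite EFinM -muB -integral_cst// integral_mkcond.
apply: ge0_le_integralT => z; rewrite patchE; case: ifPn => //.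
- by move=> _; rewrite lee_fin powR_ge0.
- move=> /set_mem[/= z1 z2].
  rewrite lee_fin ge0_ler_powR ?nnegrE ?(ltW p0) ?normc_ge0//.
    by apply: mulr_ge0; [exact: ltW|rewrite invr_ge0 exprn_ge0// ltW].
  by apply: Hc => // i; have := z1 i; rewrite /= in_itv.
- by move=> _; exact: poweR_ge0.
Qed.

End knapp_lower.

(** * Comparison of powers of R *)

Lemma knapp_scaling (K : realType) (d : nat) (s p : K) (hd : (0 < d)%N)
    (hp : p = 2 * (d%:R + 2) / d%:R) (C : K) (C0 : 0 < C)
    (hsq : forall R : K, 1 <= R ->
      forall F : 'rV[K]_d * K -> K[i],
        schwartz F ->
        fsupp (fourier F) `<=` paraboloid_nbhd d R ->
        ('N[lebesgue_st d]_p%:E[(fun x => (Normc.normc (F x))%:E)] <=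
           (C * R `^ s)%:E * 'N[lebesgue_st d]_p%:E[square_fun R F])%E) :
  exists c C' : K, [/\ 0 < c, 0 < C' & forall n : nat, (0 < n)%N ->
    c <= C' * (d%:R * n%:R) `^ (s * p - 1)].
Proof.
have dg0 : 0 < d%:R :> K by rewrite ltr0n.
have p0 : 0 < p by rewrite hp divr_gt0// mulr_gt0// addr_gt0.
have [Q [L [Q0 L0 HU]]] := integral_square_fun_knapp hd hp.
have [c [v [c0 v0 HL]]] := integral_knapp_ge hd p0.
exists (c `^ p * v), (C `^ p * Q `^ (p / 2) * L); split.
- by rewrite mulr_gt0// powR_gt0.
- by rewrite !mulr_gt0 ?powR_gt0.
move=> n n0; set R : K := d%:R * n%:R.
have n1 : 1 <= n%:R :> K by rewrite ler1n.
have d1 : 1 <= d%:R :> K by rewrite ler1n.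
have nR : n%:R <= R by rewrite ler_peMl.
have RE : R = d%:R * n%:R by [].
clearbody R.
have R1 : 1 <= R by rewrite (le_trans n1).
have R0 : 0 < R by rewrite (lt_le_trans _ R1).
have R2 : 0 < R ^+ 2 by rewrite exprn_gt0.
have sF : schwartz (knapp (d := d) n R).
  by apply: schwartz_packet => [|_]; [exact: testfun_bump_at|exact: testfun_comb].
have fF : fsupp (fourier (knapp n R)) `<=` paraboloid_nbhd d R.
  apply: fsupp_knapp => //; rewrite RE invfM mulrCA mulfV ?mulr1//.
  by rewrite gt_eqF// (lt_le_trans _ n1).
have pn : p != 0 by rewrite gt_eqF.
have SF0 x : (0 <= square_fun R (knapp (d := d) n R) x)%E by exact: poweR_ge0.
have : (((c * R ^- 2) `^ p * v)%:E <= ((C * R `^ s) `^ p *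
    ((Q * (R ^- 2) ^+ (d + 2)) `^ (p / 2) * (L * R ^+ (2 * d + 3))))%:E)%E.
  rewrite (le_trans (HL n R R1 RE))//.
  have CR : 0 <= C * R `^ s by rewrite mulr_ge0 ?powR_ge0// ltW.
  have := hsq R R1 _ sF fF.
  move=> /(@gt0_ler_poweR _ p (ltW p0)) h.
  have {h} := h _ _.
  rewrite !in_itv/= !leey !andbT !Lnorm_ge0 mule_ge0 ?Lnorm_ge0// => /(_ isT isT).
  rewrite poweRM ?Lnorm_ge0// !poweR_Lnorm// poweR_EFin => h.
  under eq_integral do rewrite -(ger0_norm (normc_ge0 _)).
  rewrite (le_trans h)// EFinM lee_wpmul2l ?lee_fin ?powR_ge0//.
  under eq_integral do rewrite gee0_abs//.
  exact: HU.
rewrite lee_fin.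
have e2 : R ^- 2 = R `^ (- 2%:R) by rewrite powR_invn// ltW.
rewrite e2 -(powR_mulrn (d + 2) (powR_ge0 _ _)) -(powR_mulrn (2 * d + 3) (ltW R0)).
rewrite !powRM ?powR_ge0 ?(ltW c0) ?(ltW C0) ?(ltW Q0)// -!powRrM => h.
rewrite -(@ler_pM2r _ (R `^ (- 2%:R * p))) ?powR_gt0//.
rewrite [leLHS](_ : _ = c `^ p * R `^ (- 2%:R * p) * v); last by ring.
rewrite (le_trans h)// le_eqVlt; apply/orP; left; apply/eqP.
(* Besides s p the exponent is - (d+2) p + 2d + 3 + 2p = - d p + 2d + 3, which is -1 because d p =
   2d + 4. *)
have E : s * p + - 2%:R * ((d + 2)%:R * (p / 2)) + (2 * d + 3)%:R - - 2%:R * p = s * p - 1.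
  by rewrite hp; field; rewrite gt_eqF.
have -> : R `^ (s * p - 1) = R `^ (s * p) * R `^ (- 2%:R * ((d + 2)%:R * (p / 2))) *
    R `^ (2 * d + 3)%:R / R `^ (- 2%:R * p).
  rewrite -powRN -!powRD ?(gt_eqF R0) ?implybT//.
  by rewrite E.
by field; rewrite gt_eqF// powR_gt0.
Qed.

Theorem proposition3 (K : realType) (d : nat) (s p : K) (hd : (1 <= d)%N)
    (hs : 0 < s) (hp : p = 2 * (d%:R + 2) / d%:R)
    (hsq : exists2 C : K, 0 < C &
      forall R : K, 1 <= R ->
      forall F : 'rV[K]_d * K -> K[i],
        schwartz F ->
        fsupp (fourier F) `<=` paraboloid_nbhd d R ->
        ('N[lebesgue_st d]_p%:E[(fun x => (Normc.normc (F x))%:E)] <=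
           (C * R `^ s)%:E * 'N[lebesgue_st d]_p%:E[square_fun R F])%E) :
  d%:R / 2 - (d%:R + 1) / p <= s.
Proof.
case: hsq => C C0 hsq.
have d0 : 0 < d%:R :> K by rewrite ltr0n.
have p0 : 0 < p by rewrite hp divr_gt0// mulr_gt0// addr_gt0.
(* Since d/2 = (d+2)/p, the threshold equals 1/p. *)
rewrite (_ : _ - _ = p^-1); last first.
  rewrite hp; field; rewrite (gt_eqF d0) gt_eqF// addr_gt0//.
have [c [C' [c0 C'0 H]]] := knapp_scaling hd hp C0 hsq.
rewrite -(ler_pM2r p0) mulVf ?gt_eqF// leNgt; apply/negP => sp.
pose e := 1 - s * p; have e0 : 0 < e by rewrite subr_gt0.
have M0 : 0 < C' / c by rewrite divr_gt0.
(* If s p < 1, then e > 0 and this choice gives R^e >= n^e > C'/c, contradicting c <= C' R^(-e); the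
   successor ensures n > 0. *)
pose n := (Num.bound ((C' / c) `^ e^-1)).+1.
have nM : (C' / c) `^ e^-1 < n%:R.
  rewrite (lt_le_trans (archi_boundP (powR_ge0 _ _)))// ler_nat//.
have := H n isT; set R : K := d%:R * n%:R.
have nR : n%:R <= R by rewrite ler_peMl// ler1n.
have R0 : 0 < R by rewrite mulr_gt0// ltr0n.
have : C' / c < R `^ e.
  rewrite -[ltLHS](powRr1 (ltW M0)) -(mulVf (lt0r_neq0 e0)) powRrM.
  by rewrite gt0_ltr_powR ?nnegrE ?powR_ge0 ?(ltW R0)// (lt_le_trans nM).
rewrite -opprB -/e powRN ltr_pdivrMr// mulrC => h.
by rewrite ler_pdivlMr ?powR_gt0// leNgt h.
Qed.
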